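(* For every finite connected weighted undirected graph $G=(V,(c_{xy})_{x,y\in V})$, all positive weights $\alpha=(\alpha_x)_{x\in V}$, and all $\kappa\in(0,\alpha_{\min})$ with $\alpha_{\min}=\min_{x\in V}\alpha_x$, the spectral gap $\mathrm{gap}(G,\alpha,\kappa)$ of the immediate exchange model (IEM) on $G$ with parameters $\alpha,\kappa$ satisfies $$\big(1\wedge\gamma_{\rm IEM}(G,\alpha,\kappa)\big)\,\mathrm{gap}_1(G,\alpha,\kappa)\le \mathrm{gap}(G,\alpha,\kappa)\le \mathrm{gap}_1(G,\alpha,\kappa),$$ where $$\gamma_{\rm IEM}(G,\alpha,\kappa)= \min_{x\neq y\,:\,c_{xy}>0}\Big\{\frac{\alpha_x-\kappa}{\alpha_x+1}+\frac{\alpha_y-\kappa}{\alpha_y+1}\Big\}\Big(1+\frac1{|\alpha|}\Big),\qquad |\alpha|=\sum_{x\in V}\alpha_x .$$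
   Context: $a\wedge b=\min\{a,b\}$. $V$ is a finite set with $|V|=n\ge 2$; $c_{xy}=c_{yx}\ge 0$ are symmetric edge weights ($c_{xx}=0$), and $G$ is connected through the edges with $c_{xy}>0$. The state space is $\Omega=\{\eta=(\eta_x)_{x\in V}:\eta_x\ge 0,\ \sum_{x\in V}\eta_x=1\}$. Immediate exchange model: for each unordered pair $\{x,y\}$ of distinct vertices, at rate $c_{xy}$, independent random variables $U\sim\mathrm{Beta}(\alpha_x-\kappa,\kappa)$ and $W\sim\mathrm{Beta}(\alpha_y-\kappa,\kappa)$ are sampled, and $(\eta_x,\eta_y)$ is replaced by $(U\eta_x+(1-W)\eta_y,(1-U)\eta_x+W\eta_y)$, all other coordinates being unchanged. Its generator is $$\mathcal L f(\eta)=\sum_{\{x,y\}\subset V,\,x\neq y}c_{xy}\,\mathbb E\big[f(\eta^{xy,U,W})-f(\eta)\big],$$ where $\eta^{xy,U,W}$ is the updated configuration just described. It is reversible with respect to the Dirichlet distribution $\mu\sim\mathrm{Dir}(\alpha)$ on $\Omega$, i.e. the probability measure with density proportional to $\prod_{x\in V}\eta_x^{\alpha_x-1}$ with respect to the uniform measure on $\Omega$. Write $\mu f=\int f\,\mathrm d\mu$ and $\mathcal D(f)=\langle f,-\mathcal L f\rangle_{L^2(\mu)}$. Define $$\mathrm{gap}(G,\alpha,\kappa)=\inf\{\mathcal D(f): f\in L^2(\mu),\ \|f-\mu f\|_{L^2(\mu)}=1\},\qquad \mathrm{gap}_1(G,\alpha,\kappa)=\inf\{\mathcal D(f): f\in \mathscr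 P_1,\ \|f-\mu f\|_{L^2(\mu)}=1\},$$ where $\mathscr P_1$ is the space of polynomial functions on $\Omega$ of degree at most $1$ in the variables $(\eta_x)_{x\in V}$. *)

(* Defs.v *)
From HB Require Import structures.
From mathcomp Require Import all_boot all_order all_algebra.
From mathcomp Require Import all_classical all_reals all_analysis.
From mathcomp Require Import measurable_realfun ring.

Set Implicit Arguments.
Unset Strict Implicit.
Unset Printing Implicit Defensive.

Import Order.TTheory GRing.Theory Num.Theory.
Import numFieldNormedType.Exports.

Local Open Scope classical_set_scope.
Local Open Scope ring_scope.

(* The measure with density [f] with respect to [m]. *)
Section density_measure.
Context d (T : measurableType d) (R : realType).
Variables (m : {measure set T -> \bar R}) (f : T -> R).
Hypotheses (mf : measurable_fun [set: T] f) (f0 : forall x, 0 <= f x).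

Definition density_measure of measurable_fun [set: T] f & (forall x, 0 <= f x) :=
  fun A : set T => (\int[m]_(x in A) (f x)%:E)%E.

Local Notation nu := (density_measure mf f0).

Let nu0 : nu set0 = 0%E.
Proof. exact: integral_set0. Qed.

Let nu_ge0 A : (0 <= nu A)%E.
Proof. by apply: integral_ge0 => x _; rewrite lee_fin. Qed.

Let nu_sigma_additive : semi_sigma_additive nu.
Proof.
move=> /= F mF tF mUF; rewrite /density_measure; apply: cvg_toP.
  apply: ereal_nondecreasing_is_cvgn => m1 n mn.
  apply: lee_sum_nneg_natr => // k _ _.
  by apply: integral_ge0 => /= x _; rewrite lee_fin.
rewrite ge0_integral_bigcup//=.
- by apply/measurable_EFinP; exact: measurable_funTS.
- by move=> x _; rewrite lee_fin.
Qed.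

HB.instance Definition _ := isMeasure.Build _ _ _ nu nu0 nu_ge0 nu_sigma_additive.

End density_measure.

(* Lebesgue measure on R^n, as an iterated product. *)
Section lebesgue_tuple.
Context (R : realType).

Definition tuple_cons n (p : measurableTypeR R * n.-tuple R) : n.+1.-tuple R :=
  [the n.+1.-tuple R of p.1 :: p.2].

Lemma measurable_tuple_cons n : measurable_fun [set: _] (@tuple_cons n).
Proof. exact: measurable_cons. Qed.

Section step.
Context n (m : {sigma_finite_measure set (n.-tuple R) -> \bar R}).

Definition lebesgue_cons : set (n.+1.-tuple R) -> \bar R :=
  pushforward (@lebesgue_measure R \x m)%E (@tuple_cons n).

Let lebesgue_cons0 : lebesgue_cons set0 = 0%E.
Proof. by rewrite /lebesgue_cons /pushforward preimage_set0 measure0. Qed.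

Let lebesgue_cons_ge0 A : (0 <= lebesgue_cons A)%E.
Proof. exact: (measure_ge0 (@lebesgue_measure R \x m)%E). Qed.

Let lebesgue_cons_sigma_additive : semi_sigma_additive lebesgue_cons.
Proof.
exact: (@measure_semi_sigma_additive _ _ _
  (pushforward (@lebesgue_measure R \x m)%E (mfun_Sub (mem_set (@measurable_tuple_cons n))))).
Qed.

HB.instance Definition _ := isMeasure.Build _ _ _ lebesgue_cons
  lebesgue_cons0 lebesgue_cons_ge0 lebesgue_cons_sigma_additive.

Let lebesgue_cons_sigma_finite : sigma_finite [set: _] lebesgue_cons.
Proof.
have /sigma_finiteP[F [FT ndF Ffin]] := sigma_finiteT (@lebesgue_measure R).
have /sigma_finiteP[G [GT ndG Gfin]] := sigma_finiteT m.
pose u (t : n.+1.-tuple R) : measurableTypeR R * n.-tuple R :=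
  (thead t, [tuple of behead t]).
have mu : measurable_fun [set: _] u.
  apply/measurable_fun_pairP; split; first exact: measurable_tnth.
  exact: measurable_behead.
have uK : u \o @tuple_cons n = id.
  by apply/funext => -[a t]; congr pair; exact/val_inj.
exists (fun k => u @^-1` (F k `*` G k)).
  apply/esym; rewrite -subTset => t _.
  have [i _ Fi] : (\bigcup_i F i) (u t).1 by rewrite -FT.
  have [j _ Gj] : (\bigcup_i G i) (u t).2 by rewrite -GT.
  exists (maxn i j) => //; split.
  - by move: Fi; exact/subsetPset/ndF/leq_maxl.
  - by move: Gj; exact/subsetPset/ndG/leq_maxr.
move=> k; have [mFk Fk] := Ffin k; have [mGk Gk] := Gfin k; split.
  by rewrite -[X in measurable X]setTI; apply: mu => //; exact: measurableX.
rewrite /lebesgue_cons /pushforward -comp_preimage uK preimage_id.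
by rewrite product_measure1E// lte_mul_pinfty// ge0_fin_numE.
Qed.

HB.instance Definition _ := Measure_isSigmaFinite.Build _ _ _ lebesgue_cons
  lebesgue_cons_sigma_finite.

End step.

Fixpoint lebesgue_tuple n : {sigma_finite_measure set (n.-tuple R) -> \bar R} :=
  match n with
  | 0 => \d_([tuple] : 0.-tuple R)
  | n'.+1 => lebesgue_cons (lebesgue_tuple n')
  end.

End lebesgue_tuple.

(* The Beta(a, b) law for real a, b > 0 ([beta_prob] of the library only has
   natural parameters). If a <= 0 or b <= 0, the weight has infinite mass and
   [mnormalize] returns the dummy Dirac mass. *)
Section beta_law.
Context (R : realType) (a b : R).

Definition beta_weight : measurableTypeR R -> R :=
  (fun x => x `^ (a - 1) * (1 - x) `^ (b - 1)) \_ `]0, 1[.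

Lemma measurable_beta_weight : measurable_fun [set: _] beta_weight.
Proof.
apply/measurable_restrict => //; apply: measurable_funTS.
apply: measurable_funM; first exact: measurable_powR.
apply: (measurableT_comp (measurable_powR _)).
exact: measurable_funB.
Qed.

Lemma beta_weight_ge0 x : 0 <= beta_weight x.
Proof. by rewrite /beta_weight patchE; case: ifP => // _; rewrite mulr_ge0 ?powR_ge0. Qed.

Definition beta_law : probability (measurableTypeR R) R :=
  mnormalize
    (density_measure (@lebesgue_measure R) measurable_beta_weight beta_weight_ge0)
    (dirac (0 : measurableTypeR R)).

End beta_law.

(* Configurations are the tuples of length n = #|V|; the coordinate eta_x is
   stored at position [enum_rank x]. The state space Omega is the subset
   [simplex]; the laws below are carried by it ([dirichlet_simplex]) and the moves
   preserve it ([exchange_simplex]), so that a function on Omega is represented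
   by any measurable function on R^V extending it. *)
Notation config V R := (#|V|.-tuple R).

Section dirichlet.
Context (R : realType) (V : finType).
Implicit Types (eta : config V R) (alpha : V -> R).

Definition coord eta (x : V) : R := tnth eta (enum_rank x).

Definition config_of (g : V -> R) : config V R := [tuple g (enum_val i) | i < #|V|].

Lemma coord_config_of g x : coord (config_of g) x = g x.
Proof. by rewrite /coord tnth_mktuple enum_rankK. Qed.

Lemma measurable_coord x : measurable_fun [set: config V R] (coord ^~ x).
Proof. exact: measurable_tnth. Qed.

Definition simplex : set (config V R) :=
  [set eta | (forall x, 0 <= coord eta x) /\ \sum_x coord eta x = 1].

Lemma measurable_simplex : measurable simplex.
Proof.
have -> : simplex =
    (\bigcap_(x in [set: V]) ((coord ^~ x) @^-1` `[0, +oo[)) `&`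
    ((fun eta : config V R => \sum_x coord eta x) @^-1` [set 1]).
  apply/seteqP; split=> eta /=.
    by move=> [eta0 eta1]; split=> // x _ /=; rewrite in_itv/= eta0.
  move=> [eta0 eta1]; split=> // x.
  by have := eta0 x I; rewrite /= in_itv/= andbT.
apply: measurableI.
  apply: fin_bigcap_measurable => // x _.
  by rewrite -[X in measurable X]setTI; apply: measurable_coord.
rewrite -[X in measurable X]setTI.
by apply: measurable_sum => // x; exact: measurable_coord.
Qed.

Definition corner_simplex n : set (n.-tuple R) :=
  [set t | (forall i, 0 <= tnth t i) /\ \sum_i tnth t i <= 1].

Lemma measurable_corner_simplex n : measurable (@corner_simplex n).
Proof.
have -> : @corner_simplex n =
    (\bigcap_(i in [set: 'I_n]) ((fun t : n.-tuple R => tnth t i) @^-1` `[0, +oo[)) `&`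
    ((fun t : n.-tuple R => \sum_i tnth t i) @^-1` `]-oo, 1]).
  apply/seteqP; split=> t /=.
    by move=> [t0 t1]; split=> [i _ /=|]; rewrite in_itv/= ?t0.
  move=> [t0]; rewrite in_itv/= => t1; split=> // i.
  by have := t0 i I; rewrite /= in_itv/= andbT.
apply: measurableI.
  apply: fin_bigcap_measurable => // i _.
  by rewrite -[X in measurable X]setTI; apply: measurable_tnth.
rewrite -[X in measurable X]setTI.
by apply: measurable_sum => // i; exact: measurable_tnth.
Qed.

(* The affine chart of Omega by its first n - 1 coordinates; the [nth] default
   1 - sum t is reached exactly by the last vertex. The chart only changes the
   normalisation of Lebesgue measure, not the resulting uniform law. *)
Definition simplex_chart (t : #|V|.-1.-tuple R) : config V R :=
  config_of (fun x => nth (1 - \sum_i tnth t i) t (enum_rank x)).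

Lemma measurable_simplex_chart : measurable_fun [set: _] simplex_chart.
Proof.
apply/measurable_fun_tnthP => i.
have -> : (@tnth _ R)^~ i \o simplex_chart =
    (fun t : #|V|.-1.-tuple R => nth (1 - \sum_i tnth t i) t i).
  by apply/funext => t; rewrite /= tnth_mktuple enum_valK.
have [ilt|ige] := ltnP i #|V|.-1.
  rewrite (_ : (fun t => _) = (@tnth _ R)^~ (Ordinal ilt)); last first.
    by apply/funext => t; rewrite (tnth_nth (1 - \sum_i tnth t i)).
  exact: measurable_tnth.
rewrite (_ : (fun t => _) = fun t : #|V|.-1.-tuple R => 1 - \sum_i tnth t i); last first.
  by apply/funext => t; rewrite nth_default// size_tuple.
apply: measurable_funB => //.
by apply: measurable_sum => j; exact: measurable_tnth.
Qed.

Lemma simplex_chart_simplex (t : #|V|.-1.-tuple R) :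
  (0 < #|V|)%N -> corner_simplex t -> simplex (simplex_chart t).
Proof.
move=> V0 [t0 t1]; split=> [x|].
  rewrite coord_config_of; have [xlt|xge] := ltnP (enum_rank x) #|V|.-1.
    by have := t0 (Ordinal xlt); rewrite (tnth_nth (1 - \sum_i tnth t i)).
  by rewrite nth_default ?size_tuple// subr_ge0.
under eq_bigr do rewrite coord_config_of.
set d := 1 - _.
rewrite (reindex_onto (@enum_val V V) (@enum_rank V))/=; last first.
  by move=> x _; exact: enum_rankK.
under eq_bigl do rewrite enum_valK eqxx.
under eq_bigr do rewrite enum_valK.
rewrite -(big_mkord xpredT (fun i => nth d t i)).
transitivity (\sum_(0 <= i < #|V|.-1.+1) nth d t i); first by rewrite (prednK V0).
rewrite big_nat_recr//=.
rewrite nth_default ?size_tuple// big_mkord.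
by under eq_bigr do rewrite -tnth_nth; rewrite addrC subrK.
Qed.

HB.instance Definition _ := isMeasurableFun.Build _ _ _ _
  simplex_chart measurable_simplex_chart.

Definition uniform_simplex : probability (config V R) R :=
  distribution
    (mnormalize (mrestr (@lebesgue_tuple R #|V|.-1)
                        (@measurable_corner_simplex #|V|.-1))
                (dirac ([tuple of nseq #|V|.-1 0] : #|V|.-1.-tuple R)))
    simplex_chart.

Lemma uniform_simplex_simplex :
  (0 < #|V|)%N -> uniform_simplex simplex = 1%E.
Proof.
move=> V0; apply/eqP; rewrite eq_le probability_le1/=; last exact: measurable_simplex.
set t0 : #|V|.-1.-tuple R := [tuple of nseq #|V|.-1 0].
pose P : probability (#|V|.-1.-tuple R) R :=
  mnormalize (mrestr (@lebesgue_tuple R #|V|.-1)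
    (@measurable_corner_simplex #|V|.-1)) (dirac t0).
have P1 : P (@corner_simplex #|V|.-1) = 1%E.
  rewrite -(probability_setT P) /P/= /mnormalize.
  case: ifP => _; last first.
    by congr (_ * _)%E; congr (lebesgue_tuple R _ _); rewrite setIid setTI.
  have t0c : corner_simplex t0.
    split=> [i|]; first by rewrite (tnth_nth 0) nth_nseq if_same.
    by rewrite big1// => i _; rewrite (tnth_nth 0) nth_nseq if_same.
  by rewrite [LHS]diracE [RHS]diracE in_setT mem_set.
rewrite -P1; apply: (@le_measure _ _ _ P); rewrite ?inE.
- exact: measurable_corner_simplex.
- rewrite -[X in measurable X]setTI.
  by apply: measurable_simplex_chart => //; exact: measurable_simplex.
- by move=> t; exact: simplex_chart_simplex.
Qed.

Section dirichlet_law.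
Variable alpha : V -> R.

(* On the faces of Omega, which are null, [0 `^ p] is 0 for p < 0. *)
Definition dirichlet_weight eta : R := \prod_x coord eta x `^ (alpha x - 1).

Lemma measurable_dirichlet_weight : measurable_fun [set: _] dirichlet_weight.
Proof.
apply: measurable_prod => x _.
exact: (measurableT_comp (measurable_powR _) (measurable_coord x)).
Qed.

Lemma dirichlet_weight_ge0 eta : 0 <= dirichlet_weight eta.
Proof. by apply: prodr_ge0 => x _; exact: powR_ge0. Qed.

Definition dirichlet : probability (config V R) R :=
  mnormalize
    (density_measure uniform_simplex measurable_dirichlet_weight dirichlet_weight_ge0)
    uniform_simplex.

Lemma dirichlet_simplex : (0 < #|V|)%N -> dirichlet simplex = 1%E.
Proof.
move=> V0; rewrite -(probability_setT dirichlet) /dirichlet/= /mnormalize.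
case: ifP => _; first by rewrite uniform_simplex_simplex// probability_setT.
have mS := measurable_simplex.
have mf : measurable_fun [set: config V R] (EFin \o dirichlet_weight).
  by apply/measurable_EFinP; exact: measurable_dirichlet_weight.
congr (_ * _)%E.
transitivity (\int[uniform_simplex]_(eta in simplex `|` ~` simplex)
    (dirichlet_weight eta)%:E)%E; last by rewrite setUv.
apply/esym.
rewrite ge0_integral_setU//=; last 4 first.
- exact: measurableC.
- exact: measurable_funTS.
- by move=> x _; rewrite lee_fin dirichlet_weight_ge0.
- exact/disj_setPCl.
rewrite [X in (_ + X)%E]null_set_integral ?adde0//.
- exact: measurableC.
- exact: measurable_funTS.
- transitivity (1 - uniform_simplex simplex)%E; first exact: probability_setC.
  by rewrite uniform_simplex_simplex// subee.
Qed.
End dirichlet_law.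
End dirichlet.

Section immediate_exchange.
Context (R : realType) (V : finType).
Variables (c : V -> V -> R) (alpha : V -> R) (kappa : R).
Implicit Types (eta : config V R) (f : config V R -> R).

Local Notation mu := (dirichlet alpha).

Definition exchange eta (x y : V) (U W : R) : config V R :=
  config_of (fun z =>
    if z == x then U * coord eta x + (1 - W) * coord eta y
    else if z == y then (1 - U) * coord eta x + W * coord eta y
    else coord eta z).

Lemma exchange_simplex eta x y U W : x != y -> 0 <= U <= 1 -> 0 <= W <= 1 ->
  simplex eta -> simplex (exchange eta x y U W).
Proof.
move=> xy /andP[U0 U1] /andP[W0 W1] [eta0 eta1]; split=> [z|].
  rewrite coord_config_of; case: eqP => _; [|case: eqP => _ //];
    by rewrite addr_ge0// mulr_ge0// subr_ge0.
under eq_bigr do rewrite coord_config_of.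
have yx : y != x by rewrite eq_sym.
rewrite -[RHS]eta1 (bigD1 x)//= (bigD1 y yx)/= [RHS](bigD1 x)//=.
rewrite [in RHS](bigD1 y yx)/= !eqxx (negbTE yx) !addrA.
congr (_ + _); first by ring.
by apply: eq_bigr => z /andP[/negbTE -> /negbTE ->].
Qed.

(* Each unordered pair {x, y} is taken once, with [enum_rank x < enum_rank y];
   the summand is symmetric when c is. *)
Definition IEM_generator f eta : R :=
  \sum_(x : V) \sum_(y : V | (enum_rank x < enum_rank y)%N)
    c x y *
    \int[(beta_law (alpha x - kappa) kappa \x beta_law (alpha y - kappa) kappa)%E]_p
      (f (exchange eta x y p.1 p.2) - f eta).

Definition dirichlet_form f : \bar R :=
  (\int[mu]_eta (f eta * - IEM_generator f eta)%:E)%E.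

Definition mean f : R := \int[mu]_eta f eta.

Definition centered_norm f : \bar R := Lnorm mu 2%:E (fun eta => (f eta - mean f)%:E).

Definition deg_le1_poly : set (config V R -> R) :=
  [set f | exists (a : R) (b : V -> R),
    forall eta, f eta = a + \sum_x b x * coord eta x].

(* The infima are taken in \bar R: no convention for empty or unbounded sets. *)
Definition gap : \bar R :=
  ereal_inf [set dirichlet_form f | f in [set f | f \in Lfun mu 2%:E /\ centered_norm f = 1%E]].

Definition gap1 : \bar R :=
  ereal_inf [set dirichlet_form f | f in [set f | deg_le1_poly f /\ centered_norm f = 1%E]].

(* [inf] is a minimum here and in [gamma_IEM]: both sets are finite, and they
   are nonempty when V is connected with at least two vertices. *)
Definition alpha_min : R := inf [set alpha x | x in [set: V]].

Definition gamma_IEM : R :=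
  inf [set (alpha p.1 - kappa) / (alpha p.1 + 1) +
           (alpha p.2 - kappa) / (alpha p.2 + 1)
      | p in [set p : V * V | p.1 != p.2 /\ 0 < c p.1 p.2]]
  * (1 + (\sum_x alpha x)^-1).

End immediate_exchange.

(* Main.v *)
(* Affine functions are admissible for the gap, so only the lower bound needs an
   argument. Write P = I + eps L for a small step eps > 0, g for gap_1,
   m = min (1, gamma) and rho = 1 - eps m g.

   Suppose that the second differences f(e4) - f(e3) - f(e2) + f(e1) of f over
   parallelograms in Omega are dominated by q(e2 - e1) + q(e3 - e1), where q is a
   sum of squares of linear forms. An exchange acts on differences of
   configurations by a random linear map, so averaging q over this map gives a sum
   of squares which dominates the second differences of P f. Let the trace of q be
   the sum of the variances, suitably normalised, of its linear forms a, read as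
   the functions sum_x a_x eta_x on Omega. The second moments of the Beta law show
   that an exchange along {x, y} lowers the trace by exactly
   kappa gamma_xy q(delta_x - delta_y), with gamma_xy the term of {x, y} in gamma,
   and the Poincare inequality for linear functions, which is the definition of g,
   turns this into contraction of the trace by the factor rho. Hence P^n f is
   within O(rho^n) of an affine function, uniformly on Omega, and as P contracts
   centered affine functions by rho, the L2 norm of P^n (f - mu f) is O(r^n) for
   every r > rho. Since P is self-adjoint this norm is log-convex in n, so already
   |P (f - mu f)| <= rho |f - mu f|, which is D(f) >= m g Var f.

   Functions with such second differences form an algebra containing
   (1 - C max(eta_x - a, 0)^2)^n, whose limits generate the Borel sets of Omega;
   they are therefore dense in L2, and the inequality passes to the limit. *)
From HB Require Import structures.
From mathcomp Require Import all_boot all_order all_algebra.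
From mathcomp Require Import all_classical all_reals all_analysis.
From mathcomp Require Import measurable_realfun ring lra.
Require Import Defs.

Set Implicit Arguments.
Unset Strict Implicit.
Unset Printing Implicit Defensive.

Import Order.TTheory GRing.Theory Num.Theory.
Import numFieldNormedType.Exports.

Local Open Scope classical_set_scope.
Local Open Scope ring_scope.

(** * Lebesgue integrals and Euler's beta integral *)

(** Two obstacles shape the proof. A single exchange need not shrink a dominating form q as a form,
    since it only mixes directions. The trace does shrink, and being additive and homogeneous it
    lets the Poincare inequality for one linear form extend verbatim to sums of squares. Second
    differences suit this because they vanish on affine functions, where gap_1 already gives the
    rate 1 - eps gap_1; that rate is the reason for the minimum with 1. The bounds along the orbit
    carry constants depending on f and on the number of vertices, and it is log-convexity that
    discards them. The other obstacle is reversibility, on which self-adjointness rests: it has to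
    be derived from the densities. Beta(alpha - kappa, kappa) is the law of the retained fraction
    for which retained and transferred masses have a product weight; in these masses the joint law
    of a configuration and its update is symmetric. Normalising constants are never evaluated, nor
    are the second moments of the Dirichlet law: one unknown factor k scales both the variance and
    the energy of linear functions, and cancels. *)

Section transport.
Context d1 d2 (X : measurableType d1) (Y : measurableType d2) (R : realType).
Local Open Scope ereal_scope.

Definition pushforward_measure (m : {measure set X -> \bar R}) (phi : X -> Y)
    (mphi : measurable_fun [set: X] phi) : {measure set Y -> \bar R} :=
  measure_function_pushforward__canonical__measure_function_Measure m mphi.

Lemma ge0_integral_measure_preserving (m : {measure set X -> \bar R})
    (nu : {measure set Y -> \bar R}) (phi : X -> Y) (f : Y -> \bar R) :
  measurable_fun [set: X] phi ->
  (forall A, measurable A -> m (phi @^-1` A) = nu A) ->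
  measurable_fun [set: Y] f -> (forall y, 0 <= f y) ->
  \int[m]_x f (phi x) = \int[nu]_y f y.
Proof.
move=> mphi mnu mf f0.
rewrite -[LHS]/(\int[m]_(x in phi @^-1` setT) (f \o phi) x).
rewrite -ge0_integral_pushforward//.
by apply: eq_measure_integral => A mA _; exact: mnu.
Qed.

End transport.

(** * Affine substitutions in Lebesgue integrals *)

Section affine_substitution.
Context (R : realType).
Local Notation mu := (@lebesgue_measure R).
Local Open Scope ereal_scope.

Lemma lebesgue_measure_shift (a : R) (A : set R) : measurable A ->
  mu ((fun x => x + a)%R @^-1` A) = mu A.
Proof.
move=> mA.
have ma : measurable_fun [set: measurableTypeR R]
  ((fun x => x + a)%R : measurableTypeR R -> measurableTypeR R) by exact: measurable_funD.
apply/esym/(@lebesgue_measure_unique R (pushforward_measure mu ma)) => //= _ [[u v]] _ <-.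
rewrite /pushforward/=.
rewrite (_ : _ @^-1` _ = `](u - a)%R, (v - a)%R]%classic); last first.
  by apply/seteqP; split => x /=; rewrite !in_itv/= ltrBlDr lerBrDr.
rewrite !lebesgue_measure_itv/= !lte_fin ltrD2r.
by case: ifPn => // _; rewrite -!EFinB; congr EFin; ring.
Qed.

Lemma ge0_integral_shift (a : R) (f : R -> \bar R) :
  measurable_fun [set: measurableTypeR R] f -> (forall x, 0 <= f x) ->
  \int[mu]_x f (x + a)%R = \int[mu]_x f x.
Proof.
move=> mf f0.
apply: (@ge0_integral_measure_preserving _ _ (measurableTypeR R) (measurableTypeR R) R
  mu mu (fun x => x + a)%R f) => //.
- exact: measurable_funD.
- exact: lebesgue_measure_shift.
Qed.

Lemma lebesgue_measure_dilate (s : R) (A : set R) : (0 < s)%R -> measurable A ->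
  s%:E * mu ((fun x => s * x)%R @^-1` A) = mu A.
Proof.
move=> s0 mA.
have ma : measurable_fun [set: measurableTypeR R]
  ((fun x => s * x)%R : measurableTypeR R -> measurableTypeR R) by exact: measurable_funM.
apply/esym/(@lebesgue_measure_unique R
  (mscale (NngNum (ltW s0)) (pushforward_measure mu ma))) => //= _ [[u v]] _ <-.
rewrite /mscale/= /pushforward/=.
rewrite (_ : _ @^-1` _ = `](u / s)%R, (v / s)%R]%classic); last first.
  apply/seteqP; split => x /=; rewrite !in_itv/= => /andP[ux xv]; apply/andP; split.
  - by rewrite ltr_pdivrMr// mulrC.
  - by rewrite ler_pdivlMr// mulrC.
  - by move: ux; rewrite ltr_pdivrMr// mulrC.
  - by move: xv; rewrite ler_pdivlMr// mulrC.
rewrite !lebesgue_measure_itv/= !lte_fin ltr_pM2r ?invr_gt0//.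
case: ifPn => [_|_]; last by rewrite mule0.
rewrite -!EFinB -EFinM; congr EFin; field.
exact: lt0r_neq0.
Qed.

Lemma ge0_integral_dilate (s : R) (f : R -> \bar R) : (0 < s)%R ->
  measurable_fun [set: measurableTypeR R] f -> (forall x, 0 <= f x) ->
  s%:E * \int[mu]_x f (s * x)%R = \int[mu]_x f x.
Proof.
move=> s0 mf f0.
have ma : measurable_fun [set: measurableTypeR R]
  ((fun x => s * x)%R : measurableTypeR R -> measurableTypeR R) by exact: measurable_funM.
rewrite (@ge0_integral_measure_preserving _ _ (measurableTypeR R) (measurableTypeR R) R
  mu (pushforward_measure mu ma) _ f ma)//.
rewrite -(@ge0_integral_mscale _ _ _ _ _ measurableT (NngNum (ltW s0)))//.
by apply: eq_measure_integral => A mA _; exact: lebesgue_measure_dilate.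
Qed.

Lemma ge0_integral_reflect (s : R) (f : R -> \bar R) :
  measurable_fun [set: measurableTypeR R] f -> (forall x, 0 <= f x) ->
  \int[mu]_x f (s - x)%R = \int[mu]_x f x.
Proof.
move=> mf f0.
transitivity (\int[mu]_x f (s + x)%R).
  apply: (@ge0_integral_measure_preserving _ _ (measurableTypeR R) (measurableTypeR R) R
    mu mu -%R (fun x => f (s + x)%R)) => //.
  - by move=> A mA; exact: lebesgue_measureN.
  - have ms : measurable_fun [set: measurableTypeR R]
      ((fun x => s + x)%R : measurableTypeR R -> measurableTypeR R) by exact: measurable_funD.
    exact: measurableT_comp mf ms.
under eq_integral do rewrite addrC.
exact: ge0_integral_shift.
Qed.

End affine_substitution.

(** * Truncated powers *)

Section pospow_theory.
Context (R : realType).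
Local Notation mu := (@lebesgue_measure R).
Implicit Types a b p s x : R.

(** The truncated power $x_+^{a-1}$, indexed like a Gamma density. It carries its own support, so
    integrals run over the whole line and no domain has to be followed through a substitution. *)
Definition pospow a x : R := if 0 < x then x `^ (a - 1) else 0.

Lemma pospow_ge0 a x : 0 <= pospow a x.
Proof. by rewrite /pospow; case: ifP => // _; exact: powR_ge0. Qed.

Lemma pospow_gt0 a x : 0 < x -> 0 < pospow a x.
Proof. by move=> x0; rewrite /pospow x0 powR_gt0. Qed.

Lemma pospow_le0 a x : x <= 0 -> pospow a x = 0.
Proof. by move=> x0; rewrite /pospow ltNge x0. Qed.

Lemma measurable_pospow a : measurable_fun [set: measurableTypeR R] (pospow a).
Proof.
apply: measurable_fun_if => //.
- by apply: measurable_fun_ltr => //; exact: measurable_cst.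
- by apply: measurable_funTS; exact: measurable_powR.
Qed.

Lemma measurable_pospow_comp d (T : measurableType d) a (f : T -> R) :
  measurable_fun [set: T] f -> measurable_fun [set: T] (fun t => pospow a (f t)).
Proof. by move=> mf; exact: (measurableT_comp (measurable_pospow a)). Qed.

Lemma pospow_dilate a s x : 0 < s -> pospow a (s * x) = s `^ (a - 1) * pospow a x.
Proof.
move=> s0; rewrite /pospow pmulr_rgt0//; case: ifPn => [x0|_]; last by rewrite mulr0.
by rewrite powRM// ltW.
Qed.

Lemma pospowSl a x : pospow (a + 1) x = x * pospow a x.
Proof.
rewrite /pospow; case: ifPn => [x0|_]; last by rewrite mulr0.
rewrite addrK -[in LHS](subrK 1 a) [in LHS]powRD; last by rewrite (negbT (gt_eqF x0)) implybT.
by rewrite powRr1 ?ltW// mulrC.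
Qed.

Lemma pospow1 x : 0 < x -> pospow 1 x = 1.
Proof. by move=> x0; rewrite /pospow x0 subrr powRr0. Qed.

Lemma pospow_at1 a : pospow a 1 = 1.
Proof. by rewrite /pospow ltr01 powR1. Qed.

Lemma integral_pospow01 a : 0 < a ->
  (\int[mu]_x (pospow a x * pospow 1 (1 - x))%:E = (a^-1)%:E)%E.
Proof.
move=> a0.
transitivity (\int[mu]_(x in `]0%R, 1%R[) (x `^ (a - 1))%:E)%E.
  rewrite [RHS]integral_mkcond; apply: eq_integral => x _.
  rewrite /pospow patchE mem_setE in_itv/= subr_gt0.
  case: (ltP 0 x) => /= x0; last by rewrite mul0r.
  by case: (ltP x 1) => x1; rewrite ?mulr0// subrr powRr0 mulr1.
have mf (A : set R) : measurable_fun A (fun x => (x `^ (a - 1))%:E).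
  by apply/measurable_funTS/measurable_EFinP; exact: measurable_powR.
rewrite integral_itv_bndo_bndc//.
(* The integral is improper at 0, hence the exhaustion. The offset 2 keeps the left endpoint
   strictly below 1 already for n = 0, as the fundamental theorem requires. *)
pose F n := `[(n.+2%:R^-1 : R), 1]%classic.
have F0 n : (0 : R) < n.+2%:R^-1 by rewrite invr_gt0.
have F1 n : n.+2%:R^-1 < 1 :> R by rewrite invf_lt1// ltr1n.
have FU : `]0%R, 1%R]%classic = \bigcup_n F n :> set R.
  apply/seteqP; split => x /=.
    rewrite in_itv/= => /andP[x0 x1].
    exists (Num.truncn x^-1) => //; rewrite /F/= in_itv/= x1 andbT.
    rewrite -[leRHS]invrK lef_pV2 ?posrE ?invr_gt0//.
    by have := truncnS_gt x^-1; move=> /ltW /le_trans; apply; rewrite ler_nat.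
  move=> [n _]; rewrite /F/= !in_itv/= => /andP[nx xn].
  by rewrite (lt_le_trans (F0 n) nx) xn.
have cvg1 := @ge0_nondecreasing_set_cvg_integral _ (measurableTypeR R) R F
  (fun x => (x `^ (a - 1))%:E) mu.
have {}cvg1 : (\int[mu]_(x in F n) (x `^ (a - 1))%:E)%E @[n --> \oo] -->
    (\int[mu]_(x in `]0%R, 1%R]) (x `^ (a - 1))%:E)%E.
  rewrite FU; apply: cvg1 => //.
  - apply/nondecreasing_seqP => n; apply/subsetPset => x.
    rewrite /F/= !in_itv/= => /andP[nx ->]; rewrite andbT; apply: le_trans nx.
    by rewrite lef_pV2 ?posrE// ler_nat.
  - by move=> i; exact: measurable_itv.
  - by move=> i; exact: mf.
  - by move=> i x _; rewrite lee_fin powR_ge0.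
apply: (cvg_unique _ cvg1) => //.
pose G : R -> R := a^-1 \*: (@powR R ^~ a).
have dG x : 0 < x -> is_derive x 1 G (x `^ (a - 1)).
  move=> x0; have h := is_derive1_powR a x0.
  have -> : x `^ (a - 1) = a^-1 *: (a * x `^ (a - 1)).
    by rewrite /GRing.scale/= mulrA mulVf ?mul1r// gt_eqF.
  exact: (@is_deriveZ R R^o R^o (@powR R ^~ a) a^-1 x 1 _ h).
have cG x : 0 < x -> {for x, continuous G}.
  move=> x0; apply: differentiable_continuous; apply/derivable1_diffP.
  by case: (dG x x0).
have -> : (fun n => \int[mu]_(x in F n) (x `^ (a - 1))%:E)%E =
    (fun n => (a^-1 - G n.+2%:R^-1)%:E).
  apply/funext => n; rewrite (@continuous_FTC2 R _ G) ?F1//.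
  - by rewrite /G/= powR1 /GRing.scale/= mulr1 EFinB.
  - apply: continuous_in_subspaceT => x; rewrite inE/= in_itv/= => /andP[nx _].
    have x0 := lt_le_trans (F0 n) nx.
    apply: differentiable_continuous; apply/derivable1_diffP.
    by case: (is_derive1_powR (a - 1) x0).
  - split=> [x||].
    + rewrite in_itv/= => /andP[nx _]; case: (dG x _) => //.
      exact: lt_trans nx.
    + by apply: cvg_at_right_filter; apply: cG.
    + by apply: cvg_at_left_filter; apply: cG.
  - move=> x; rewrite in_itv/= => /andP[nx _]; rewrite derive1E.
    by have [_ ->] := dG x (lt_trans (F0 n) nx).
apply/cvg_EFin => //; first by near=> n.
rewrite -[X in _ --> X]subr0; apply: cvgB; first exact: cvg_cst.
rewrite -(mulr0 a^-1); apply: cvgMr.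
have /cvg_at_rightP := powR_cvg0 a0; apply; split=> //.
by have := @cvg_harmonic R; rewrite -cvg_shiftS.
Unshelve. all: by end_near.
Qed.

End pospow_theory.

(* Sealed: failed unifications would otherwise unfold the integral. *)
HB.lock Definition beta_int (R : realType) (a b : R) : R :=
  fine (\int[@lebesgue_measure R]_x (pospow a x * pospow b (1 - x))%:E)%E.

Section beta_function.
Context (R : realType).
Local Notation mu := (@lebesgue_measure R).
Implicit Types a b p s x : R.

Lemma measurable_pospow_conv a b s :
  measurable_fun [set: measurableTypeR R] (fun x => pospow a x * pospow b (s - x)).
Proof.
apply: measurable_funM; first exact: measurable_pospow.
by apply: measurable_pospow_comp; exact: measurable_funB.
Qed.

Lemma pospow_conv_ge0 a b s x : (0 <= (pospow a x * pospow b (s - x))%:E)%E.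
Proof. by rewrite lee_fin mulr_ge0 ?pospow_ge0. Qed.

(** The content is finiteness, [beta_int] being a [fine]. One of x and 1 - x is at least 1/2, where
    its power is at most 2, so the integrand is below the sum of two one-sided integrands of the
    form [integral_pospow01]. *)
Lemma integral_beta_int a b : 0 < a -> 0 < b ->
  (\int[mu]_x (pospow a x * pospow b (1 - x))%:E = (beta_int a b)%:E)%E.
Proof.
move=> a0 b0; rewrite unlock fineK// ge0_fin_numE; last first.
  by apply: integral_ge0 => x _; exact: pospow_conv_ge0.
(* For p >= 1 the power is at most 1; for p < 1 it is at most the inverse of y, hence at most 2. *)
have half p y : 2^-1 <= y -> y < 1 -> 0 < p -> pospow p y <= 2.
  move=> y2 y1 p0; have y0 : 0 < y by rewrite (lt_le_trans _ y2).
  rewrite /pospow y0.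
  have [p1|p1] := leP 1 p.
    rewrite (@le_trans _ _ 1) ?ler1n//.
    by rewrite -[leRHS](powRr0 y) ger_powR ?subr_ge0// y0 ltW.
  rewrite -(invrK 2) (@le_trans _ _ y^-1) ?lef_pV2 ?posrE//.
  rewrite -powR_inv1 ?(ltW y0)// ger_powR//; first by rewrite y0 ltW.
  by rewrite lerBrDl addrN ltW.
pose g a x : \bar R := (2 * (pospow a x * pospow 1 (1 - x)))%:E.
have g0 p x : (0 <= g p x)%E.
  by rewrite lee_fin mulr_ge0// mulr_ge0// pospow_ge0.
have mg p : measurable_fun [set: measurableTypeR R] (g p).
  by apply/measurable_EFinP/measurable_funM => //; exact: measurable_pospow_conv.
have intg p : 0 < p -> (\int[mu]_x g p x = (2 * p^-1)%:E)%E.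
  move=> p0; under eq_integral do rewrite /g EFinM.
  rewrite ge0_integralZl_EFin//.
  - by rewrite integral_pospow01.
  - by move=> x _; exact: pospow_conv_ge0.
  - by apply/measurable_EFinP; exact: measurable_pospow_conv.
have mgr : measurable_fun [set: measurableTypeR R] (fun x => g b (1 - x)).
  have mr : measurable_fun [set: measurableTypeR R]
    ((fun x => 1 - x)%R : measurableTypeR R -> measurableTypeR R) by exact: measurable_funB.
  exact: measurableT_comp (mg b) mr.
apply: (@le_lt_trans _ _ (\int[mu]_x (g a x + g b (1 - x)%R))%E).
  apply: ge0_le_integral => //.
  - by move=> x _; exact: pospow_conv_ge0.
  - by apply/measurable_EFinP; exact: measurable_pospow_conv.
  - exact: emeasurable_funD.
  - move=> x _; rewrite -EFinD lee_fin subKr.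
    have [x0|x0] := leP x 0.
      by rewrite pospow_le0// mul0r addr_ge0// mulr_ge0// mulr_ge0// pospow_ge0.
    have [x1|x1] := leP 1 x.
      by rewrite (@pospow_le0 _ b) ?subr_le0// mulr0 addr_ge0// mulr_ge0// mulr_ge0// pospow_ge0.
    rewrite !(@pospow1 _ (1 - x)) ?(@pospow1 _ x)// ?subr_gt0// !mulr1.
    have [x2|x2] := leP x 2^-1.
      rewrite ler_wpDr ?mulr_ge0 ?pospow_ge0// mulrC ler_wpM2r ?pospow_ge0// half//.
        by rewrite lerBrDl -lerBrDr; apply: le_trans x2 _; lra.
      by rewrite ltrBlDr ltrDl.
    by rewrite ler_wpDl ?mulr_ge0 ?pospow_ge0// ler_wpM2r ?pospow_ge0// half// ltW.
rewrite ge0_integralD// ge0_integral_reflect// !intg//.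
by rewrite -EFinD ltry.
Qed.

Lemma beta_int_gt0 a b : 0 < a -> 0 < b -> 0 < beta_int a b.
Proof.
move=> a0 b0; rewrite -lte_fin -integral_beta_int// lt_neqAle; apply/andP; split; last first.
  by apply: integral_ge0 => x _; exact: pospow_conv_ge0.
apply/negP => /eqP /esym i0.
have mf : measurable_fun [set: measurableTypeR R]
    (fun x => (pospow a x * pospow b (1 - x))%:E).
  by apply/measurable_EFinP; exact: measurable_pospow_conv.
have : ae_eq mu setT (fun x => (pospow a x * pospow b (1 - x))%:E) (cst 0%E).
  apply/(ae_eq_integral_abs mu measurableT mf).
  by under eq_integral do rewrite gee0_abs ?pospow_conv_ge0//.
move=> [N [mN N0 subN]].
suff : (mu `]0%R, 1%R[ <= mu N)%E by rewrite N0 lebesgue_measure_itv/= lte01 oppr0 addr0 leNgt lte01.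
apply: le_measure; rewrite ?inE//.
move=> x /=; rewrite in_itv/= => /andP[x0 x1]; apply: subN => /= /(_ I) [].
by apply/eqP; rewrite gt_eqF// mulr_gt0// pospow_gt0// subr_gt0.
Qed.

(** Truncated powers form a convolution semigroup up to constants: dilation by s reduces to s = 1,
    and both sides vanish for s <= 0. *)
Lemma pospow_conv a b s : 0 < a -> 0 < b ->
  (\int[mu]_x (pospow a x * pospow b (s - x))%:E =
   (beta_int a b * pospow (a + b) s)%:E)%E.
Proof.
move=> a0 b0; have [s0|s0] := leP s 0.
  rewrite [RHS](_ : _ = 0%E); last by rewrite pospow_le0// mulr0.
  apply: integral0_eq => x _; have [x0|x0] := leP x 0; first by rewrite pospow_le0// mul0r.
  by rewrite (@pospow_le0 _ b) ?mulr0// subr_le0 (le_trans s0)// ltW.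
rewrite -(ge0_integral_dilate s0); last 2 first.
- by apply/measurable_EFinP; exact: measurable_pospow_conv.
- by move=> x; exact: pospow_conv_ge0.
rewrite (eq_integral (fun x : measurableTypeR R =>
  ((s `^ (a - 1) * s `^ (b - 1)) * (pospow a x * pospow b (1 - x)))%:E)); last first.
  move=> x _; congr EFin; rewrite -{2}(mulr1 s) -mulrBr !pospow_dilate//; ring.
under eq_integral do rewrite EFinM.
rewrite ge0_integralZl_EFin//; last 3 first.
- by move=> x _; exact: pospow_conv_ge0.
- by apply/measurable_EFinP; exact: measurable_pospow_conv.
- by rewrite mulr_ge0// powR_ge0.
rewrite integral_beta_int// -!EFinM; congr EFin.
rewrite /pospow s0 [RHS]mulrC mulrA; congr (_ * _).
rewrite -{1}(powRr1 (ltW s0)) -!powRD ?(gt_eqF s0) ?implybT//.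
by congr (_ `^ _); ring.
Qed.

Lemma beta_int1 a : 0 < a -> beta_int a 1 = a^-1.
Proof. by move=> a0; rewrite unlock integral_pospow01. Qed.

Lemma integral_conv_scale k a b s : 0 <= k -> 0 < a -> 0 < b ->
  (\int[mu]_x (k * (pospow a x * pospow b (s - x)))%:E =
   (k * (beta_int a b * pospow (a + b) s))%:E)%E.
Proof.
move=> k0 a0 b0; under eq_integral do rewrite EFinM.
rewrite ge0_integralZl_EFin//.
- by rewrite (pospow_conv s a0 b0).
- by move=> y _; exact: pospow_conv_ge0.
- by apply/measurable_EFinP; exact: measurable_pospow_conv.
Qed.

(** Both sides are the threefold convolution of truncated powers at 1, bracketed in the two ways and
    compared by Tonelli. This takes the place of the formula with Gamma functions. *)
Lemma beta_int_assoc a b c : 0 < a -> 0 < b -> 0 < c ->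
  beta_int a b * beta_int (a + b) c = beta_int b c * beta_int a (b + c).
Proof.
move=> a0 b0 c0.
pose f (p : measurableTypeR R * measurableTypeR R) : \bar R :=
  (pospow a p.1 * (pospow b (p.2 - p.1) * pospow c (1 - p.2)))%:E.
have f0 (q : measurableTypeR R * measurableTypeR R) : (0 <= f q)%E.
  by rewrite lee_fin !mulr_ge0// pospow_ge0.
have mf : measurable_fun setT f.
  apply/measurable_EFinP/measurable_funM.
    exact: measurable_pospow_comp.
  by apply: measurable_funM; apply: measurable_pospow_comp; exact: measurable_funB.
have ab0 := addr_gt0 a0 b0; have bc0 := addr_gt0 b0 c0.
have B1 := ltW (beta_int_gt0 a0 b0); have B2 := ltW (beta_int_gt0 b0 c0).
have fub := @fubini_tonelli _ _ _ _ _ mu mu f mf f0.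
have e1 : (\int[mu]_x fubini_F mu f x =
    (beta_int b c * (beta_int a (b + c) * pospow (a + (b + c)) 1))%:E)%E.
  rewrite -(integral_conv_scale 1 B2 a0 bc0); apply: eq_integral => x _.
  transitivity (\int[mu]_y (pospow a x * (pospow b y * pospow c ((1 - x) - y)))%:E)%E.
    rewrite /fubini_F -(@ge0_integral_shift _ x (fun y => f (x, y))); last 2 first.
    - exact: (measurableT_comp mf (pair1_measurable x)).
    - by move=> y; exact: f0.
    apply: eq_integral => y _; congr EFin => /=.
    by rewrite addrK opprD (addrC (- y)) addrA.
  rewrite (integral_conv_scale _ (pospow_ge0 a x) b0 c0); congr EFin; ring.
have e2 : (\int[mu]_y fubini_G mu f y =
    (beta_int a b * (beta_int (a + b) c * pospow (a + b + c) 1))%:E)%E.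
  rewrite -(integral_conv_scale 1 B1 ab0 c0); apply: eq_integral => y _.
  transitivity (\int[mu]_x (pospow c (1 - y) * (pospow a x * pospow b (y - x)))%:E)%E.
    apply: eq_integral => x _; congr EFin => /=; ring.
  rewrite (integral_conv_scale _ (pospow_ge0 c _) a0 b0); congr EFin; ring.
have := e1; rewrite fub e2 => -[].
rewrite (pospow_at1 (a + b + c)) (pospow_at1 (a + (b + c))).
rewrite (mulr1 (beta_int (a + b) c)) (mulr1 (beta_int a (b + c))).
by apply.
Qed.

(** Associativity with c = 1, where the two integrals with parameter 1 are explicit. All Beta
    moments below come from this recursion. *)
Lemma beta_intS a b : 0 < a -> 0 < b ->
  beta_int a (b + 1) = b / (a + b) * beta_int a b.
Proof.
move=> a0 b0; have := beta_int_assoc a0 b0 ltr01.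
rewrite (beta_int1 b0) (beta_int1 (addr_gt0 a0 b0)) => e.
have ab0 : a + b != 0 by rewrite gt_eqF// addr_gt0.
have b0' : b != 0 by rewrite gt_eqF.
by apply: (@mulfI _ b^-1); rewrite ?invr_eq0// -e; field; rewrite ab0.
Qed.

End beta_function.

(** * Translations and Dirichlet integrals on tuples *)

Section lebesgue_tuple_theory.
Context (R : realType).
Local Notation mu := (@lebesgue_measure R).
Local Notation leb := (lebesgue_tuple R).

Lemma ge0_integral_lebesgue_tupleS n (f : n.+1.-tuple R -> \bar R) :
  measurable_fun [set: n.+1.-tuple R] f -> (forall t, (0 <= f t)%E) ->
  (\int[leb n.+1]_t f t = \int[mu]_x \int[leb n]_t f [tuple of x :: t])%E.
Proof.
move=> mf f0.
rewrite -(@ge0_integral_measure_preserving _ _ _ _ R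
  (mu \x leb n)%E (leb n.+1) (@tuple_cons R n) f)//.
  rewrite fubini_tonelli1//.
  apply: measurableT_comp mf _; exact: measurable_tuple_cons.
exact: measurable_tuple_cons.
Qed.

Lemma ge0_integral_lebesgue_tuple0 (f : 0.-tuple R -> \bar R) :
  measurable_fun [set: 0.-tuple R] f ->
  (\int[leb 0]_t f t = f [tuple])%E.
Proof. by move=> mf; rewrite /= integral_dirac// diracE in_setT mul1e. Qed.

Definition tuple_shift n (v t : n.-tuple R) : n.-tuple R :=
  [tuple tnth t i + tnth v i | i < n].

Lemma measurable_tuple_shift n (v : n.-tuple R) :
  measurable_fun [set: n.-tuple R] (tuple_shift v).
Proof.
apply/measurable_fun_tnthP => i.
rewrite (_ : _ \o _ = fun t : n.-tuple R => tnth t i + tnth v i); last first.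
  by apply/funext => t; rewrite /= tnth_mktuple.
by apply: measurable_funD => //; exact: measurable_tnth.
Qed.

Lemma tuple_shift_cons n (v : n.+1.-tuple R) x (t : n.-tuple R) :
  tuple_shift v [tuple of x :: t] =
  [tuple of x + thead v :: tuple_shift [tuple of behead v] t].
Proof.
apply: eq_from_tnth => i; rewrite tnth_mktuple.
case: (unliftP ord0 i) => [j|] ->.
  by rewrite !tnthS tnth_mktuple [in LHS](tuple_eta v) tnthS.
by rewrite !tnth0.
Qed.

Lemma ge0_integral_tuple_shift n (v : n.-tuple R) (f : n.-tuple R -> \bar R) :
  measurable_fun [set: n.-tuple R] f -> (forall t, (0 <= f t)%E) ->
  (\int[leb n]_t f (tuple_shift v t) = \int[leb n]_t f t)%E.
Proof.
elim: n v f => [|n IH] v f mf f0.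
  by apply: eq_integral => t _; rewrite (tuple0 t) (tuple0 (tuple_shift _ _)).
rewrite [RHS](ge0_integral_lebesgue_tupleS mf f0).
transitivity (\int[mu]_x \int[leb n]_t f (tuple_shift v [tuple of x :: t]))%E.
  apply: (@ge0_integral_lebesgue_tupleS n (fun t => f (tuple_shift v t))) => //.
  exact: measurableT_comp mf (measurable_tuple_shift v).
have mcons : measurable_fun [set: measurableTypeR R * n.-tuple R]
  (fun p => f (tuple_cons p)) by exact: measurableT_comp mf (@measurable_tuple_cons R n).
have mc x : measurable_fun [set: n.-tuple R] (fun t => f [tuple of x :: t]).
  exact: (measurableT_comp mcons (pair1_measurable x)).
transitivity (\int[mu]_x (\int[leb n]_t f [tuple of (x + thead v)%R :: t]))%E.
  apply: eq_integral => x _.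
  rewrite -[RHS](IH [tuple of behead v])//.
  by apply: eq_integral => t _; rewrite tuple_shift_cons.
apply: (@ge0_integral_shift R (thead v) (fun x => \int[leb n]_t f [tuple of x :: t])%E).
  exact: (@measurable_fun_fubini_tonelli_F _ _ _ _ R (leb n) (fun p => f (tuple_cons p))).
by move=> x; exact: integral_ge0.
Qed.

Lemma measurable_dirichlet_kernel n (a : 'I_n -> R) b s :
  measurable_fun [set: n.-tuple R]
    (fun t : n.-tuple R => (\prod_i pospow (a i) (tnth t i)) *
                           pospow b (s - \sum_i tnth t i)).
Proof.
apply: measurable_funM.
  by apply: measurable_prod => i _; apply: measurable_pospow_comp; exact: measurable_tnth.
apply: measurable_pospow_comp; apply: measurable_funB => //.
by apply: measurable_sum => i; exact: measurable_tnth.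
Qed.

(** Iterated convolution. The total s is left free because integrating out the first coordinate x
    replaces s by s - x in the induction. *)
Lemma dirichlet_kernel_integral n (a : 'I_n -> R) b :
  (forall i, 0 < a i) -> 0 < b -> exists2 C : R, 0 < C & forall s : R,
  (\int[leb n]_t ((\prod_i pospow (a i) (tnth t i)) *
     pospow b (s - \sum_i tnth t i))%:E =
   (C * pospow (\sum_i a i + b) s)%:E)%E.
Proof.
move=> a0 b0; elim: n a a0 => [|n IH] a a0.
  exists 1 => // s; rewrite ge0_integral_lebesgue_tuple0; last first.
    by apply/measurable_EFinP; exact: measurable_dirichlet_kernel.
  by rewrite !big_ord0 subr0 add0r.
have [C C0 IHC] := IH (fun i => a (lift ord0 i)) (fun i => a0 _).
have S0 : 0 < \sum_i a (lift ord0 i) + b by rewrite ltr_wpDl// sumr_ge0// => i _; exact: ltW.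
exists (C * beta_int (a ord0) (\sum_i a (lift ord0 i) + b)).
  by rewrite mulr_gt0// beta_int_gt0.
move=> s; rewrite ge0_integral_lebesgue_tupleS; last 2 first.
- by apply/measurable_EFinP; exact: measurable_dirichlet_kernel.
- move=> t; rewrite lee_fin mulr_ge0 ?pospow_ge0//.
  by apply: prodr_ge0 => i _; exact: pospow_ge0.
transitivity (\int[mu]_x (C * (pospow (a ord0) x *
    pospow (\sum_i a (lift ord0 i) + b) (s - x)))%:E)%E.
  apply: eq_integral => x _.
  transitivity (\int[leb n]_t ((pospow (a ord0) x)%:E *
      ((\prod_i pospow (a (lift ord0 i)) (tnth t i)) *
     pospow b (s - x - \sum_i tnth t i))%:E))%E.
    apply: eq_integral => t _; rewrite -EFinM; congr EFin.
    rewrite !big_ord_recl tnth0 -!mulrA; congr (_ * (_ * pospow _ _)).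
      by apply: eq_bigr => i _; rewrite tnthS.
    by rewrite opprD addrA; congr (_ - _); apply: eq_bigr => i _; rewrite tnthS.
  rewrite ge0_integralZl_EFin ?pospow_ge0//; last 2 first.
  - move=> t _; rewrite lee_fin mulr_ge0 ?pospow_ge0//.
    by apply: prodr_ge0 => i _; exact: pospow_ge0.
  - by apply/measurable_EFinP; exact: measurable_dirichlet_kernel.
  by rewrite IHC -EFinM; congr EFin; ring.
rewrite (integral_conv_scale _ (ltW C0) (a0 ord0) S0) big_ord_recl addrA.
by rewrite mulrA.
Qed.

End lebesgue_tuple_theory.

(** * Integrals against densities and normalised measures *)

Section change_of_measure.
Context d (T : measurableType d) (R : realType).
Local Open Scope ereal_scope.
Import HBNNSimple.

(** Simple functions from below; both sides pass to the limit by monotone convergence. *)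
Lemma ge0_integral_density (m : {measure set T -> \bar R}) (f : T -> R)
    (mf : measurable_fun [set: T] f) (f0 : forall x, (0 <= f x)%R) (g : T -> \bar R) :
  measurable_fun [set: T] g -> (forall x, 0 <= g x) ->
  \int[density_measure m mf f0]_x g x = \int[m]_x ((f x)%:E * g x).
Proof.
move=> mg g0; pose h := nnsfun_approx measurableT mg.
have hg x : EFin \o h ^~ x @ \oo --> g x by apply: cvg_nnsfun_approx.
have hle x a b : (a <= b)%N -> (h a x <= h b x)%R.
  by move=> ab; have /lefP := nd_nnsfun_approx measurableT mg ab; exact.
have mh n : measurable_fun [set: T] (h n) by [].
have mfh n : measurable_fun [set: T] (fun x => (f x)%:E * (h n x)%:E).
  by apply: emeasurable_funM; apply/measurable_EFinP.
transitivity (limn (fun n => \int[density_measure m mf f0]_x (h n x)%:E)).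
  rewrite -monotone_convergence//.
  - by apply: eq_integral => x _; apply/esym/cvg_lim => //; exact: hg.
  - by move=> n; exact/measurable_EFinP.
  - by move=> n x _; rewrite lee_fin.
  - by move=> x _ a b ab; rewrite lee_fin; exact: hle.
transitivity (limn (fun n => \int[m]_x ((f x)%:E * (h n x)%:E))); last first.
  rewrite -monotone_convergence//.
  - apply: eq_integral => x _; apply/cvg_lim => //.
    by apply: cvgeZl => //; exact: hg.
  - by move=> n x _; rewrite mule_ge0// lee_fin.
  - by move=> x _ a b ab; rewrite lee_wpmul2l ?lee_fin//; exact: hle.
congr (limn _); apply/funext => n.
rewrite integralT_nnsfun sintegralE.
transitivity (\int[m]_x \sum_(r \in range (h n))
    ((f x)%:E * (r * \1_(h n @^-1` [set r]) x)%:E)); last first.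
  apply: eq_integral => x _; rewrite [in RHS](fimfunE (h n)) -fsumEFin//.
  by rewrite ge0_mule_fsumr// => r; rewrite nnfun_muleindic_ge0.
rewrite ge0_integral_fsum//; last 2 first.
- move=> r; apply: emeasurable_funM; first exact/measurable_EFinP.
  by apply/measurable_EFinP/measurable_funM.
- move=> r x _; apply: mule_ge0; first by rewrite lee_fin.
  by rewrite EFinM nnfun_muleindic_ge0.
apply: eq_fsbigr => r _ /=.
have [r0|r0] := leP 0%R r; last first.
  have -> : h n @^-1` [set r] = set0.
    by apply/seteqP; split=> // x /= hr; move: r0; rewrite -hr ltNge fun_ge0.
  rewrite /density_measure integral_set0 mule0 integral0_eq// => x _.
  by rewrite indic0 mulr0 mule0.
transitivity (\int[m]_x (r%:E * ((f x)%:E * (\1_(h n @^-1` [set r]) x)%:E))); last first.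
  by apply: eq_integral => x _; rewrite EFinM muleCA.
rewrite ge0_integralZl_EFin//; last 2 first.
- by move=> x _; rewrite mule_ge0 ?lee_fin.
- by apply: emeasurable_funM; apply/measurable_EFinP.
congr (_ * _); rewrite /density_measure [LHS]integral_mkcond; apply: eq_integral => x _.
by rewrite epatch_indic.
Qed.

Lemma ge0_integral_mnormalize (m : {measure set T -> \bar R}) (P : probability T R)
    (c : R) (g : T -> \bar R) : (0 < c)%R -> m setT = c%:E ->
  measurable_fun [set: T] g -> (forall x, 0 <= g x) ->
  \int[mnormalize m P]_x g x = (c^-1)%:E * \int[m]_x g x.
Proof.
move=> c0 mc mg g0.
have ci : (0 <= c^-1)%R by rewrite invr_ge0 ltW.
rewrite -(@ge0_integral_mscale _ _ _ m setT measurableT (NngNum ci))//.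
apply: eq_measure_integral => A mA _; rewrite -[LHS]/(mnormalize m P A).
by rewrite /mnormalize mc eqe (gt_eqF c0)/= /mscale/= muleC.
Qed.

End change_of_measure.

(** * Dirichlet integrals over the simplex *)

Section chart.
Context (R : realType) (V : finType).
Implicit Types (eta : config V R) (t : #|V|.-1.-tuple R) (x y z : V).

Lemma config_ext eta eta' : coord eta =1 coord eta' -> eta = eta'.
Proof.
move=> e; apply: eq_from_tnth => i.
by have := e (enum_val i); rewrite /coord enum_valK.
Qed.

Lemma enum_rank_nth x0 i : (i < #|V|)%N -> enum_rank (nth x0 (enum V) i) = i :> nat.
Proof.
move=> iV; rewrite -[i in nth _ _ i]/(val (Ordinal iV)) -enum_val_nth.
by rewrite enum_valK.
Qed.

Lemma coord_chart t x :
  coord (simplex_chart t) x = nth (1 - \sum_i tnth t i) t (enum_rank x).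
Proof. exact: coord_config_of. Qed.

(** The last vertex splits off, as its coordinate is the remaining mass. A general monoid is allowed
    since both total masses (sums) and Dirichlet weights (products) are read in the chart. *)
Lemma big_coord_chart (S : Type) (idx : S) (op : Monoid.com_law idx)
    (g : V -> R -> S) x0 t : (0 < #|V|)%N ->
  \big[op/idx]_x g x (coord (simplex_chart t) x) =
  op (\big[op/idx]_(i < #|V|.-1) g (nth x0 (enum V) i) (tnth t i))
     (g (nth x0 (enum V) #|V|.-1) (1 - \sum_i tnth t i)).
Proof.
move=> V0; under eq_bigr do rewrite coord_chart.
set d := 1 - _.
have big_last N (F : nat -> S) : (0 < N)%N ->
    \big[op/idx]_(0 <= i < N) F i = op (\big[op/idx]_(i < N.-1) F i) (F N.-1).
  by case: N => // N _; rewrite big_nat_recr//= big_mkord.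
rewrite -big_enum/= (big_nth x0) -cardE big_last//.
rewrite enum_rank_nth ?prednK// [nth d t _]nth_default ?size_tuple//.
congr (op _ _); apply: eq_bigr => i _.
by rewrite enum_rank_nth -?tnth_nth// (leq_trans (ltn_ord i)) ?leq_pred.
Qed.

Lemma sum_coord_chart t : (0 < #|V|)%N -> \sum_x coord (simplex_chart t) x = 1.
Proof.
move=> V0; have [x0 _] := card_gt0P V0.
by rewrite (big_coord_chart _ (fun _ r => r) x0)//= addrC subrK.
Qed.

Lemma chart_unique t eta : (0 < #|V|)%N -> \sum_x coord eta x = 1 ->
  (forall x (i : 'I_#|V|.-1), enum_rank x = i :> nat -> coord eta x = tnth t i) ->
  eta = simplex_chart t.
Proof.
move=> V0 eta1 etat.
have e x : (enum_rank x < #|V|.-1)%N -> coord eta x = coord (simplex_chart t) x.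
  move=> xn; rewrite (etat x (Ordinal xn))// coord_chart.
  by rewrite (tnth_nth (1 - \sum_i tnth t i)).
apply: config_ext => x; have [/e//|xn] := ltnP (enum_rank x) #|V|.-1.
have xE : enum_rank x = #|V|.-1 :> nat.
  by apply/eqP; rewrite eqn_leq xn andbT -ltnS prednK.
have := sum_coord_chart t V0; rewrite -eta1 (bigD1 x)//= [RHS](bigD1 x)//=.
rewrite [X in _ = _ + X](eq_bigr (fun y => coord (simplex_chart t) y)).
  by move/addIr.
move=> y yx; apply: e; rewrite ltn_neqAle; apply/andP; split.
  by apply: contra yx => /eqP yE; apply/eqP/enum_rank_inj/val_inj; rewrite /= xE.
by rewrite -ltnS prednK.
Qed.

Definition config_move eta x y (s : R) : config V R :=
  config_of (fun z => coord eta z + s * ((z == x)%:R - (z == y)%:R)).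

Lemma coord_config_move eta x y s z :
  coord (config_move eta x y s) z = coord eta z + s * ((z == x)%:R - (z == y)%:R).
Proof. exact: coord_config_of. Qed.

Lemma sum_config_move eta x y s :
  \sum_z coord (config_move eta x y s) z = \sum_z coord eta z.
Proof.
under eq_bigr do rewrite coord_config_move.
rewrite big_split/= -mulr_sumr sumrB.
have one w : \sum_z (z == w)%:R = 1 :> R.
  by rewrite (bigD1 w)//= eqxx big1 ?addr0// => z /negbTE ->.
by rewrite !one subrr mulr0 addr0.
Qed.

(** A move of mass is a translation of the hyperplane, hence of the chart. If x or y is the last
    vertex, the corresponding indicator never fires, in accordance with its missing chart
    coordinate. *)
Lemma chart_move t x y s : (0 < #|V|)%N ->
  simplex_chart (tuple_shift [tuple s * ((i == enum_rank x :> nat)%:R -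
      (i == enum_rank y :> nat)%:R) | i < #|V|.-1] t) =
  config_move (simplex_chart t) x y s.
Proof.
move=> V0; apply/esym/chart_unique => //.
  by rewrite sum_config_move sum_coord_chart.
move=> z i zi; rewrite coord_config_move !tnth_mktuple coord_chart zi -tnth_nth.
by rewrite -!zi !(inj_eq val_inj) !(inj_eq enum_rank_inj).
Qed.

Lemma simplex_corner t : (0 < #|V|)%N ->
  simplex (simplex_chart t) <-> corner_simplex t.
Proof.
move=> V0; split; last exact: simplex_chart_simplex.
have [x0 _] := card_gt0P V0.
move=> [c0 _]; split.
  move=> i; have iV : (i < #|V|)%N by rewrite (leq_trans (ltn_ord i)) ?leq_pred.
  have := c0 (nth x0 (enum V) i).
  by rewrite coord_chart enum_rank_nth// -tnth_nth.
have := c0 (nth x0 (enum V) #|V|.-1).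
rewrite coord_chart enum_rank_nth ?prednK// nth_default ?size_tuple//.
by rewrite subr_ge0.
Qed.

Lemma measurable_config_of d (T : measurableType d) (g : T -> V -> R) :
  (forall x, measurable_fun [set: T] (g ^~ x)) ->
  measurable_fun [set: T] (fun p => config_of (g p)).
Proof.
move=> mg; apply/measurable_fun_tnthP => i.
rewrite (_ : _ \o _ = g ^~ (enum_val i)); first exact: mg.
by apply/funext => p; rewrite /= tnth_mktuple.
Qed.

End chart.

(** * Lebesgue measure on the hyperplane of total mass 1 *)

Section hyperplane_integral.
Context (R : realType) (V : finType).
Hypothesis V2 : (1 < #|V|)%N.
Local Notation leb := (lebesgue_tuple R #|V|.-1).
Local Notation mu := (@lebesgue_measure R).
Implicit Types (F G : config V R -> \bar R) (x y z : V).
Local Open Scope ereal_scope.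

Let V0 : (0 < #|V|)%N := ltnW V2.

(** Taken over the whole hyperplane and not over Omega: moves then preserve the domain of
    integration, and the integrands carry the support. *)
Definition hyp_integral F : \bar R := \int[leb]_t F (simplex_chart t).

Lemma measurable_chart_comp F : measurable_fun [set: config V R] F ->
  measurable_fun [set: #|V|.-1.-tuple R] (fun t => F (simplex_chart t)).
Proof. by move=> mF; exact: measurableT_comp mF (@measurable_simplex_chart R V). Qed.

Lemma hyp_integral_move F x y s : measurable_fun [set: config V R] F ->
  (forall eta, 0 <= F eta) ->
  hyp_integral (fun eta => F (config_move eta x y s)) = hyp_integral F.
Proof.
move=> mF F0; rewrite /hyp_integral.
under eq_integral do rewrite -chart_move//.
apply: (ge0_integral_tuple_shift _ (f := fun t => F (simplex_chart t))) => //.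
exact: measurable_chart_comp.
Qed.

Lemma measurable_coord_eq0 x :
  measurable_fun [set: config V R] (fun eta => ((coord eta x == 0)%:R%:E : \bar R)).
Proof.
apply/measurable_EFinP; apply: (measurableT_comp (f := fun b : bool => b%:R : R)) => //.
apply: measurable_fun_eqr => //; exact: measurable_coord.
Qed.

(** A move by s along an edge at x does not change the measure of the face. Averaging over s in
    [0, 1] and applying Tonelli leaves fibres in s that are single points. *)
Lemma hyp_integral_face x : hyp_integral (fun eta => (coord eta x == 0)%:R%:E) = 0.
Proof.
have [y yx] : exists y, y != x.
  move: V2; rewrite (cardD1 x) inE add1n ltnS => /card_gt0P[y].
  by rewrite !inE andbT => yx; exists y.
pose A : set (measurableTypeR R * #|V|.-1.-tuple R) :=
  (fst @^-1` `[0%R, 1%R]) `&`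
  ((fun p => coord (simplex_chart p.2) x + p.1)%R @^-1` [set 0%R]).
have mA : measurable A.
  apply: measurableI; first by rewrite -[X in measurable X]setTI; exact: measurable_fst.
  rewrite -[X in measurable X]setTI.
  have mh : measurable_fun [set: measurableTypeR R * #|V|.-1.-tuple R]
      (fun p => coord (simplex_chart p.2) x + p.1)%R.
    apply: measurable_funD => //.
    apply: measurableT_comp (measurable_coord x) _.
    exact: measurableT_comp (@measurable_simplex_chart R V) measurable_snd.
  exact: mh.
have fub := @indic_fubini_tonelli _ _ _ _ _ mu leb A mA.
set F0 := fun eta : config V R => (coord eta x == 0)%:R%:E : \bar R.
have F00 eta : 0 <= F0 eta by rewrite lee_fin.
have lhs : \int[mu]_s fubini_F leb (EFin \o \1_A) s = hyp_integral F0.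
  transitivity (\int[mu]_(s in `[0%R, 1%R]) hyp_integral F0); last first.
    rewrite integral_cst//= lebesgue_measure_itv/= lte_fin ltr01 -EFinB subr0 mule1//.
  rewrite [RHS]integral_mkcond; apply: eq_integral => s _.
  rewrite patchE mem_setE; case: ifPn => [s01|s01]; last first.
    apply: integral0_eq => t _; rewrite /= indicE memNset//.
    by rewrite /A => -[/= s01' _]; rewrite s01' in s01.
  rewrite -(@hyp_integral_move F0 x y s) //; last exact: measurable_coord_eq0.
  apply: eq_integral => t _; congr EFin; rewrite /= indicE /F0.
  rewrite coord_config_move eqxx (eq_sym x) (negbTE yx) subr0 mulr1.
  congr (_%:R); congr nat_of_bool; apply/idP/eqP; first by rewrite inE => -[].
  by move=> e; rewrite inE; split.
have rhs : \int[leb]_t fubini_G mu (EFin \o \1_A) t = 0.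
  apply: integral0_eq => t _; rewrite indic_fubini_tonelli_GE//=.
  apply/eqP; rewrite -measure_le0.
  have <- : mu [set (- coord (simplex_chart t) x)%R] = 0 by exact: lebesgue_measure_set1.
  apply: le_measure; rewrite ?inE//; first exact: measurable_ysection.
  move=> s; rewrite /ysection/= inE => -[_ /= /eqP]; rewrite addrC addr_eq0 => /eqP.
  by [].
by rewrite -lhs fub rhs.
Qed.

(** Lets [dirichlet_weight] and [dirichlet_kernel] be interchanged: their conventions for powers of
    0 differ, but only on the faces, which are null. *)
Lemma hyp_integral_interior F G :
  measurable_fun [set: config V R] F -> measurable_fun [set: config V R] G ->
  (forall eta, 0 <= F eta) -> (forall eta, 0 <= G eta) ->
  (forall eta, (\sum_x coord eta x = 1)%R -> (forall x, coord eta x != 0%R) ->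
    F eta = G eta) ->
  hyp_integral F = hyp_integral G.
Proof.
move=> mF mG F0 G0 FG; apply: ge0_ae_eq_integral => //; try exact: measurable_chart_comp.
pose S (eta : config V R) : \bar R := \sum_x (coord eta x == 0)%:R%:E.
have mS : measurable_fun [set: config V R] S.
  by apply: emeasurable_sum => x; exact: measurable_coord_eq0.
have S0 : hyp_integral S = 0.
  rewrite /hyp_integral ge0_integral_sum//.
    by apply: big1 => x _; exact: hyp_integral_face.
  by move=> x; exact: (measurable_chart_comp (measurable_coord_eq0 x)).
have Sge0 eta : 0 <= S eta by apply: sume_ge0.
have : ae_eq leb setT (fun t => S (simplex_chart t)) (cst 0).
  apply/(ae_eq_integral_abs leb measurableT (measurable_chart_comp mS)).
  by under eq_integral do rewrite gee0_abs//.
apply: filterS => t /(_ I) /= St _; apply: FG => [|x]; first exact: sum_coord_chart.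
apply/eqP => cx; move: St; rewrite /S (bigD1 x)//= cx eqxx => /eqP.
by rewrite gt_eqF// (lt_le_trans lte01)// leeDl// sume_ge0.
Qed.

Variable alpha : V -> R.
Hypothesis alpha_gt0 : forall x, (0 < alpha x)%R.

Definition dirichlet_kernel (a : V -> R) (eta : config V R) : R :=
  (\prod_x pospow (a x) (coord eta x))%R.

Lemma dirichlet_kernel_ge0 a eta : (0 <= dirichlet_kernel a eta)%R.
Proof. by apply: prodr_ge0 => x _; exact: pospow_ge0. Qed.

Lemma measurable_dirichlet_kernelV a :
  measurable_fun [set: config V R] (dirichlet_kernel a).
Proof.
by apply: measurable_prod => x _; apply: measurable_pospow_comp; exact: measurable_coord.
Qed.

Lemma hyp_integral_kernel a : (forall x, 0 < a x)%R -> exists2 C : R, (0 < C)%R &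
  hyp_integral (fun eta => (dirichlet_kernel a eta)%:E) = C%:E.
Proof.
move=> a0; have [x0 _] := card_gt0P V0.
have [C C0 HC] := dirichlet_kernel_integral
  (fun i : 'I_#|V|.-1 => a0 (nth x0 (enum V) i)) (a0 (nth x0 (enum V) #|V|.-1)).
exists C => //; rewrite -[C]mulr1 -(pospow_at1
  (\sum_(i < #|V|.-1) a (nth x0 (enum V) i) + a (nth x0 (enum V) #|V|.-1))) -HC.
apply: eq_integral => t _; congr EFin.
by rewrite /dirichlet_kernel (big_coord_chart _ (fun x => pospow (a x)) x0).
Qed.

Local Notation simplex := (@simplex R V).

Lemma dirichlet_kernel_interior a eta : (\sum_x coord eta x = 1)%R ->
  (forall x, coord eta x != 0%R) ->
  (\1_simplex eta * dirichlet_weight a eta)%R = dirichlet_kernel a eta.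
Proof.
move=> e1 en0; rewrite indicE; have [|] := boolP (eta \in simplex).
  rewrite inE => -[e0 _]; rewrite mul1r; apply: eq_bigr => x _.
  by rewrite /pospow lt_neqAle eq_sym en0 e0.
rewrite notin_setE => ne; rewrite mul0r; apply/esym/eqP/prodf_eq0.
have [x xlt0] : exists x, (coord eta x < 0)%R.
  apply: contrapT => /forallNP h; apply: ne; split=> // x.
  by rewrite leNgt; apply/negP/h.
by exists x => //; rewrite pospow_le0// ltW.
Qed.

Lemma hyp_integral_uniform : exists2 k : R, (0 < k)%R &
  forall F, measurable_fun [set: config V R] F -> (forall eta, 0 <= F eta) ->
  \int[uniform_simplex R V]_eta F eta =
  k%:E * hyp_integral (fun eta => (\1_simplex eta)%:E * F eta).
Proof.
have m1 F : measurable_fun [set: config V R] F ->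
    measurable_fun [set: config V R] (fun eta => (\1_simplex eta)%:E * F eta).
  move=> mF; apply: emeasurable_funM => //; apply/measurable_EFinP.
  by apply: measurable_indic; exact: measurable_simplex.
(* With all exponents equal to 1 the kernel is the indicator of Omega up to the faces, so C is the
   volume of the chart domain. *)
have [C C0 HC] := @hyp_integral_kernel (fun=> 1%R) (fun=> ltr01).
have mc := @measurable_corner_simplex R #|V|.-1.
have mi : measurable_fun [set: #|V|.-1.-tuple R] (\1_(@corner_simplex R #|V|.-1) : _ -> R).
  exact: measurable_indic.
have int1 (F : #|V|.-1.-tuple R -> \bar R) :
    measurable_fun setT F -> (forall t, 0 <= F t) ->
    \int[mrestr leb mc]_t F t = \int[leb]_t ((\1_(@corner_simplex R #|V|.-1) t)%:E * F t).
  move=> mF F0; rewrite -(ge0_integral_density leb mi)//.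
  apply: eq_measure_integral => A mA _.
  rewrite -[RHS]/(\int[leb]_(t in A) (\1_(@corner_simplex R #|V|.-1) t)%:E).
  by rewrite integral_indic// setIC.
have corner1 t : \1_(@corner_simplex R #|V|.-1) t = \1_simplex (simplex_chart t) :> R.
  rewrite !indicE; congr (_%:R); congr nat_of_bool; apply/idP/idP; rewrite !inE.
    by move/(simplex_corner t V0).
  by move/(simplex_corner t V0).
have mass : mrestr leb mc setT = C%:E.
  transitivity (\int[mrestr leb mc]_t (cst 1 t)); first by rewrite integral_cst// mul1e.
  rewrite int1// -HC; transitivity (hyp_integral (fun eta => (\1_simplex eta)%:E)).
    by apply: eq_integral => t _; rewrite mule1 corner1.
  apply: hyp_integral_interior.
  - by apply/measurable_EFinP; apply: measurable_indic; exact: measurable_simplex.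
  - by apply/measurable_EFinP; exact: measurable_dirichlet_kernelV.
  - by move=> eta; rewrite lee_fin.
  - by move=> eta; rewrite lee_fin dirichlet_kernel_ge0.
  move=> eta eta1 eta0; congr EFin; rewrite -dirichlet_kernel_interior//.
  rewrite [dirichlet_weight _ _]big1 ?mulr1// => x _.
  by rewrite subrr powRr0.
exists C^-1%R; first by rewrite invr_gt0.
move=> F mF F0.
set P := mnormalize (mrestr leb mc)
   (dirac ([tuple of nseq #|V|.-1 0%R] : #|V|.-1.-tuple R)).
rewrite -(@ge0_integral_measure_preserving _ _ _ _ R P (uniform_simplex R V)
  (@simplex_chart R V) F)//.
rewrite (ge0_integral_mnormalize _ C0 mass)//; last exact: measurable_chart_comp.
rewrite int1//; last exact: measurable_chart_comp.
by congr (_ * _); apply: eq_integral => t _; rewrite corner1.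
Qed.

Lemma integral_dirichlet : exists2 K : R, (0 < K)%R &
  forall F, measurable_fun [set: config V R] F -> (forall eta, 0 <= F eta) ->
  \int[dirichlet alpha]_eta F eta =
  K%:E * hyp_integral (fun eta => (dirichlet_kernel alpha eta)%:E * F eta).
Proof.
have [k k0 Hk] := hyp_integral_uniform.
have [C C0 HC] := hyp_integral_kernel alpha_gt0.
set w := density_measure (uniform_simplex R V) (measurable_dirichlet_weight alpha)
  (dirichlet_weight_ge0 alpha).
have mw := measurable_dirichlet_weight alpha.
have intw F : measurable_fun [set: config V R] F -> (forall eta, 0 <= F eta) ->
    \int[w]_eta F eta =
    k%:E * hyp_integral (fun eta => (dirichlet_kernel alpha eta)%:E * F eta).
  move=> mF F0; rewrite ge0_integral_density//.
  have mwF : measurable_fun [set: config V R]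
      (fun eta => (dirichlet_weight alpha eta)%:E * F eta).
    by apply: emeasurable_funM => //; exact/measurable_EFinP.
  have wF0 eta : 0 <= (dirichlet_weight alpha eta)%:E * F eta.
    by rewrite mule_ge0// lee_fin dirichlet_weight_ge0.
  rewrite Hk//; congr (_ * _); apply: hyp_integral_interior.
  - apply: emeasurable_funM => //; apply/measurable_EFinP.
    by apply: measurable_indic; exact: measurable_simplex.
  - apply: emeasurable_funM => //; apply/measurable_EFinP.
    exact: measurable_dirichlet_kernelV.
  - by move=> eta; rewrite mule_ge0// lee_fin.
  - by move=> eta; rewrite mule_ge0// lee_fin dirichlet_kernel_ge0.
  by move=> eta e1 e0; rewrite muleA -EFinM dirichlet_kernel_interior.
have mass : w setT = (k * C)%:E.
  transitivity (\int[w]_t (cst 1 t)); first by rewrite integral_cst// mul1e.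
  rewrite intw// EFinM -HC; congr (_ * _); apply: eq_integral => t _.
  by rewrite mule1.
exists ((k * C)^-1 * k)%R; first by rewrite mulr_gt0// invr_gt0 mulr_gt0.
move=> F mF F0; rewrite (ge0_integral_mnormalize _ (mulr_gt0 k0 C0) mass)//.
by rewrite intw// muleA EFinM.
Qed.

End hyperplane_integral.

(** * Reversibility *)

Lemma ge0_integral_scale d (T : measurableType d) (R : realType)
    (m : {measure set T -> \bar R}) (k : R) (f : T -> \bar R) :
  0 <= k -> measurable_fun [set: T] f -> (forall x, (0 <= f x)%E) ->
  (k%:E * \int[m]_x f x = \int[m]_x (k%:E * f x))%E.
Proof. by move=> k0 mf f0; rewrite ge0_integralZl_EFin. Qed.

(** * The Beta law and the splitting of mass *)

Section beta_law_theory.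
Context (R : realType).
Local Notation mu := (@lebesgue_measure R).
Local Notation TR := (measurableTypeR R).
Local Open Scope ereal_scope.

Lemma beta_weightE (a b : R) x :
  beta_weight a b x = (pospow a x * pospow b (1 - x))%R.
Proof.
rewrite /beta_weight patchE mem_setE in_itv/= /pospow subr_gt0.
by case: (ltP 0%R x) => /= x0; rewrite ?mul0r//; case: ifP => // _; rewrite mulr0.
Qed.

Lemma ge0_integral_beta (a b : R) (f : TR -> \bar R) : (0 < a)%R -> (0 < b)%R ->
  measurable_fun [set: TR] f -> (forall x, 0 <= f x) ->
  \int[beta_law a b]_x f x =
  ((beta_int a b)^-1)%:E * \int[mu]_x ((pospow a x * pospow b (1 - x))%:E * f x).
Proof.
move=> a0 b0 mf f0.
set w := density_measure mu (measurable_beta_weight a b) (beta_weight_ge0 a b).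
have intw (g : TR -> \bar R) : measurable_fun [set: TR] g -> (forall x, 0 <= g x) ->
    \int[w]_x g x = \int[mu]_x ((pospow a x * pospow b (1 - x))%:E * g x).
  move=> mg g0; rewrite ge0_integral_density//.
  by apply: eq_integral => x _; rewrite beta_weightE.
have mass : w setT = (beta_int a b)%:E.
  transitivity (\int[w]_t (cst 1 t)); first by rewrite integral_cst// mul1e.
  rewrite intw// -integral_beta_int//; apply: eq_integral => t _.
  by rewrite mule1.
by rewrite (ge0_integral_mnormalize _ (beta_int_gt0 a0 b0) mass)// intw.
Qed.

(** With B = (1 - u) s, the weight of a mass s with exponent a + k becomes the product of the weight
    of the retained part s - B with exponent a and that of the transferred part B with exponent k.
    This is the reason for the parameters alpha - kappa and kappa in the model. *)
Lemma beta_subst (a k s : R) (h : TR -> \bar R) : (0 < a)%R -> (0 < k)%R ->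
  measurable_fun [set: TR] h -> (forall x, 0 <= h x) ->
  (pospow (a + k) s)%:E * \int[beta_law a k]_u h ((1 - u) * s)%R =
  ((beta_int a k)^-1)%:E *
    \int[mu]_B ((pospow a (s - B) * pospow k B)%:E * h B).
Proof.
move=> a0 k0 mh h0.
have maff : measurable_fun [set: TR] ((fun u => (1 - u) * s)%R : TR -> TR).
  by apply: measurable_funM => //; exact: measurable_funB.
have mk (p q r : R) : measurable_fun [set: TR] (fun x => (pospow p (r - x) * pospow q x)%:E).
  apply/measurable_EFinP; apply: measurable_funM; last exact: measurable_pospow.
  by apply: measurable_pospow_comp; exact: measurable_funB.
have [s0|s0] := leP s 0%R.
  rewrite pospow_le0// mul0e integral0_eq ?mule0// => B _.
  have [B0|B0] := leP B 0%R; first by rewrite (pospow_le0 k B0) mulr0 mul0e.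
  by rewrite (@pospow_le0 _ a) ?mul0r ?mul0e// subr_le0 (le_trans s0)// ltW.
have mhs : measurable_fun [set: TR] (fun x => h (s * x)%R).
  have ms : measurable_fun [set: TR] ((fun u => s * u)%R : TR -> TR).
    exact: measurable_funM.
  exact: measurableT_comp mh ms.
pose g x := (pospow a (s - x) * pospow k x)%:E * h x.
have mg : measurable_fun [set: TR] g by exact: emeasurable_funM.
have g0 x : 0 <= g x by rewrite mule_ge0// lee_fin mulr_ge0// pospow_ge0.
pose f x := (pospow a (1 - x) * pospow k x)%:E * h (s * x)%R.
have mf : measurable_fun [set: TR] f by exact: emeasurable_funM.
have f0 x : 0 <= f x by rewrite mule_ge0// lee_fin mulr_ge0// pospow_ge0.
have sak : (s `^ (a + k - 1) = s * s `^ (a - 1) * s `^ (k - 1))%R.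
  have sn0 (r t : R) : (r + t == 0)%R ==> (s != 0%R) by rewrite (gt_eqF s0) implybT.
  rewrite (_ : a + k - 1 = 1 + (a - 1) + (k - 1))%R; last by ring.
  by rewrite (powRD (sn0 (1 + (a - 1)) _)%R) (powRD (sn0 1 (a - 1)))%R powRr1 ?ltW.
have fg x : (pospow (a + k) s)%:E * f x = s%:E * g (s * x)%R.
  rewrite /f /g !muleA -!EFinM; congr (_%:E * _).
  rewrite (_ : s - s * x = s * (1 - x))%R; last by ring.
  rewrite !pospow_dilate// {1}/pospow s0.
  by rewrite sak; ring.
have fE : \int[mu]_x f x = \int[mu]_x ((pospow a x * pospow k (1 - x))%:E * h ((1 - x) * s)%R).
  rewrite -(ge0_integral_reflect 1%R mf f0).
  by apply: eq_integral => x _; rewrite /f subKr (mulrC s).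
have -> : \int[beta_law a k]_u h ((1 - u) * s)%R = ((beta_int a k)^-1)%:E * \int[mu]_x f x.
  have -> := ge0_integral_beta (f := fun u => h ((1 - u) * s)%R) a0 k0
    (measurableT_comp mh maff) (fun u => h0 _).
  exact: (f_equal (fun X => ((beta_int a k)^-1)%:E * X) (esym fE)).
rewrite muleCA.
have -> : (pospow (a + k) s)%:E * \int[mu]_x f x = \int[mu]_x g x; last by [].
rewrite -(ge0_integral_dilate s0 mg g0).
have ms : measurable_fun [set: TR] ((fun u => s * u)%R : TR -> TR) by exact: measurable_funM.
rewrite (ge0_integral_scale _ (pospow_ge0 _ _) mf f0).
rewrite (ge0_integral_scale _ (ltW s0) (measurableT_comp mg ms) (fun x => g0 (s * x)%R)).
by apply: eq_integral => x _; exact: fg.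
Qed.

Lemma beta_subst2 (a b k s1 s2 : R) (h : TR * TR -> \bar R) :
  (0 < a)%R -> (0 < b)%R -> (0 < k)%R ->
  measurable_fun [set: TR * TR] h -> (forall x, 0 <= h x) ->
  (pospow (a + k) s1 * pospow (b + k) s2)%:E *
    \int[(beta_law a k \x beta_law b k)]_p h ((1 - p.1) * s1, (1 - p.2) * s2)%R =
  ((beta_int a k)^-1 * (beta_int b k)^-1)%:E *
    \int[(mu \x mu)]_p ((pospow a (s1 - p.1) * pospow k p.1 *
                       (pospow b (s2 - p.2) * pospow k p.2))%:E * h p).
Proof.
move=> a0 b0 k0 mh h0.
have mk (p q r : R) : measurable_fun [set: TR] (fun x => (pospow p (r - x) * pospow q x)%:E).
  apply/measurable_EFinP; apply: measurable_funM; last exact: measurable_pospow.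
  by apply: measurable_pospow_comp; exact: measurable_funB.
have maff (s : R) : measurable_fun [set: TR] ((fun u => (1 - u) * s)%R : TR -> TR).
  by apply: measurable_funM => //; exact: measurable_funB.
have maff2 : measurable_fun [set: TR * TR] ((fun p => ((1 - p.1) * s1, (1 - p.2) * s2))%R
    : TR * TR -> TR * TR).
  apply: measurable_fun_pair.
    exact: measurableT_comp (maff s1) measurable_fst.
  exact: measurableT_comp (maff s2) measurable_snd.
rewrite (fubini_tonelli1 (fun p : TR * TR => h ((1 - p.1) * s1, (1 - p.2) * s2)%R))//; last first.
  exact: measurableT_comp mh maff2.
rewrite /fubini_F/=.
pose c2 := ((beta_int b k)^-1)%R.
have c20 : (0 <= c2)%R by rewrite invr_ge0 ltW// beta_int_gt0.
pose q (p : TR * TR) := (pospow b (s2 - p.2) * pospow k p.2)%:E * h p.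
have q0 p : 0 <= q p by rewrite mule_ge0// lee_fin mulr_ge0// pospow_ge0.
have mq : measurable_fun [set: TR * TR] q.
  apply: emeasurable_funM => //.
  exact: measurableT_comp (mk b k s2) measurable_snd.
pose g (B : TR) := c2%:E * \int[mu]_D q (B, D).
have mg : measurable_fun [set: TR] g.
  apply: emeasurable_funM => //.
  exact: (measurable_fun_fubini_tonelli_F q mq q0).
have g0 B : 0 <= g B by rewrite mule_ge0// integral_ge0.
have inner u : (pospow (b + k) s2)%:E * \int[beta_law b k]_w h ((1 - u) * s1, (1 - w) * s2)%R
    = g ((1 - u) * s1)%R.
  apply: (beta_subst s2 b0 k0 (h := fun D => h ((1 - u) * s1, D)%R)) => //.
  exact: measurableT_comp mh (pair1_measurable _).
pose F u := \int[beta_law b k]_w h ((1 - u) * s1, (1 - w) * s2)%R.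
have mF : measurable_fun [set: TR] F.
  apply: (measurable_fun_fubini_tonelli_F (fun p : TR * TR => h ((1 - p.1) * s1, (1 - p.2) * s2)%R)) => //.
  exact: measurableT_comp mh maff2.
have F0 u : 0 <= F u by rewrite integral_ge0.
rewrite EFinM -muleA -[X in _ * (_ * X)]/(\int[beta_law a k]_u F u).
have -> : (pospow (b + k) s2)%:E * \int[beta_law a k]_u F u =
    \int[beta_law a k]_u g ((1 - u) * s1)%R.
  rewrite (ge0_integral_scale _ (pospow_ge0 _ _) mF F0).
  by apply: eq_integral => u _; exact: inner.
rewrite (beta_subst s1 a0 k0 mg g0) EFinM -muleA; congr (_ * _).
pose r (p : TR * TR) := (pospow a (s1 - p.1) * pospow k p.1 *
                       (pospow b (s2 - p.2) * pospow k p.2))%:E * h p.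
have rE p : r p = (pospow a (s1 - p.1) * pospow k p.1)%:E * q p.
  by rewrite /r /q muleA -EFinM.
have r0 p : 0 <= r p by rewrite rE mule_ge0// lee_fin mulr_ge0// pospow_ge0.
have mr : measurable_fun [set: TR * TR] r.
  rewrite (_ : r = fun p => (pospow a (s1 - p.1) * pospow k p.1)%:E * q p); last exact/funext.
  apply: emeasurable_funM => //.
  exact: measurableT_comp (mk a k s1) measurable_fst.
rewrite -[X in _ = _ * X]/(\int[(mu \x mu)]_p r p) (fubini_tonelli1 r mr r0).
rewrite (ge0_integral_scale mu (f := fubini_F mu r) c20 (measurable_fun_fubini_tonelli_F r mr r0)).
  2: by move=> x; exact: integral_ge0.
apply: eq_integral => B _; rewrite /fubini_F /g.
rewrite muleCA; have -> : (pospow a (s1 - B) * pospow k B)%:E * \int[mu]_D q (B, D) =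
  \int[mu]_y r (B, y); last by [].
rewrite (@ge0_integral_scale _ _ _ mu _ (fun D => q (B, D)))//.
- by apply: eq_integral => D _; rewrite rE.
- by rewrite mulr_ge0// pospow_ge0.
- exact: measurableT_comp mq (pair1_measurable B).
Qed.

End beta_law_theory.

Lemma measurable_uncurry_comp d d1 d2 d3 (T : measurableType d) (T1 : measurableType d1)
    (T2 : measurableType d2) (T3 : measurableType d3) (G : T1 -> T2 -> T3)
    (e1 : T -> T1) (e2 : T -> T2) :
  measurable_fun [set: T1 * T2] (fun q => G q.1 q.2) ->
  measurable_fun [set: T] e1 -> measurable_fun [set: T] e2 ->
  measurable_fun [set: T] (fun p => G (e1 p) (e2 p)).
Proof. by move=> mG me1 me2; exact: measurableT_comp mG (measurable_fun_pair me1 me2). Qed.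

Section lebesgue_plane.
Context (R : realType).
Local Notation mu := (@lebesgue_measure R).

(** A name of its own lets the product serve as a single sigma-finite factor when Tonelli is applied
    against the chart. *)
Definition lebesgue_plane : set (measurableTypeR R * measurableTypeR R) -> \bar R :=
  (mu \x mu)%E.

HB.instance Definition _ := Measure.on lebesgue_plane.

Let lebesgue_plane_sigma_finite : sigma_finite [set: _] lebesgue_plane.
Proof.
have /sigma_finiteP[F [TF ndF Ffin]] := sigma_finiteT mu.
exists (fun n => F n `*` F n) => [|n].
  apply/esym; rewrite -subTset => -[u v] _.
  have [i _ Fi] : (\bigcup_i F i) u by rewrite -TF.
  have [j _ Fj] : (\bigcup_i F i) v by rewrite -TF.
  exists (maxn i j) => //; split.
  - by move: Fi; exact/subsetPset/ndF/leq_maxl.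
  - by move: Fj; exact/subsetPset/ndF/leq_maxr.
have [mFn Fn] := Ffin n; split; first exact: measurableX.
by rewrite /lebesgue_plane product_measure1E// lte_mul_pinfty// ge0_fin_numE.
Qed.

HB.instance Definition _ := Measure_isSigmaFinite.Build _ _ _ lebesgue_plane
  lebesgue_plane_sigma_finite.

End lebesgue_plane.

Definition exchange_law (R : realType) (V : finType) (alpha : V -> R) (kappa : R) (x y : V) :
    probability (measurableTypeR R * measurableTypeR R)%type R :=
  (beta_law (alpha x - kappa) kappa \x beta_law (alpha y - kappa) kappa)%E.

(** * The joint law of a configuration and its update *)

Section reversibility.
Context (R : realType) (V : finType).
Hypothesis V2 : (1 < #|V|)%N.
Variables (alpha : V -> R) (kappa : R).
Hypotheses (kappa_gt0 : 0 < kappa) (kappa_lt : forall x, kappa < alpha x).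
Variables (x y : V).
Hypothesis xy : x != y.
Local Notation mu := (@lebesgue_measure R).
Local Notation TR := (measurableTypeR R).
Local Notation leb := (lebesgue_tuple R #|V|.-1).
Local Notation D := (dirichlet alpha).
Local Notation Q := (exchange_law alpha kappa x y).
Local Notation plane := (@lebesgue_plane R).
Local Open Scope ereal_scope.

Let V0 : (0 < #|V|)%N := ltnW V2.
Let a0 z : (0 < alpha z - kappa)%R.
Proof. by rewrite subr_gt0. Qed.
Let alpha_gt0 z : (0 < alpha z)%R.
Proof. exact: lt_trans kappa_gt0 (kappa_lt z). Qed.

Implicit Types (G : config V R -> config V R -> \bar R).

Lemma exchange_move (eta : config V R) u w :
  exchange eta x y u w = config_move eta x y ((1 - w) * coord eta y - (1 - u) * coord eta x)%R.
Proof.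
apply: config_ext => z; rewrite coord_config_move coord_config_of.
have [->|zx] := eqVneq z x; first by rewrite (negbTE xy)/=; ring.
by have [->|zy] := eqVneq z y; rewrite /=; ring.
Qed.

Let rest (eta : config V R) : R := (\prod_(z | (z != x) && (z != y)) pospow (alpha z) (coord eta z))%R.

(** The mass [p.1] leaves x and [p.2] leaves y; the four factors weigh the retained and the
    transferred masses. The transferred ones have the same exponent kappa at both ends, which is
    what allows them to be swapped. *)
Let ker (eta : config V R) (p : TR * TR) : R :=
  (pospow (alpha x - kappa) (coord eta x - p.1) * pospow kappa p.1 *
   (pospow (alpha y - kappa) (coord eta y - p.2) * pospow kappa p.2))%R.

Let Phi G eta p : \bar R :=
  (rest eta * ker eta p)%:E * G eta (config_move eta x y (p.2 - p.1)%R).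

Let kernel_rest eta : (dirichlet_kernel alpha eta =
  rest eta * (pospow (alpha x) (coord eta x) * pospow (alpha y) (coord eta y)))%R.
Proof.
rewrite /dirichlet_kernel (bigD1 x)//= (bigD1 y) 1?eq_sym//=.
by rewrite /rest mulrC -mulrA [RHS]mulrC; ring.
Qed.

Let rest_ge0 eta : (0 <= rest eta)%R.
Proof. by apply: prodr_ge0 => z _; exact: pospow_ge0. Qed.

Let ker_ge0 eta p : (0 <= ker eta p)%R.
Proof. by rewrite !mulr_ge0 ?pospow_ge0. Qed.

Let measurable_rest : measurable_fun [set: config V R] rest.
Proof.
rewrite (_ : rest = fun eta => \prod_z (if (z != x) && (z != y)
    then pospow (alpha z) (coord eta z) else 1))%R; last first.
  by apply/funext => eta; rewrite /rest big_mkcond.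
apply: measurable_prod => z _; case: ((z != x) && (z != y)) => //.
by apply: measurable_pospow_comp; exact: measurable_coord.
Qed.

Lemma measurable_config_move2 d (T : measurableType d) (e : T -> config V R) (s : T -> R) :
  measurable_fun [set: T] e -> measurable_fun [set: T] s ->
  measurable_fun [set: T] (fun p => config_move (e p) x y (s p)).
Proof.
move=> me ms; apply: measurable_config_of => z; apply: measurable_funD.
  exact: measurableT_comp (measurable_coord z) me.
exact: measurable_funM.
Qed.

Let mPhi G : measurable_fun [set: config V R * config V R] (fun q => G q.1 q.2) ->
  measurable_fun [set: config V R * (TR * TR)] (fun q => Phi G q.1 q.2).
Proof.
move=> mG.
have m1 : measurable_fun [set: config V R * (TR * TR)] (fun q => q.2.1 : R).
  exact: measurableT_comp measurable_fst measurable_snd.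
have m2 : measurable_fun [set: config V R * (TR * TR)] (fun q => q.2.2 : R).
  exact: measurableT_comp measurable_snd measurable_snd.
have mc z : measurable_fun [set: config V R * (TR * TR)] (fun q => coord q.1 z).
  exact: measurableT_comp (measurable_coord z) measurable_fst.
apply: emeasurable_funM.
  apply/measurable_EFinP; apply: measurable_funM.
    exact: measurableT_comp measurable_rest measurable_fst.
  by apply: measurable_funM; apply: measurable_funM; apply: measurable_pospow_comp => //;
    exact: measurable_funB.
apply: (measurable_uncurry_comp mG) => //.
by apply: measurable_config_move2 => //; exact: measurable_funB.
Qed.

Let Phi_ge0 G e p : (forall e e', 0 <= G e e') -> 0 <= Phi G e p.
Proof. by move=> G0; rewrite mule_ge0// lee_fin mulr_ge0. Qed.

Lemma measurable_exchange :
  measurable_fun [set: config V R * (TR * TR)] (fun q => exchange q.1 x y q.2.1 q.2.2).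
Proof.
rewrite (_ : (fun q => _) = fun q : config V R * (TR * TR) =>
  config_move q.1 x y ((1 - q.2.2) * coord q.1 y - (1 - q.2.1) * coord q.1 x)%R); last first.
  by apply/funext => q; rewrite exchange_move.
have m1 : measurable_fun [set: config V R * (TR * TR)] (fun q => q.2.1 : R).
  exact: measurableT_comp measurable_fst measurable_snd.
have m2 : measurable_fun [set: config V R * (TR * TR)] (fun q => q.2.2 : R).
  exact: measurableT_comp measurable_snd measurable_snd.
have mc z : measurable_fun [set: config V R * (TR * TR)] (fun q => coord q.1 z).
  exact: measurableT_comp (measurable_coord z) measurable_fst.
apply: measurable_config_move2 => //; apply: measurable_funB;
  by apply: measurable_funM => //; exact: measurable_funB.
Qed.

(** Passes from the Beta variables to the transferred masses: there the joint law has an explicit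
    density, and the update is a move by [p.2 - p.1]. *)
Let integral_exchange_kernel : exists2 K : R, (0 < K)%R & forall G,
  measurable_fun [set: config V R * config V R] (fun q => G q.1 q.2) ->
  (forall e e', 0 <= G e e') ->
  \int[D]_eta \int[Q]_p G eta (exchange eta x y p.1 p.2) =
  K%:E * \int[leb]_t \int[plane]_p Phi G (simplex_chart t) p.
Proof.
have [K K0 HK] := integral_dirichlet V2 alpha_gt0.
pose cx := beta_int (alpha x - kappa) kappa; pose cy := beta_int (alpha y - kappa) kappa.
have cx0 : (0 < cx)%R by exact: beta_int_gt0.
have cy0 : (0 < cy)%R by exact: beta_int_gt0.
have c0 : (0 < cx^-1 * cy^-1)%R by rewrite mulr_gt0 ?invr_gt0.
exists (K * (cx^-1 * cy^-1))%R; first exact: mulr_gt0.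
move=> G mG G0.
pose f (q : config V R * (TR * TR)) := G q.1 (exchange q.1 x y q.2.1 q.2.2).
have mf : measurable_fun [set: config V R * (TR * TR)] f.
  apply: (measurable_uncurry_comp mG) => //.
  exact: measurable_exchange.
have f0 q : 0 <= f q by exact: G0.
pose F eta := \int[Q]_p f (eta, p).
have mF : measurable_fun [set: config V R] F.
  exact: (@measurable_fun_fubini_tonelli_F _ _ _ _ R Q f mf f0).
have F0 eta : 0 <= F eta by exact: integral_ge0.
pose P eta := \int[plane]_p Phi G eta p.
have mP : measurable_fun [set: config V R] P.
  exact: (@measurable_fun_fubini_tonelli_F _ _ _ _ R plane
    (fun q => Phi G q.1 q.2) (mPhi mG) (fun q => Phi_ge0 _ _ G0)).
have P0 eta : 0 <= P eta by apply: integral_ge0 => p _; exact: Phi_ge0.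
rewrite -[LHS]/(\int[D]_eta F eta) HK// -[in RHS]/(\int[leb]_t P (simplex_chart t)).
rewrite EFinM -muleA.
have -> : hyp_integral (fun eta => (dirichlet_kernel alpha eta)%:E * F eta) =
  (cx^-1 * cy^-1)%:E * \int[leb]_t P (simplex_chart t); last by [].
rewrite (ge0_integral_scale leb (ltW c0) (measurable_chart_comp mP) (fun t => P0 _)).
apply: eq_integral => t _; set eta := simplex_chart t.
rewrite kernel_rest EFinM -muleA.
pose h (p : TR * TR) := G eta (config_move eta x y (p.2 - p.1)%R).
have mh : measurable_fun [set: TR * TR] h.
  apply: (measurable_uncurry_comp mG) => //.
  apply: measurable_config_move2 => //; apply: measurable_funB; first exact: measurable_snd.
  exact: measurable_fst.
have h0 p : 0 <= h p by exact: G0.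
have := beta_subst2 (coord eta x) (coord eta y) (a0 x) (a0 y) kappa_gt0 mh h0.
rewrite !subrK -[X in _ * X = _]/(\int[Q]_p h ((1 - p.1) * coord eta x, (1 - p.2) * coord eta y)%R).
rewrite -[X in _ = _ * X]/(\int[plane]_p ((pospow (alpha x - kappa) (coord eta x - p.1) *
    pospow kappa p.1 *
    (pospow (alpha y - kappa) (coord eta y - p.2) * pospow kappa p.2))%:E * h p)) => E.
have FE : F eta = \int[Q]_p
    h ((1 - p.1) * coord eta x, (1 - p.2) * coord eta y)%R.
  by apply: eq_integral => p _; rewrite /f /h /= exchange_move.
rewrite FE E muleCA.
have -> : (rest eta)%:E * \int[plane]_p ((pospow (alpha x - kappa) (coord eta x - p.1) * pospow kappa p.1 *
    (pospow (alpha y - kappa) (coord eta y - p.2) * pospow kappa p.2))%:E * h p) = P eta; last by [].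
rewrite ge0_integral_scale//.
- by apply: eq_integral => p _; rewrite muleA -EFinM.
- have mks z : measurable_fun [set: TR] (fun u => pospow (alpha z - kappa) (coord eta z - u) * pospow kappa u)%R.
    apply: measurable_funM; last exact: measurable_pospow.
    by apply: measurable_pospow_comp; exact: measurable_funB.
  apply: emeasurable_funM => //; apply/measurable_EFinP; apply: measurable_funM.
    exact: measurableT_comp (mks x) measurable_fst.
  exact: measurableT_comp (mks y) measurable_snd.
- by move=> p; rewrite mule_ge0// lee_fin; exact: (ker_ge0 eta p).
Qed.

(* In terms of the transferred masses [B] and [D], exchanging [B] and [D] and
   translating the configuration by [B - D] swaps the two configurations. *)
Theorem exchange_reversible G :
  measurable_fun [set: config V R * config V R] (fun q => G q.1 q.2) ->
  (forall e e', 0 <= G e e') ->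
  \int[D]_eta \int[Q]_p G eta (exchange eta x y p.1 p.2) =
  \int[D]_eta \int[Q]_p G (exchange eta x y p.1 p.2) eta.
Proof.
move=> mG G0; have [K K0 HK] := integral_exchange_kernel.
pose G' e e' := G e' e.
have mG' : measurable_fun [set: config V R * config V R] (fun q => G' q.1 q.2).
  exact: measurableT_comp mG (@measurable_swap _ _ _ _).
have G'0 e e' : 0 <= G' e e' by exact: G0.
rewrite (HK _ mG G0) (HK _ mG' G'0).
pose f (q : #|V|.-1.-tuple R * (TR * TR)) := Phi G (simplex_chart q.1) q.2.
pose f' (q : #|V|.-1.-tuple R * (TR * TR)) := Phi G' (simplex_chart q.1) q.2.
pose f2 (q : #|V|.-1.-tuple R * (TR * TR)) := Phi G' (simplex_chart q.1) (swap_pair q.2).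
have mchart : measurable_fun [set: #|V|.-1.-tuple R * (TR * TR)]
    (fun q => (simplex_chart q.1, q.2)).
  apply: measurable_fun_pair => //.
  exact: measurableT_comp (@measurable_simplex_chart R V) measurable_fst.
have mf : measurable_fun setT f by exact: (measurableT_comp (mPhi mG) mchart).
have mf' : measurable_fun setT f' by exact: (measurableT_comp (mPhi mG') mchart).
have f0 q : 0 <= f q by exact: Phi_ge0.
have f'0 q : 0 <= f' q by exact: Phi_ge0.
have msw : measurable_fun [set: #|V|.-1.-tuple R * (TR * TR)] (fun q => (q.1, swap_pair q.2)).
  apply: measurable_fun_pair => //.
  exact: measurableT_comp (@measurable_swap _ _ _ _) measurable_snd.
have mf2 : measurable_fun setT f2 by exact: (measurableT_comp mf' msw).
have f20 q : 0 <= f2 q by exact: Phi_ge0.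
have E1 : \int[leb]_t \int[plane]_p f (t, p) = \int[leb]_t \int[plane]_p f2 (t, p).
  have e1 := fubini_tonelli (m1 := leb) (m2 := plane) f mf f0.
  have e2 := fubini_tonelli (m1 := leb) (m2 := plane) f2 mf2 f20.
  apply: (etrans e1); apply: etrans (esym e2).
  apply: eq_integral => p _; rewrite /fubini_G.
  (* With the masses p fixed outside, the translation is by a constant. After it the mass retained
     at x is that of the swapped exchange, and likewise at y. *)
  rewrite -[LHS](hyp_integral_move V2 x y (p.1 - p.2)%R (F := fun eta => Phi G eta p)); last 2 first.
  - exact: measurableT_comp (mPhi mG) (pair2_measurable p).
  - by move=> eta; exact: Phi_ge0.
  apply: eq_integral => t _; rewrite /f2 /Phi /G'/=; set eta := simplex_chart t.
  have back : config_move (config_move eta x y (p.1 - p.2)%R) x y (p.2 - p.1)%R = eta.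
    by apply: config_ext => z; rewrite !coord_config_move; ring.
  rewrite back; congr (_%:E * _); congr (_ * _)%R.
    apply: eq_bigr => z /andP[zx zy]; rewrite coord_config_move.
    by rewrite (negbTE zx) (negbTE zy) subrr mulr0 addr0.
  rewrite /ker/= !coord_config_move !eqxx (negbTE xy) eq_sym (negbTE xy).
  rewrite subr0 sub0r mulr1 mulrN1.
  rewrite (_ : coord eta x + (p.1 - p.2) - p.1 = coord eta x - p.2)%R; last by ring.
  rewrite (_ : coord eta y - (p.1 - p.2) - p.2 = coord eta y - p.1)%R; last by ring.
  by ring.
have E2 : \int[leb]_t \int[plane]_p f2 (t, p) = \int[leb]_t \int[plane]_p f' (t, p).
  apply: eq_integral => t _.
  have mft : measurable_fun [set: TR * TR] (fun p => f' (t, p)).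
    exact: measurableT_comp mf' (pair1_measurable t).
  have mf2t : measurable_fun [set: TR * TR] (fun p => f2 (t, p)).
    exact: measurableT_comp mf2 (pair1_measurable t).
  have e1 := fubini_tonelli1 (m1 := mu) (m2 := mu) (fun p => f2 (t, p)) mf2t (fun p => f20 _).
  have e2 := fubini_tonelli2 (m1 := mu) (m2 := mu) (fun p => f' (t, p)) mft (fun p => f'0 _).
  exact: (etrans e1 (esym e2)).
exact: (f_equal (fun X => K%:E * X) (etrans E1 E2)).
Qed.

End reversibility.

(** * Expectations and moments *)

Section full_expectation.
Context d (T : measurableType d) (R : realType) (P : probability T R).
Variable S : set T.
Hypotheses (mS : measurable S) (PS : P S = 1%E).
Implicit Types f g h : T -> R.

(** Measurability is global but the bound is only on S: functions on Omega are represented on all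
    configurations, where coordinates are unbounded. *)
Definition bounded_on f := measurable_fun [set: T] f /\ exists K, forall x, S x -> `|f x| <= K.

Lemma full_ae (p : T -> Prop) : (forall x, S x -> p x) -> {ae P, forall x, p x}.
Proof.
move=> Sp; exists (~` S); split; first exact: measurableC.
  transitivity (1 - P S)%E; first exact: probability_setC.
  by rewrite PS subee.
by move=> x /= npx; apply: contra_not npx => Sx; exact: Sp.
Qed.

Lemma bounded_on_integrable f : bounded_on f -> P.-integrable [set: T] (EFin \o f).
Proof.
move=> [mf [K Kf]].
have ifS : P.-integrable S (EFin \o f).
  apply: measurable_bounded_integrable => //.
  - exact: le_lt_trans (probability_le1 P mS) (ltry 1).
  - exact: measurable_funTS.
  - exists K; split; first exact: num_real.
    by move=> M KM x Sx; exact: le_trans (Kf x Sx) (ltW KM).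
apply/integrableP; split; first exact/measurable_EFinP.
have /integrableP[_] := ifS; apply: le_lt_trans.
rewrite (ge0_negligible_integral (N := ~` S))//; last 3 first.
- exact: measurableC.
- by apply: measurableT_comp => //; exact/measurable_EFinP.
- transitivity (1 - P S)%E; first exact: probability_setC.
  by rewrite PS subee.
by rewrite setDE setCK setTI.
Qed.

Lemma bounded_onD f g : bounded_on f -> bounded_on g -> bounded_on (fun x => f x + g x).
Proof.
move=> [mf [K Kf]] [mg [L Lg]]; split; first exact: measurable_funD.
by exists (K + L) => x Sx; rewrite (le_trans (ler_normD _ _))// lerD// ?Kf// Lg.
Qed.

Lemma bounded_onM f g : bounded_on f -> bounded_on g -> bounded_on (fun x => f x * g x).
Proof.
move=> [mf [K Kf]] [mg [L Lg]]; split; first exact: measurable_funM.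
by exists (K * L) => x Sx; rewrite normrM ler_pM// ?Kf// Lg.
Qed.

Lemma bounded_on_cst k : bounded_on (fun=> k).
Proof. by split; [exact: measurable_cst|exists `|k|]. Qed.

Lemma bounded_onZ k f : bounded_on f -> bounded_on (fun x => k * f x).
Proof. exact/bounded_onM/bounded_on_cst. Qed.

Lemma bounded_onN f : bounded_on f -> bounded_on (fun x => - f x).
Proof.
move=> [mf [K Kf]]; split; last by exists K => x Sx; rewrite normrN Kf.
exact: measurableT_comp.
Qed.

Lemma bounded_onB f g : bounded_on f -> bounded_on g -> bounded_on (fun x => f x - g x).
Proof. by move=> bf bg; apply: bounded_onD => //; exact: bounded_onN. Qed.

Lemma bounded_on_sum I (r : seq I) (p : pred I) (F : I -> T -> R) :
  (forall i, bounded_on (F i)) -> bounded_on (fun x => \sum_(i <- r | p i) F i x).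
Proof.
move=> bF; elim: r => [|i r IH].
  by under eq_fun do rewrite big_nil; exact: bounded_on_cst.
under eq_fun do rewrite big_cons.
by case: (p i) => //; exact: bounded_onD.
Qed.

Lemma bounded_on_norm f : bounded_on f -> bounded_on (fun x => `|f x|).
Proof.
move=> [mf [K Kf]]; split; last by exists K => x Sx; rewrite normr_id Kf.
exact: measurableT_comp.
Qed.

Lemma expectationD f g : bounded_on f -> bounded_on g ->
  \int[P]_x (f x + g x) = \int[P]_x f x + \int[P]_x g x.
Proof. by move=> bf bg; rewrite RintegralD//; exact: bounded_on_integrable. Qed.

Lemma expectationB f g : bounded_on f -> bounded_on g ->
  \int[P]_x (f x - g x) = \int[P]_x f x - \int[P]_x g x.
Proof. by move=> bf bg; rewrite RintegralB//; exact: bounded_on_integrable. Qed.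

Lemma expectationZ k f : bounded_on f -> \int[P]_x (k * f x) = k * \int[P]_x f x.
Proof. by move=> bf; rewrite RintegralZl//; exact: bounded_on_integrable. Qed.

Lemma expectation_cst (k : R) : \int[P]_x k = k.
Proof.
rewrite Rintegral_cst// -[RHS]mulr1; congr (_ * _).
by rewrite -[X in fine X]/(P setT) probability_setT.
Qed.

Lemma expectation_sum I (r : seq I) (p : pred I) (F : I -> T -> R) :
  (forall i, bounded_on (F i)) ->
  \int[P]_x (\sum_(i <- r | p i) F i x) = \sum_(i <- r | p i) \int[P]_x F i x.
Proof.
move=> bF; elim: r => [|i r IH].
  by under eq_Rintegral do rewrite big_nil; rewrite expectation_cst big_nil.
under eq_Rintegral do rewrite big_cons.
rewrite big_cons; case: (p i); rewrite ?IH//.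
by rewrite expectationD ?IH//; exact: bounded_on_sum.
Qed.

Lemma expectation_full f : bounded_on f -> \int[P]_x f x = \int[P]_(x in S) f x.
Proof.
move=> bf; congr fine.
rewrite (negligible_integral (N := ~` S))//; last 3 first.
- exact: measurableC.
- exact: bounded_on_integrable.
- transitivity (1 - P S)%E; first exact: probability_setC.
  by rewrite PS subee.
by rewrite setDE setCK setTI.
Qed.

Lemma expectation_le f g : bounded_on f -> bounded_on g ->
  (forall x, S x -> f x <= g x) -> \int[P]_x f x <= \int[P]_x g x.
Proof.
move=> bf bg fg; rewrite !expectation_full//.
by apply: le_Rintegral => //; apply: integrableS (bounded_on_integrable _).
Qed.

Lemma expectation_eq f g : bounded_on f -> bounded_on g ->
  (forall x, S x -> f x = g x) -> \int[P]_x f x = \int[P]_x g x.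
Proof.
by move=> bf bg fg; apply/eqP; rewrite eq_le !expectation_le// => x Sx; rewrite fg.
Qed.

Lemma expectation_norm f : bounded_on f -> `|\int[P]_x f x| <= \int[P]_x `|f x|.
Proof.
move=> bf; rewrite ler_norml -[X in X <= _]mulN1r -expectationZ; last exact: bounded_on_norm.
apply/andP; split; apply: expectation_le => //; try exact: bounded_on_norm.
- by apply: bounded_onZ; exact: bounded_on_norm.
- by move=> x _; rewrite mulN1r lerNl -normrN ler_norm.
- by move=> x _; rewrite ler_norm.
Qed.

End full_expectation.

(** The source of the Cauchy-Schwarz inequalities below, for finite sums, for expectations and for
    the quadratic form of the Markov operator. *)
Lemma discriminant_le (R : realFieldType) (a b c : R) : 0 <= c ->
  (forall t, 0 <= a + 2 * t * b + t ^+ 2 * c) -> b ^+ 2 <= a * c.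
Proof.
rewrite le_eqVlt => /predU1P[<-|c0] h.
  have [->|b0] := eqVneq b 0; first by rewrite expr0n mulr0.
  (* For c = 0 the expression is affine in t; this t makes it -1. *)
  have := h (- (a + 1) / (2 * b)).
  rewrite (_ : _ + _ = -1); last by field; rewrite b0.
  by rewrite oppr_ge0 ler10.
have := h (- b / c); rewrite (_ : _ + _ = (a * c - b ^+ 2) / c); last first.
  by field; rewrite gt_eqF.
by rewrite pmulr_lge0 ?invr_gt0// subr_ge0.
Qed.

(** * Square-integrable functions *)

Section square_integrable.
Context d (T : measurableType d) (R : realType) (P : probability T R).
Implicit Types f g h : T -> R.

Definition square_integrable f := measurable_fun [set: T] f /\
  (\int[P]_x ((f x) ^+ 2)%:E < +oo)%E.

Lemma square_integrable_sqr f : square_integrable f ->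
  P.-integrable [set: T] (fun x => ((f x) ^+ 2)%:E).
Proof.
move=> [mf f2]; apply/integrableP; split.
  by apply/measurable_EFinP; exact: measurable_funX.
by under eq_integral do rewrite gee0_abs ?lee_fin ?sqr_ge0//.
Qed.

Lemma square_integrableM f g : square_integrable f -> square_integrable g ->
  P.-integrable [set: T] (fun x => (f x * g x)%:E).
Proof.
move=> lf lg; have [mf _] := lf; have [mg _] := lg.
apply: (@le_integrable _ _ _ _ _ _ _ (fun x => ((f x) ^+ 2)%:E + ((g x) ^+ 2)%:E)%E) => //.
- by apply/measurable_EFinP; exact: measurable_funM.
- move=> x _; rewrite -EFinD lee_fin [leRHS]ger0_norm ?addr_ge0 ?sqr_ge0//.
  rewrite normrM -(real_normK (num_real (f x))) -(real_normK (num_real (g x))).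
  have := sqr_ge0 (`|f x| - `|g x|); have := normr_ge0 (f x); have := normr_ge0 (g x).
  by nra.
- by apply: integrableD => //; exact: square_integrable_sqr.
Qed.

Lemma square_integrable_cst k : square_integrable (fun=> k).
Proof.
split; first exact: measurable_cst.
by rewrite integral_cst// -[X in (_ * X)%E]/(P setT) probability_setT mule1 ltry.
Qed.

Lemma square_integrableD f g : square_integrable f -> square_integrable g ->
  square_integrable (fun x => f x + g x).
Proof.
move=> lf lg; have [mf _] := lf; have [mg _] := lg.
split; first exact: measurable_funD.
have i : P.-integrable [set: T]
    (fun x => ((f x) ^+ 2)%:E + ((g x) ^+ 2)%:E + (f x * g x)%:E + (f x * g x)%:E)%E.
  apply: integrableD => //; last exact: square_integrableM.
  apply: integrableD => //; last exact: square_integrableM.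
  by apply: integrableD => //; exact: square_integrable_sqr.
rewrite (eq_integral (fun x => ((f x) ^+ 2)%:E + ((g x) ^+ 2)%:E + (f x * g x)%:E + (f x * g x)%:E)%E).
  by rewrite (integrable_lty _ i).
by move=> x _; rewrite -!EFinD; congr EFin; ring.
Qed.

Lemma square_integrableZ k f : square_integrable f -> square_integrable (fun x => k * f x).
Proof.
move=> [mf f2]; split; first exact: measurable_funM.
under eq_integral do rewrite exprMn EFinM.
rewrite ge0_integralZl_EFin ?sqr_ge0//.
- by rewrite lte_mul_pinfty// lee_fin sqr_ge0.
- by move=> x _; rewrite lee_fin sqr_ge0.
- by apply/measurable_EFinP; exact: measurable_funX.
Qed.

Lemma square_integrableB f g : square_integrable f -> square_integrable g ->
  square_integrable (fun x => f x - g x).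
Proof.
move=> lf lg; under eq_fun do rewrite -mulN1r.
by apply: square_integrableD => //; exact: square_integrableZ.
Qed.

Lemma square_integrable_integrable f : square_integrable f ->
  P.-integrable [set: T] (EFin \o f).
Proof.
move=> lf; have := square_integrableM lf (square_integrable_cst 1).
by under eq_fun do rewrite mulr1.
Qed.

Lemma bounded_square_integrable (S : set T) f : measurable S -> P S = 1%E ->
  bounded_on S f -> square_integrable f.
Proof.
move=> mS PS bf; split; first by have [] := bf.
have := bounded_on_integrable mS PS (bounded_onM bf bf).
by move/integrable_lty; apply.
Qed.

End square_integrable.

(** * Moments of the Beta law *)

Section beta_moments.
Context (R : realType) (a k : R).
Hypotheses (a0 : 0 < a) (k0 : 0 < k).
Local Notation mu := (@lebesgue_measure R).
Local Notation TR := (measurableTypeR R).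

Definition unit_itv : set TR := `[0, 1]%classic.

Lemma measurable_unit_itv : measurable unit_itv.
Proof. exact: measurable_itv. Qed.

Lemma beta_law_unit_itv : beta_law a k unit_itv = 1%E.
Proof.
have mC : measurable (~` unit_itv) by apply: measurableC; exact: measurable_unit_itv.
have C0 : beta_law a k (~` unit_itv) = 0%E.
  transitivity (\int[beta_law a k]_x (\1_(~` unit_itv) x)%:E)%E.
    by rewrite integral_indic// setIT.
  have mI : measurable_fun [set: TR] (fun x => (\1_(~` unit_itv) x)%:E : \bar R).
    by apply/measurable_EFinP; exact: measurable_indic.
  have I0 (x : TR) : (0 <= (\1_(~` unit_itv) x)%:E :> \bar R)%E by rewrite lee_fin.
  rewrite (ge0_integral_beta a0 k0 mI I0).
  rewrite integral0_eq ?mule0// => x _.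
  have [x0|x0] := leP x 0; first by rewrite (pospow_le0 a x0) mul0r mul0e.
  have [x1|x1] := leP 1 x; first by rewrite (@pospow_le0 _ k) ?subr_le0// mulr0 mul0e.
  rewrite indicE memNset ?mule0//; apply.
  by rewrite /unit_itv/= in_itv/= !ltW.
rewrite -(setCK unit_itv) -[LHS]/(beta_law a k (~` ~` unit_itv)).
have -> := probability_setC (beta_law a k) mC.
by rewrite C0 sube0.
Qed.

Lemma unit_itv_bounded_X n : bounded_on unit_itv (fun u : TR => (1 - u) ^+ n).
Proof.
split; first by apply: measurable_funX; exact: measurable_funB.
exists 1 => u; rewrite /unit_itv/= in_itv/= => /andP[u0 u1].
by rewrite ger0_norm ?exprn_ge0 ?exprn_ile1 ?subr_ge0// lerBlDr lerDl.
Qed.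

Lemma expectation_betaX n :
  \int[beta_law a k]_u ((1 - u) ^+ n) = beta_int a (k + n%:R) / beta_int a k.
Proof.
have kn0 : 0 < k + n%:R by rewrite ltr_pwDl.
have mX : measurable_fun [set: TR] (fun u : TR => `|1 - u| ^+ n).
  apply: measurable_funX; apply: measurableT_comp => //; exact: measurable_funB.
(* The absolute value makes the integrand non-negative on the whole line, as [ge0_integral_beta]
   requires, and changes nothing on [0, 1]. *)
transitivity (\int[beta_law a k]_u (`|1 - u| ^+ n)).
  apply: (expectation_eq measurable_unit_itv beta_law_unit_itv).
  - exact: unit_itv_bounded_X.
  - split=> //; exists 1 => u; rewrite /unit_itv/= in_itv/= => /andP[u0 u1].
    by rewrite normrX normr_id ger0_norm ?exprn_ile1 ?subr_ge0// lerBlDr lerDl.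
  - move=> u; rewrite /unit_itv/= in_itv/= => /andP[u0 u1].
    by rewrite ger0_norm ?subr_ge0.
have mE : measurable_fun [set: TR] (fun u : TR => (`|1 - u| ^+ n)%:E) by exact/measurable_EFinP.
have E0 (u : TR) : (0 <= (`|1 - u| ^+ n)%:E)%E by rewrite lee_fin exprn_ge0.
rewrite /Rintegral (ge0_integral_beta a0 k0 mE E0).
rewrite (_ : (\int[mu]_x _)%E = (beta_int a (k + n%:R))%:E).
  by rewrite -EFinM/= mulrC.
rewrite -integral_beta_int//; apply: eq_integral => u _; rewrite -EFinM; congr EFin.
rewrite -mulrA; congr (_ * _).
have [u1|u1] := leP (1 - u) 0; first by rewrite !(pospow_le0 _ u1) mul0r.
rewrite (ger0_norm (ltW u1)); elim: n {kn0 mX mE E0} => [|n IH].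
  by rewrite addr0 expr0 mulr1.
by rewrite -natr1 addrA pospowSl -IH exprS; ring.
Qed.

Lemma expectation_beta1 : \int[beta_law a k]_u (1 - u) = k / (a + k).
Proof.
have := expectation_betaX 1; under eq_Rintegral do rewrite expr1.
move=> ->; rewrite beta_intS// mulrK// unitfE gt_eqF// beta_int_gt0//.
Qed.

Lemma expectation_beta2 :
  \int[beta_law a k]_u ((1 - u) ^+ 2) = k * (k + 1) / ((a + k) * (a + k + 1)).
Proof.
rewrite (expectation_betaX 2) -[2%:R]/(1 + 1) addrA !beta_intS// ?addr_gt0//.
have ? : beta_int a k != 0 by rewrite gt_eqF// beta_int_gt0.
have ? : a + k != 0 by rewrite gt_eqF// addr_gt0.
have ? : a + k + 1 != 0 by rewrite gt_eqF// !addr_gt0.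
by rewrite addrA; field; apply/and3P.
Qed.

End beta_moments.

Section product_expectation.
Context d1 d2 (T1 : measurableType d1) (T2 : measurableType d2) (R : realType).
Variables (P1 : probability T1 R) (P2 : probability T2 R).
Variables (S1 : set T1) (S2 : set T2).
Hypotheses (mS1 : measurable S1) (mS2 : measurable S2).
Hypotheses (P1S : P1 S1 = 1%E) (P2S : P2 S2 = 1%E).

Definition product_law : probability (T1 * T2)%type R := (P1 \x P2)%E.

Lemma product_law_full : product_law (S1 `*` S2) = 1%E.
Proof.
rewrite -[LHS]/((P1 \x P2)%E (S1 `*` S2)) product_measure1E//.
by rewrite [X in (X * _)%E]P1S mul1e -[LHS]/(P2 S2).
Qed.

Lemma ge0_integral_product_law (f : T1 * T2 -> \bar R) :
  measurable_fun [set: T1 * T2] f -> (forall x, 0 <= f x)%E ->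
  (\int[product_law]_p f p = \int[P1]_x \int[P2]_y f (x, y))%E.
Proof. exact: fubini_tonelli1. Qed.

Lemma integral_product_law (f : T1 * T2 -> \bar R) :
  product_law.-integrable [set: T1 * T2] f ->
  (\int[product_law]_p f p = \int[P1]_x \int[P2]_y f (x, y))%E.
Proof. by move=> fi; rewrite -(integral12_prod_meas1 (m1 := P1) (m2 := P2) fi). Qed.

Lemma bounded_on_fst f : bounded_on S1 f -> bounded_on (S1 `*` S2) (fun p => f p.1 : R).
Proof.
move=> [mf [K Kf]]; split; last by exists K => -[x y] /= [Sx _]; exact: Kf.
exact: measurableT_comp mf measurable_fst.
Qed.

Lemma bounded_on_snd f : bounded_on S2 f -> bounded_on (S1 `*` S2) (fun p => f p.2 : R).
Proof.
move=> [mf [K Kf]]; split; last by exists K => -[x y] /= [_ Sy]; exact: Kf.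
exact: measurableT_comp mf measurable_snd.
Qed.

Lemma expectation_product_fun f g : bounded_on S1 f -> bounded_on S2 g ->
  \int[product_law]_p (f p.1 * g p.2) = (\int[P1]_x f x) * (\int[P2]_y g y).
Proof.
move=> bf bg.
have bfg : bounded_on (S1 `*` S2) (fun p => f p.1 * g p.2).
  by apply: bounded_onM; [exact: bounded_on_fst|exact: bounded_on_snd].
have ifg := bounded_on_integrable (measurableX mS1 mS2) product_law_full bfg.
rewrite [LHS]/Rintegral (integral_product_law ifg).
rewrite -(@RintegralZr _ _ _ P1 setT f (\int[P2]_y g y))//; last first.
  exact: (bounded_on_integrable mS1 P1S bf).
congr fine; apply: eq_integral => x _.
have ig := bounded_on_integrable mS2 P2S bg.
rewrite /= -(@RintegralZl _ _ _ P2 setT g (f x))// fineK//.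
by apply: integrable_fin_num => //; apply: (bounded_on_integrable mS2 P2S (bounded_onZ _ bg)).
Qed.

End product_expectation.

(** * One exchange along a fixed edge *)

Section exchange_pair.
Context (R : realType) (V : finType).
Hypothesis V2 : (1 < #|V|)%N.
Variables (alpha : V -> R) (kappa : R).
Hypotheses (kappa_gt0 : 0 < kappa) (kappa_lt : forall x, kappa < alpha x).
Variables (x y : V).
Hypothesis xy : x != y.
Local Notation TR := (measurableTypeR R).
Local Notation D := (dirichlet alpha).
Local Notation Q := (exchange_law alpha kappa x y).
Local Notation simplex := (@simplex R V).

Let a0 z : 0 < alpha z - kappa. Proof. by rewrite subr_gt0. Qed.
Let alpha_gt0 z : 0 < alpha z. Proof. exact: lt_trans kappa_gt0 (kappa_lt z). Qed.

Definition unit_square : set (TR * TR) := @unit_itv R `*` @unit_itv R.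

Lemma measurable_unit_square : measurable unit_square.
Proof. by apply: measurableX; exact: measurable_unit_itv. Qed.

Lemma exchange_law_full : Q unit_square = 1%E.
Proof.
by apply: product_law_full;
  [exact: measurable_unit_itv|exact: measurable_unit_itv|exact: beta_law_unit_itv..].
Qed.

Let mQ := measurable_unit_square.
Let Q1 := exchange_law_full.
Let mI := @measurable_unit_itv R.
Let bx1 := beta_law_unit_itv (a0 x) kappa_gt0.
Let by1 := beta_law_unit_itv (a0 y) kappa_gt0.

Lemma bounded_onem_fst : bounded_on unit_square (fun p : TR * TR => 1 - p.1 : R).
Proof.
apply: (bounded_on_fst (@unit_itv R) (S1 := @unit_itv R) (f := fun u => 1 - u)).
by have := unit_itv_bounded_X R 1; under eq_fun do rewrite expr1.
Qed.

Lemma bounded_onem_snd : bounded_on unit_square (fun p : TR * TR => 1 - p.2 : R).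
Proof.
apply: (bounded_on_snd (@unit_itv R) (S2 := @unit_itv R) (f := fun u => 1 - u)).
by have := unit_itv_bounded_X R 1; under eq_fun do rewrite expr1.
Qed.

Lemma exchange_moment m n :
  \int[Q]_p ((1 - p.1) ^+ m * (1 - p.2) ^+ n) =
  (\int[beta_law (alpha x - kappa) kappa]_u (1 - u) ^+ m) *
  (\int[beta_law (alpha y - kappa) kappa]_u (1 - u) ^+ n).
Proof.
exact: (expectation_product_fun mI mI bx1 by1 (unit_itv_bounded_X R m) (unit_itv_bounded_X R n)).
Qed.

Lemma beta_exp0 z : \int[beta_law (alpha z - kappa) kappa]_u ((1 - u) ^+ 0) = 1.
Proof. by under eq_Rintegral do rewrite expr0; exact: expectation_cst. Qed.

Lemma beta_exp1 z : \int[beta_law (alpha z - kappa) kappa]_u ((1 - u) ^+ 1) = kappa / alpha z.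
Proof.
under eq_Rintegral do rewrite expr1.
by rewrite expectation_beta1// subrK.
Qed.

Lemma beta_exp2 z : \int[beta_law (alpha z - kappa) kappa]_u ((1 - u) ^+ 2) =
  kappa * (kappa + 1) / (alpha z * (alpha z + 1)).
Proof. by rewrite expectation_beta2// subrK. Qed.

Let bA := bounded_onem_fst.
Let bB := bounded_onem_snd.

Lemma bounded_exchange_linear c0 c1 c2 :
  bounded_on unit_square (fun p : TR * TR => c0 + (1 - p.1) * c1 + (1 - p.2) * c2 : R).
Proof.
apply: bounded_onD; last by apply: bounded_onM => //; exact: bounded_on_cst.
apply: bounded_onD; first exact: bounded_on_cst.
by apply: bounded_onM => //; exact: bounded_on_cst.
Qed.

Lemma exchange_linear c0 c1 c2 :
  \int[Q]_p (c0 + (1 - p.1) * c1 + (1 - p.2) * c2) =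
  c0 + kappa / alpha x * c1 + kappa / alpha y * c2.
Proof.
have E1 : \int[Q]_p (1 - p.1) = kappa / alpha x.
  transitivity (\int[Q]_p ((1 - p.1) ^+ 1 * (1 - p.2) ^+ 0)).
    by apply: eq_Rintegral => p _; rewrite expr1 expr0 mulr1.
  exact: (etrans (exchange_moment 1 0) (etrans (f_equal2 *%R (beta_exp1 x) (beta_exp0 y)) (mulr1 _))).
have E2 : \int[Q]_p (1 - p.2) = kappa / alpha y.
  transitivity (\int[Q]_p ((1 - p.1) ^+ 0 * (1 - p.2) ^+ 1)).
    by apply: eq_Rintegral => p _; rewrite expr1 expr0 mul1r.
  exact: (etrans (exchange_moment 0 1) (etrans (f_equal2 *%R (beta_exp0 x) (beta_exp1 y)) (mul1r _))).
under eq_Rintegral do rewrite (mulrC (1 - _.1)) (mulrC (1 - _.2)).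
rewrite (expectationD mQ Q1 (f := fun p => c0 + c1 * (1 - p.1))); last 2 first.
- by apply: bounded_onD; [exact: bounded_on_cst|exact: bounded_onZ].
- exact: bounded_onZ.
rewrite (expectationD mQ Q1 (f := fun=> c0)); last 2 first.
- exact: bounded_on_cst.
- exact: bounded_onZ.
rewrite expectation_cst (expectationZ mQ Q1)// (expectationZ mQ Q1)// E1 E2; ring.
Qed.

(** The square of the mean plus the variances of 1 - U and 1 - W; independence removes the
    covariance. *)
Lemma exchange_quadratic c0 c1 c2 :
  \int[Q]_p ((c0 + (1 - p.1) * c1 + (1 - p.2) * c2) ^+ 2) =
  (c0 + kappa / alpha x * c1 + kappa / alpha y * c2) ^+ 2 +
  (kappa * (kappa + 1) / (alpha x * (alpha x + 1)) - (kappa / alpha x) ^+ 2) * c1 ^+ 2 +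
  (kappa * (kappa + 1) / (alpha y * (alpha y + 1)) - (kappa / alpha y) ^+ 2) * c2 ^+ 2.
Proof.
have E1 : \int[Q]_p ((1 - p.1) * (1 - p.1)) = kappa * (kappa + 1) / (alpha x * (alpha x + 1)).
  transitivity (\int[Q]_p ((1 - p.1) ^+ 2 * (1 - p.2) ^+ 0)).
    by apply: eq_Rintegral => p _; rewrite expr2 expr0 mulr1.
  exact: (etrans (exchange_moment 2 0) (etrans (f_equal2 *%R (beta_exp2 x) (beta_exp0 y)) (mulr1 _))).
have E2 : \int[Q]_p ((1 - p.2) * (1 - p.2)) = kappa * (kappa + 1) / (alpha y * (alpha y + 1)).
  transitivity (\int[Q]_p ((1 - p.1) ^+ 0 * (1 - p.2) ^+ 2)).
    by apply: eq_Rintegral => p _; rewrite expr2 expr0 mul1r.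
  exact: (etrans (exchange_moment 0 2) (etrans (f_equal2 *%R (beta_exp0 x) (beta_exp2 y)) (mul1r _))).
have E12 : \int[Q]_p ((1 - p.1) * (1 - p.2)) = (kappa / alpha x) * (kappa / alpha y).
  transitivity (\int[Q]_p ((1 - p.1) ^+ 1 * (1 - p.2) ^+ 1)).
    by apply: eq_Rintegral => p _; rewrite !expr1.
  exact: (etrans (exchange_moment 1 1) (f_equal2 *%R (beta_exp1 x) (beta_exp1 y))).
have bAA := bounded_onM bA bA; have bBB := bounded_onM bB bB.
have bAB := bounded_onM bA bB.
transitivity (\int[Q]_p ((c0 ^+ 2 + (1 - p.1) * (2 * c0 * c1) + (1 - p.2) * (2 * c0 * c2)) +
  (c1 ^+ 2 * ((1 - p.1) * (1 - p.1)) + (c2 ^+ 2 * ((1 - p.2) * (1 - p.2)) +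
   2 * c1 * c2 * ((1 - p.1) * (1 - p.2)))))).
  by apply: eq_Rintegral => p _; ring.
rewrite (expectationD mQ Q1); last 2 first.
- exact: bounded_exchange_linear.
- by apply: bounded_onD; [exact: bounded_onZ|apply: bounded_onD; exact: bounded_onZ].
rewrite exchange_linear (expectationD mQ Q1); last 2 first.
- exact: bounded_onZ.
- by apply: bounded_onD; exact: bounded_onZ.
rewrite (expectationD mQ Q1); [|exact: bounded_onZ|exact: bounded_onZ].
by rewrite !(expectationZ mQ Q1)// E1 E2 E12; ring.
Qed.

Definition exchange_joint : probability (config V R * (TR * TR))%type R := product_law D Q.
Local Notation J := exchange_joint.

Definition exchanged (q : config V R * (TR * TR)) : config V R :=
  exchange q.1 x y q.2.1 q.2.2.

Lemma measurable_exchanged : measurable_fun [set: config V R * (TR * TR)] exchanged.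
Proof. exact: measurable_exchange. Qed.

Lemma exchanged_simplex q : (simplex `*` unit_square) q -> simplex (exchanged q).
Proof.
case: q => eta [u w] /= [es []]; rewrite /unit_itv/= !in_itv/= => u01 w01.
exact: exchange_simplex.
Qed.

Lemma dirichlet_full : D simplex = 1%E.
Proof. by apply: dirichlet_simplex; exact: ltnW V2. Qed.

Lemma exchange_joint_full : J (simplex `*` unit_square) = 1%E.
Proof.
apply: product_law_full => //; first exact: measurable_simplex.
exact: dirichlet_full.
Qed.

Lemma exchange_joint_sym_ge0 (G : config V R -> config V R -> \bar R) :
  measurable_fun [set: config V R * config V R] (fun q => G q.1 q.2) ->
  (forall e e', 0 <= G e e')%E ->
  (\int[J]_q G q.1 (exchanged q) = \int[J]_q G (exchanged q) q.1)%E.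
Proof.
move=> mG G0.
have h1 := exchange_reversible V2 kappa_gt0 kappa_lt xy mG G0.
have m1 := measurable_uncurry_comp mG (@measurable_fst _ _ _ _) measurable_exchanged.
have m2 := measurable_uncurry_comp mG measurable_exchanged (@measurable_fst _ _ _ _).
have e1 := @ge0_integral_product_law _ _ _ _ R D Q _ m1 (fun q => G0 _ _).
have e2 := @ge0_integral_product_law _ _ _ _ R D Q _ m2 (fun q => G0 _ _).
exact: (etrans e1 (etrans h1 (esym e2))).
Qed.

(** Positive and negative parts are swapped separately, each by the non-negative case. *)
Lemma exchange_joint_sym (h : config V R -> config V R -> R) :
  measurable_fun [set: config V R * config V R] (fun q => h q.1 q.2) ->
  \int[J]_q h q.1 (exchanged q) = \int[J]_q h (exchanged q) q.1.
Proof.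
move=> mh; congr fine; rewrite integralE [RHS]integralE; congr (_ - _)%E.
  transitivity (\int[J]_q maxe (h q.1 (exchanged q))%:E 0)%E.
    by apply: eq_integral => q _; rewrite funeposE.
  transitivity (\int[J]_q maxe (h (exchanged q) q.1)%:E 0)%E; last first.
    by apply: eq_integral => q _; rewrite funeposE.
  apply: (exchange_joint_sym_ge0 (G := fun e e' => maxe (h e e')%:E 0%E)).
    by apply: measurable_maxe => //; exact/measurable_EFinP.
  by move=> e e'; rewrite le_max lexx orbT.
transitivity (\int[J]_q maxe (- (h q.1 (exchanged q))%:E) 0)%E.
  by apply: eq_integral => q _; rewrite funenegE.
transitivity (\int[J]_q maxe (- (h (exchanged q) q.1)%:E) 0)%E; last first.
  by apply: eq_integral => q _; rewrite funenegE.
apply: (exchange_joint_sym_ge0 (G := fun e e' => maxe (- (h e e')%:E)%E 0%E)).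
  by apply: measurable_maxe => //; apply: measurableT_comp => //; exact/measurable_EFinP.
by move=> e e'; rewrite le_max lexx orbT.
Qed.

Lemma ge0_integral_joint_fst (F : config V R -> \bar R) :
  measurable_fun [set: config V R] F -> (forall e, 0 <= F e)%E ->
  (\int[J]_q F q.1 = \int[D]_e F e)%E.
Proof.
move=> mF F0.
have e1 := @ge0_integral_product_law _ _ _ _ R D Q (fun q => F q.1)
  (measurableT_comp mF measurable_fst) (fun q => F0 _).
apply: (etrans e1); apply: eq_integral => e _.
by rewrite /= integral_cst// -[X in (_ * X)%E]/(Q setT) probability_setT mule1.
Qed.

(** Stationarity of the Dirichlet law: reversibility for a function of one configuration only. *)
Lemma ge0_integral_joint_exchanged (F : config V R -> \bar R) :
  measurable_fun [set: config V R] F -> (forall e, 0 <= F e)%E ->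
  (\int[J]_q F (exchanged q) = \int[D]_e F e)%E.
Proof.
move=> mF F0; rewrite -ge0_integral_joint_fst//.
apply/esym/(exchange_joint_sym_ge0 (G := fun e _ => F e)) => //.
exact: measurableT_comp mF measurable_fst.
Qed.

End exchange_pair.

(** * The Dirichlet form *)

Lemma measurable_Rintegral_section d1 d2 (T1 : measurableType d1) (T2 : measurableType d2)
    (R : realType) (P : probability T2 R) (g : T1 * T2 -> R) :
  measurable_fun [set: T1 * T2] g ->
  measurable_fun [set: T1] (fun x => \int[P]_y g (x, y)).
Proof.
move=> mg; have mEg : measurable_fun [set: T1 * T2] (EFin \o g) by exact/measurable_EFinP.
apply: (measurableT_comp (f := fine)) => //.
rewrite (_ : (fun x => _) = fun x => (\int[P]_y (EFin \o g)^\+ (x, y) -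
   \int[P]_y (EFin \o g)^\- (x, y))%E); last first.
  apply/funext => x; rewrite integralE; congr (_ - _)%E; apply: eq_integral => y _.
    by rewrite !funeposE.
  by rewrite !funenegE.
apply: emeasurable_funB.
  apply: (@measurable_fun_fubini_tonelli_F _ _ _ _ R P) => //.
  exact: measurable_funepos.
apply: (@measurable_fun_fubini_tonelli_F _ _ _ _ R P) => //.
exact: measurable_funeneg.
Qed.

Section energy.
Context (R : realType) (V : finType).
Hypothesis V2 : (1 < #|V|)%N.
Variables (alpha : V -> R) (kappa : R).
Hypotheses (kappa_gt0 : 0 < kappa) (kappa_lt : forall x, kappa < alpha x).
Local Notation TR := (measurableTypeR R).
Local Notation D := (dirichlet alpha).
Local Notation Q := (exchange_law alpha kappa).
Local Notation J := (exchange_joint alpha kappa).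
Implicit Types (f g : config V R -> R) (x y : V).

(** Twice the contribution of the edge to the Dirichlet form at rate 1; the symmetric form makes its
    sign evident. *)
Definition energy x y f : R := \int[J x y]_q ((f q.1 - f (exchanged x y q)) ^+ 2).

Lemma square_integrable_fst x y f : square_integrable D f ->
  square_integrable (J x y) (fun q => f q.1).
Proof.
move=> [mf f2]; split; first exact: measurableT_comp mf measurable_fst.
rewrite (ge0_integral_joint_fst alpha kappa x y (F := fun e => (f e ^+ 2)%:E))//.
  by apply/measurable_EFinP; exact: measurable_funX.
by move=> e; rewrite lee_fin sqr_ge0.
Qed.

Lemma integral_exchanged_sqr x y f : x != y -> measurable_fun [set: config V R] f ->
  (\int[J x y]_q (f (exchanged x y q) ^+ 2)%:E = \int[D]_e (f e ^+ 2)%:E)%E.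
Proof.
move=> xy mf.
apply: (ge0_integral_joint_exchanged V2 kappa_gt0 kappa_lt xy (F := fun e => (f e ^+ 2)%:E)).
  by apply/measurable_EFinP; exact: measurable_funX.
by move=> e; rewrite lee_fin sqr_ge0.
Qed.

Lemma square_integrable_exchanged x y f : x != y -> square_integrable D f ->
  square_integrable (J x y) (fun q => f (exchanged x y q)).
Proof.
move=> xy [mf f2]; split; last by rewrite integral_exchanged_sqr.
by apply: measurableT_comp mf _; exact: measurable_exchanged.
Qed.

Lemma energy_ge0 x y f : 0 <= energy x y f.
Proof. by apply: Rintegral_ge0 => q _; exact: sqr_ge0. Qed.

Lemma energyE x y f : x != y -> square_integrable D f ->
  energy x y f = 2 * \int[J x y]_q (f q.1 * (f q.1 - f (exchanged x y q))).
Proof.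
move=> xy lf; have l1 := square_integrable_fst x y lf.
have l2 := square_integrable_exchanged xy lf.
have l12 := square_integrableB l1 l2; have l21 := square_integrableB l2 l1.
have [mf _] := lf.
have sym : \int[J x y]_q (f q.1 * (f q.1 - f (exchanged x y q))) =
    \int[J x y]_q (f (exchanged x y q) * (f (exchanged x y q) - f q.1)).
  apply: (exchange_joint_sym V2 kappa_gt0 kappa_lt xy (h := fun e e' => f e * (f e - f e'))).
  have m1 : measurable_fun [set: config V R * config V R] (fun q => f q.1).
    exact: measurableT_comp mf measurable_fst.
  apply: measurable_funM => //; apply: measurable_funB => //.
  exact: measurableT_comp mf measurable_snd.
rewrite mulr2n mulrDl !mul1r {2}sym -RintegralD//.
- by apply: eq_Rintegral => q _; ring.
- exact: square_integrableM l1 l12.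
- exact: square_integrableM l2 l21.
Qed.

(** For f merely in L2 the inner integral of the generator is controlled only for almost every e.
    Fubini applied to the product with f e identifies it off a null set. *)
Lemma integral_generator_term x y f : x != y -> square_integrable D f ->
  let t := fun e => f e * - \int[Q x y]_p (f (exchange e x y p.1 p.2) - f e) in
  D.-integrable [set: config V R] (EFin \o t) /\
  (\int[D]_e (t e)%:E = (energy x y f / 2)%:E)%E.
Proof.
move=> xy lf t; have l1 := square_integrable_fst x y lf.
have l2 := square_integrable_exchanged xy lf.
have l12 := square_integrableB l1 l2.
have [mf _] := lf.
pose h q := f q.1 * (f q.1 - f (exchanged x y q)).
have ih : (J x y).-integrable setT (EFin \o h) by exact: square_integrableM l1 l12.
pose F e : \bar R := (\int[Q x y]_p (EFin \o h) (e, p))%E.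
have iF : D.-integrable setT F by exact: (@integrable_fubini_F _ _ _ _ R D (Q x y) _ ih).
have mdiff : measurable_fun [set: config V R * (TR * TR)]
    (fun q => f (exchanged x y q) - f q.1).
  apply: measurable_funB; last exact: measurableT_comp mf measurable_fst.
  by apply: measurableT_comp mf _; exact: measurable_exchanged.
have mt : measurable_fun [set: config V R] t.
  apply: measurable_funM => //; apply: measurableT_comp => //.
  exact: (measurable_Rintegral_section (Q x y) mdiff).
have mEt : measurable_fun [set: config V R] (EFin \o t) by exact/measurable_EFinP.
have tF : ae_eq D setT (EFin \o t) F.
  have := @ae_integrable1 _ _ _ _ R D (Q x y) _ ih.
  apply: filterS => e ie _; have Ffin : F e \is a fin_num by exact: integrable_fin_num.
  rewrite -(fineK Ffin) /=; congr EFin; rewrite /t -[RHS]/(\int[Q x y]_p h (e, p)).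
  (* Where f e = 0, integrability of the product says nothing about the increment, but both sides
     vanish; elsewhere the factor f e can be divided out. *)
  have [fe0|fe0] := eqVneq (f e) 0.
    rewrite fe0 mul0r -[LHS](expectation_cst (Q x y) 0).
    by apply: eq_Rintegral => p _; rewrite /h /= fe0 mul0r.
  have idiff : (Q x y).-integrable setT
      (fun p => (f (exchange e x y p.1 p.2) - f e)%:E).
    have := integrableZl measurableT (- (f e)^-1) ie.
    apply: eq_integrable => // p _.
    rewrite /h/= -EFinM; congr EFin; rewrite /exchanged/=; field.
    exact: fe0.
  rewrite mulrN -mulNr -RintegralZl//.
  by apply: eq_Rintegral => p _; rewrite /h/= /exchanged/=; ring.
have it : D.-integrable [set: config V R] (EFin \o t).
  have [mF Foo] := integrableP _ _ _ iF; apply/integrableP; split=> //.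
  rewrite (@ae_eq_integral _ _ _ D setT (fun e => `|F e|%E))//.
  - exact: measurableT_comp.
  - exact: measurableT_comp.
  - by apply: filterS tF => e /(_ I) te _; rewrite -te.
split=> //; rewrite (@ae_eq_integral _ _ _ D setT F)//; last by have [] := integrableP _ _ _ iF.
have -> : (\int[D]_e F e = \int[J x y]_q (h q)%:E)%E.
  exact: esym (integral_product_law ih).
rewrite energyE// mulrC mulKf ?pnatr_eq0// /Rintegral fineK//.
exact: integrable_fin_num.
Qed.

Variable c : V -> V -> R.

Definition form f : R :=
  \sum_(x : V) \sum_(y : V | (enum_rank x < enum_rank y)%N) c x y * (energy x y f / 2).

Lemma rank_lt_neq x y : (enum_rank x < enum_rank y)%N -> x != y.
Proof. by apply: contraTneq => ->; rewrite ltnn. Qed.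

Lemma dirichlet_formE f : square_integrable D f ->
  dirichlet_form c alpha kappa f = (form f)%:E.
Proof.
move=> lf.
pose t x y e := f e * - \int[Q x y]_p (f (exchange e x y p.1 p.2) - f e).
have it x y : x != y -> D.-integrable setT (EFin \o t x y).
  by move=> xy; have [] := integral_generator_term xy lf.
transitivity (\int[D]_e (\sum_x \sum_(y | (enum_rank x < enum_rank y)%N)
    ((c x y)%:E * (t x y e)%:E)))%E.
  apply: eq_integral => e _; rewrite /IEM_generator -sumrN mulr_sumr -sumEFin.
  apply: eq_bigr => x _; rewrite -sumrN mulr_sumr -sumEFin; apply: eq_bigr => y _.
  by rewrite -EFinM; congr EFin; rewrite /t -[\int[_]_p _]/(\int[Q x y]_p _); ring.
have icx x y : (enum_rank x < enum_rank y)%N ->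
    D.-integrable setT (fun e => (c x y)%:E * (t x y e)%:E)%E.
  by move=> /rank_lt_neq xy; exact: integrableZl (it _ _ xy).
rewrite integral_sum//; last first.
  move=> x; under eq_fun do rewrite big_mkcond; apply: integrable_sum => // y _.
  by case: (boolP (_ < _)%N) => [/icx//|_]; exact: integrable0.
rewrite /form -sumEFin; apply: eq_bigr => x _.
under eq_integral do rewrite big_mkcond.
rewrite integral_sum//; last first.
  by move=> y; case: (boolP (_ < _)%N) => [/icx//|_]; exact: integrable0.
rewrite -sumEFin [RHS]big_mkcond; apply: eq_bigr => y _.
case: (boolP (_ < _)%N) => [xy|_]; last by rewrite integral0.
rewrite integralZl//; last exact: it (rank_lt_neq xy).
by have [_ ->] := integral_generator_term (rank_lt_neq xy) lf.
Qed.

End energy.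

Section iterated_expectation.
Context d1 d2 (T1 : measurableType d1) (T2 : measurableType d2) (R : realType).
Variables (P1 : probability T1 R) (P2 : probability T2 R).
Variables (S1 : set T1) (S2 : set T2).
Hypotheses (mS1 : measurable S1) (mS2 : measurable S2).
Hypotheses (P1S : P1 S1 = 1%E) (P2S : P2 S2 = 1%E).

Lemma bounded_on_section (h : T1 * T2 -> R) x : S1 x ->
  bounded_on (S1 `*` S2) h -> bounded_on S2 (fun y => h (x, y)).
Proof.
move=> Sx [mh [K Kh]]; split; first exact: measurableT_comp mh (pair1_measurable x).
by exists K => y Sy; exact: Kh.
Qed.

Lemma bounded_on_Rintegral (h : T1 * T2 -> R) :
  bounded_on (S1 `*` S2) h -> bounded_on S1 (fun x => \int[P2]_y h (x, y)).
Proof.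
move=> bh; have [mh [K Kh]] := bh; split; first exact: measurable_Rintegral_section.
exists K => x Sx; have bx := bounded_on_section Sx bh.
apply: le_trans (expectation_norm mS2 P2S bx) _.
rewrite -[leRHS](expectation_cst P2 K).
apply: (expectation_le mS2 P2S); first exact: bounded_on_norm.
  exact: bounded_on_cst.
by move=> y Sy; exact: Kh.
Qed.

Lemma expectation_product (h : T1 * T2 -> R) : bounded_on (S1 `*` S2) h ->
  \int[product_law P1 P2]_q h q = \int[P1]_x \int[P2]_y h (x, y).
Proof.
move=> bh; have ih := bounded_on_integrable (measurableX mS1 mS2)
  (product_law_full mS1 mS2 P1S P2S) bh.
rewrite [LHS]/Rintegral (integral_product_law ih); congr fine.
have mF : measurable_fun [set: T1] (fun x => (\int[P2]_y (h (x, y))%:E)%E).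
  have := @measurable_fubini_F _ _ _ _ R P1 P2 _ ih; exact.
have mG : measurable_fun [set: T1] (fun x => (\int[P2]_y h (x, y))%:E).
  by apply/measurable_EFinP; apply: measurable_Rintegral_section; have [] := bh.
apply: ae_eq_integral => //.
apply: (full_ae mS1 P1S) => x Sx _; rewrite fineK//.
apply: integrable_fin_num => //.
exact: (bounded_on_integrable mS2 P2S (bounded_on_section Sx bh)).
Qed.

End iterated_expectation.

(** * The generator on bounded functions *)

Section generator.
Context (R : realType) (V : finType).
Hypothesis V2 : (1 < #|V|)%N.
Variables (c : V -> V -> R) (alpha : V -> R) (kappa : R).
Hypothesis c_ge0 : forall x y, 0 <= c x y.
Hypotheses (kappa_gt0 : 0 < kappa) (kappa_lt : forall x, kappa < alpha x).
Local Notation D := (dirichlet alpha).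
Local Notation Q := (exchange_law alpha kappa).
Local Notation J := (exchange_joint alpha kappa).
Local Notation simplex := (@simplex R V).
Local Notation L := (IEM_generator c alpha kappa).
Local Notation lt_rank x y := (enum_rank x < enum_rank y)%N.
Implicit Types (f g : config V R -> R) (x y : V).

Let mS : measurable simplex := @measurable_simplex R V.
Let D1 : D simplex = 1%E := dirichlet_full V2 alpha.
Let mQ := @measurable_unit_square R.
Let Q1 x y := exchange_law_full kappa_gt0 kappa_lt x y.
Let mSQ := measurableX mS mQ.
Let J1 x y := exchange_joint_full V2 kappa_gt0 kappa_lt x y.

Lemma bounded_joint_fst f : bounded_on simplex f ->
  bounded_on (simplex `*` @unit_square R) (fun q => f q.1).
Proof. exact: bounded_on_fst. Qed.

Lemma bounded_joint_exchanged x y f : x != y -> bounded_on simplex f ->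
  bounded_on (simplex `*` @unit_square R) (fun q => f (exchanged x y q)).
Proof.
move=> xy [mf [K Kf]]; split.
  by apply: measurableT_comp mf _; exact: measurable_exchanged.
by exists K => q Sq; apply: Kf; exact: exchanged_simplex.
Qed.

Lemma bounded_on_generator f : bounded_on simplex f -> bounded_on simplex (L f).
Proof.
move=> bf; apply: bounded_on_sum => x.
under eq_fun do rewrite big_mkcond; apply: bounded_on_sum => y.
case: (boolP (lt_rank x y)) => [/rank_lt_neq xy|_]; last exact: bounded_on_cst.
apply: bounded_onZ.
apply: (bounded_on_Rintegral (P2 := Q x y) mQ (Q1 x y)
  (h := fun q => f (exchanged x y q) - f q.1)).
by apply: bounded_onB; [exact: bounded_joint_exchanged|exact: bounded_joint_fst].
Qed.

Lemma generator_dot f g : bounded_on simplex f -> bounded_on simplex g ->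
  \int[D]_e (g e * L f e) = \sum_x \sum_(y | lt_rank x y)
    c x y * \int[J x y]_q (g q.1 * (f (exchanged x y q) - f q.1)).
Proof.
move=> bf bg.
have bd x y : x != y -> bounded_on (simplex `*` @unit_square R)
    (fun q => f (exchanged x y q) - f q.1).
  by move=> xy; apply: bounded_onB; [exact: bounded_joint_exchanged|exact: bounded_joint_fst].
pose t x y e := \int[Q x y]_p (f (exchanged x y (e, p)) - f e).
have bt x y : x != y -> bounded_on simplex (t x y).
  by move=> xy; exact: (bounded_on_Rintegral mQ (Q1 x y) (bd x y xy)).
transitivity (\int[D]_e (\sum_x \sum_y (if lt_rank x y then c x y * (g e * t x y e) else 0))).
  apply: eq_Rintegral => e _; rewrite /IEM_generator mulr_sumr; apply: eq_bigr => x _.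
  rewrite -big_mkcond mulr_sumr; apply: eq_bigr => y _.
  by rewrite mulrCA.
have bct x y : bounded_on simplex (fun e => if lt_rank x y then c x y * (g e * t x y e) else 0).
  case: (boolP (lt_rank x y)) => [/rank_lt_neq xy|_]; last exact: bounded_on_cst.
  by apply: bounded_onZ; apply: bounded_onM => //; exact: bt.
rewrite (expectation_sum mS D1); last by move=> x; exact: bounded_on_sum.
apply: eq_bigr => x _; rewrite (expectation_sum mS D1)// [RHS]big_mkcond.
apply: eq_bigr => y _.
case: (boolP (lt_rank x y)) => [/rank_lt_neq xy|_]; last exact: expectation_cst.
rewrite (expectationZ mS D1); last by apply: bounded_onM => //; exact: bt.
congr (_ * _).
rewrite (expectation_product mS mQ D1 (Q1 x y)
  (h := fun q => g q.1 * (f (exchanged x y q) - f q.1))); last first.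
  by apply: bounded_onM; [exact: bounded_joint_fst|exact: bd].
apply: (expectation_eq mS D1).
- by apply: bounded_onM => //; exact: bt.
- apply: (bounded_on_Rintegral mQ (Q1 x y)
    (h := fun q => g q.1 * (f (exchanged x y q) - f q.1))).
  by apply: bounded_onM; [exact: bounded_joint_fst|exact: bd].
- move=> e Se; rewrite -(expectationZ mQ (Q1 x y))//.
  exact: bounded_on_section Se (bd x y xy).
Qed.

Lemma joint_dot_sym x y f g : x != y -> bounded_on simplex f -> bounded_on simplex g ->
  \int[J x y]_q (g q.1 * (f (exchanged x y q) - f q.1)) =
  \int[J x y]_q (f q.1 * (g (exchanged x y q) - g q.1)).
Proof.
move=> xy bf bg; have [mf _] := bf; have [mg _] := bg.
have b1 := bounded_joint_fst bf; have b2 := bounded_joint_fst bg.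
have b3 := bounded_joint_exchanged xy bf; have b4 := bounded_joint_exchanged xy bg.
under eq_Rintegral do rewrite mulrBr.
rewrite (expectationB mSQ (J1 x y)); [|exact: bounded_onM..].
under [RHS]eq_Rintegral do rewrite mulrBr.
rewrite (expectationB mSQ (J1 x y)); [|exact: bounded_onM..].
congr (_ - _); last by apply: eq_Rintegral => q _; rewrite mulrC.
rewrite (exchange_joint_sym V2 kappa_gt0 kappa_lt xy (h := fun e e' => g e * f e')).
  by apply: eq_Rintegral => q _; rewrite mulrC.
apply: measurable_funM; first exact: measurableT_comp mg measurable_fst.
exact: measurableT_comp mf measurable_snd.
Qed.

Lemma generator_sym f g : bounded_on simplex f -> bounded_on simplex g ->
  \int[D]_e (g e * L f e) = \int[D]_e (f e * L g e).
Proof.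
move=> bf bg; rewrite !generator_dot//; apply: eq_bigr => x _; apply: eq_bigr => y /rank_lt_neq xy.
by rewrite (joint_dot_sym xy bf bg).
Qed.

Lemma energy_dot x y f : x != y -> bounded_on simplex f ->
  energy alpha kappa x y f / 2 = - \int[J x y]_q (f q.1 * (f (exchanged x y q) - f q.1)).
Proof.
move=> xy bf; have lf := bounded_square_integrable mS D1 bf.
rewrite (energyE V2 kappa_gt0 kappa_lt xy lf) mulrC mulKf ?pnatr_eq0//.
have b1 := bounded_joint_fst bf; have b3 := bounded_joint_exchanged xy bf.
rewrite -mulN1r -(expectationZ mSQ (J1 x y)); last by apply: bounded_onM => //; exact: bounded_onB.
by apply: eq_Rintegral => q _; ring.
Qed.

Lemma form_generator f : bounded_on simplex f ->
  form alpha kappa c f = - \int[D]_e (f e * L f e).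
Proof.
move=> bf; rewrite generator_dot// -sumrN; apply: eq_bigr => x _.
rewrite -sumrN; apply: eq_bigr => y /rank_lt_neq xy.
by rewrite (energy_dot xy bf) mulrN.
Qed.

Lemma energy_le x y f : x != y -> square_integrable D f ->
  energy alpha kappa x y f <= 4 * \int[D]_e (f e ^+ 2).
Proof.
move=> xy lf; have [mf _] := lf.
have l1 := square_integrable_fst kappa x y lf.
have l2 := square_integrable_exchanged V2 kappa_gt0 kappa_lt xy lf.
have s1 := square_integrable_sqr l1; have s2 := square_integrable_sqr l2.
have e1 : \int[J x y]_q (f q.1 ^+ 2) = \int[D]_e (f e ^+ 2).
  congr fine; apply: (ge0_integral_joint_fst alpha kappa x y (F := fun e => (f e ^+ 2)%:E)).
    by apply/measurable_EFinP; exact: measurable_funX.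
  by move=> e; rewrite lee_fin sqr_ge0.
have e2 : \int[J x y]_q (f (exchanged x y q) ^+ 2) = \int[D]_e (f e ^+ 2).
  by congr fine; exact: (integral_exchanged_sqr V2 kappa_gt0 kappa_lt xy mf).
have i1 : (J x y).-integrable setT (fun q => (2 * f q.1 ^+ 2)%:E).
  by under eq_fun do rewrite EFinM; exact: integrableZl.
have i2 : (J x y).-integrable setT (fun q => (2 * f (exchanged x y q) ^+ 2)%:E).
  by under eq_fun do rewrite EFinM; exact: integrableZl.
apply: (@le_trans _ _ (\int[J x y]_q (2 * f q.1 ^+ 2 + 2 * f (exchanged x y q) ^+ 2))).
  apply: le_Rintegral => //.
  - exact: square_integrable_sqr (square_integrableB l1 l2).
  - by apply: eq_integrable (integrableD measurableT i1 i2).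
  - move=> q _; have := sqr_ge0 (f q.1 + f (exchanged x y q)); nra.
by rewrite RintegralD// !RintegralZl// e1 e2; lra.
Qed.

Definition total_rate : R := \sum_(x : V) \sum_(y | lt_rank x y) c x y.

Lemma total_rate_ge0 : 0 <= total_rate.
Proof. by apply: sumr_ge0 => x _; apply: sumr_ge0. Qed.

(** By stationarity each edge energy is at most four times the squared norm, so L is a bounded
    operator. The constant limits the step eps, and lets the spectral inequality pass to limits in
    L2. *)
Lemma form_le f : square_integrable D f ->
  form alpha kappa c f <= 2 * total_rate * \int[D]_e (f e ^+ 2).
Proof.
move=> lf; rewrite mulrAC mulr_sumr; apply: ler_sum => x _.
rewrite mulr_sumr; apply: ler_sum => y /rank_lt_neq xy.
rewrite [leRHS]mulrC ler_wpM2l//.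
by have := energy_le xy lf; lra.
Qed.

Lemma form_ge0 f : 0 <= form alpha kappa c f.
Proof.
by apply: sumr_ge0 => x _; apply: sumr_ge0 => y _; rewrite mulr_ge0// divr_ge0 ?energy_ge0.
Qed.

End generator.

(** * Linear functions and moments of the Dirichlet law *)

Section linear_functions.
Context (R : realType) (V : finType).
Hypothesis V2 : (1 < #|V|)%N.
Variables (alpha : V -> R) (kappa : R).
Hypotheses (kappa_gt0 : 0 < kappa) (kappa_lt : forall x, kappa < alpha x).
Local Notation D := (dirichlet alpha).
Local Notation Q := (exchange_law alpha kappa).
Local Notation J := (exchange_joint alpha kappa).
Local Notation simplex := (@simplex R V).
Implicit Types (f g : config V R -> R) (x y z w : V) (l : V -> R).

Let mS : measurable simplex := @measurable_simplex R V.
Let D1 : D simplex = 1%E := dirichlet_full V2 alpha.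
Let mQ := @measurable_unit_square R.
Let Q1 x y := exchange_law_full kappa_gt0 kappa_lt x y.
Let alpha_gt0 z : 0 < alpha z := lt_trans kappa_gt0 (kappa_lt z).
Let alpha_neq0 z : alpha z != 0. Proof. by rewrite gt_eqF. Qed.

Definition lin l (eta : config V R) : R := \sum_x l x * coord eta x.

Lemma lin_delta x : lin (fun z => (z == x)%:R) = (@coord R V)^~ x.
Proof.
apply/funext => eta; rewrite /lin (bigD1 x)//= eqxx mul1r big1 ?addr0// => z /negbTE ->.
by rewrite mul0r.
Qed.

Lemma coord_le1 eta x : simplex eta -> coord eta x <= 1.
Proof. by move=> [e0 <-]; rewrite (bigD1 x)//= lerDl sumr_ge0. Qed.

Lemma bounded_on_coord x : bounded_on simplex ((@coord R V)^~ x).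
Proof.
split; first exact: measurable_coord.
by exists 1 => eta Seta; rewrite ger0_norm ?coord_le1//; have [] := Seta.
Qed.

Lemma bounded_joint_coord x :
  bounded_on (simplex `*` @unit_square R) (fun q => coord q.1 x).
Proof. exact: (bounded_joint_fst (bounded_on_coord x)). Qed.

Lemma bounded_on_lin l : bounded_on simplex (lin l).
Proof. by apply: bounded_on_sum => x; apply: bounded_onZ; exact: bounded_on_coord. Qed.

Lemma lin_move l eta x y s : lin l (config_move eta x y s) = lin l eta + s * (l x - l y).
Proof.
rewrite /lin; under eq_bigr do rewrite coord_config_move mulrDr.
rewrite big_split/=; congr (_ + _).
under eq_bigr do rewrite mulrCA mulrBr.
rewrite -mulr_sumr sumrB; congr (_ * (_ - _)).
  by rewrite (bigD1 x)//= eqxx mulr1 big1 ?addr0// => z /negbTE ->; rewrite mulr0.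
by rewrite (bigD1 y)//= eqxx mulr1 big1 ?addr0// => z /negbTE ->; rewrite mulr0.
Qed.

Lemma lin_exchanged l x y q : x != y ->
  lin l (exchanged x y q) - lin l q.1 =
  (l y - l x) * ((1 - q.2.1) * coord q.1 x - (1 - q.2.2) * coord q.1 y).
Proof. by move=> xy; rewrite /exchanged (exchange_move xy) lin_move; ring. Qed.

(** Only the means of 1 - U and 1 - W enter, so each moment identity obtained by symmetry compares
    coordinates divided by their alpha. *)
Lemma joint_transfer g x y : bounded_on simplex g ->
  \int[J x y]_q (g q.1 * ((1 - q.2.1) * coord q.1 x - (1 - q.2.2) * coord q.1 y)) =
  kappa * (\int[D]_e (g e * coord e x) / alpha x - \int[D]_e (g e * coord e y) / alpha y).
Proof.
move=> bg; have bgx z := bounded_onM bg (bounded_on_coord z).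
have b1 := bounded_onem_fst R; have b2 := bounded_onem_snd R.
rewrite (expectation_product mS mQ D1 (Q1 x y)
  (h := fun q => g q.1 * ((1 - q.2.1) * coord q.1 x - (1 - q.2.2) * coord q.1 y))); last first.
  apply: bounded_onM; first exact: bounded_joint_fst.
  have b3 : bounded_on (simplex `*` @unit_square R) (fun q => 1 - q.2.1 : R).
    exact: (bounded_on_snd simplex b1).
  have b4 : bounded_on (simplex `*` @unit_square R) (fun q => 1 - q.2.2 : R).
    exact: (bounded_on_snd simplex b2).
  by apply: bounded_onB; apply: bounded_onM => //; exact: bounded_joint_coord.
transitivity (\int[D]_e (kappa / alpha x * (g e * coord e x) +
                         - (kappa / alpha y) * (g e * coord e y))).
  apply: eq_Rintegral => e _.
  transitivity (\int[Q x y]_p (0 + (1 - p.1) * (g e * coord e x) +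
    (1 - p.2) * (- (g e * coord e y)))).
    by apply: eq_Rintegral => p _ /=; ring.
  by rewrite (exchange_linear kappa_gt0 kappa_lt x y); ring.
rewrite (expectationD mS D1); [|exact: bounded_onZ..].
by rewrite !(expectationZ mS D1)//; ring.
Qed.

Lemma joint_lin_transfer g l x y : x != y -> bounded_on simplex g ->
  \int[J x y]_q (g q.1 * (lin l (exchanged x y q) - lin l q.1)) =
  (l y - l x) * kappa *
  (\int[D]_e (g e * coord e x) / alpha x - \int[D]_e (g e * coord e y) / alpha y).
Proof.
move=> xy bg; rewrite -mulrA -joint_transfer//.
rewrite -(expectationZ (measurableX mS mQ) (exchange_joint_full V2 kappa_gt0 kappa_lt x y)).
  by apply: eq_Rintegral => q _; rewrite lin_exchanged//; ring.
apply: bounded_onM; first exact: bounded_joint_fst.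
have b3 : bounded_on (simplex `*` @unit_square R) (fun q => 1 - q.2.1 : R).
  exact: (bounded_on_snd simplex (bounded_onem_fst R)).
have b4 : bounded_on (simplex `*` @unit_square R) (fun q => 1 - q.2.2 : R).
  exact: (bounded_on_snd simplex (bounded_onem_snd R)).
by apply: bounded_onB; apply: bounded_onM => //; exact: bounded_joint_coord.
Qed.

Let m1 x := \int[D]_e coord e x.
Let m2 x y := \int[D]_e (coord e x * coord e y).
Let sa := \sum_x alpha x.

Let sa_gt0 : 0 < sa.
Proof.
have [x _] := card_gt0P (ltnW V2).
by rewrite /sa (bigD1 x)//= ltr_pwDl// sumr_ge0// => z _; exact: ltW.
Qed.

(** In equilibrium the mean net transfer along any pair is zero, since it pairs with the constant 1;
    hence the ratios to alpha agree, and the total mass fixes their common value. *)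
Let m1E x : m1 x = alpha x / sa.
Proof.
have e z w : m1 z / alpha z = m1 w / alpha w.
  have [->//|zw] := eqVneq z w.
  have := joint_lin_transfer (fun v => (v == z)%:R) zw (bounded_on_cst simplex 1).
  have b := bounded_on_lin (fun v => (v == z)%:R).
  rewrite (joint_dot_sym V2 kappa_gt0 kappa_lt zw b (bounded_on_cst simplex 1)).
  have -> : \int[J z w]_q (lin (fun v => (v == z)%:R) q.1 * (1 - 1)) = 0.
    rewrite -[RHS](expectation_cst (J z w) 0).
    by apply: eq_Rintegral => q _; rewrite subrr mulr0.
  rewrite eqxx eq_sym (negbTE zw) sub0r mulN1r => /esym/eqP.
  rewrite mulf_eq0 oppr_eq0 (gt_eqF kappa_gt0)/= subr_eq0 => /eqP.
  by under eq_Rintegral do rewrite mul1r; under [in RHS]eq_Rintegral do rewrite mul1r.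
have s1 : \sum_z m1 z = 1.
  rewrite -(expectation_sum mS D1); last by move=> z; exact: bounded_on_coord.
  rewrite -(expectation_cst D 1); apply: (expectation_eq mS D1).
  - by apply: bounded_on_sum => z; exact: bounded_on_coord.
  - exact: bounded_on_cst.
  - by move=> eta [].
have : (m1 x / alpha x) * sa = 1.
  rewrite -s1 mulr_sumr; apply: eq_bigr => z _.
  by rewrite (e x z) divfK.
by move=> /(canRL (mulfK (lt0r_neq0 sa_gt0))) /(canRL (divfK (alpha_neq0 x))) ->; rewrite mul1r mulrC.
Qed.

Let m2C x y : m2 x y = m2 y x.
Proof. by apply: eq_Rintegral => e _; rewrite mulrC. Qed.

Let sum_m2 x : \sum_y m2 x y = m1 x.
Proof.
rewrite -(expectation_sum mS D1); last first.
  by move=> z; apply: bounded_onM; exact: bounded_on_coord.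
apply: (expectation_eq mS D1).
- by apply: bounded_on_sum => z; apply: bounded_onM; exact: bounded_on_coord.
- exact: bounded_on_coord.
- by move=> eta [_ e1]; rewrite -mulr_sumr e1 mulr1.
Qed.

(** An exchange along {x, y} leaves the coordinate z alone, so by symmetry the net transfer is
    uncorrelated with it. *)
Let m2_step z x y : z != x -> z != y -> m2 z x / alpha x = m2 z y / alpha y.
Proof.
move=> zx zy; have [->//|xy] := eqVneq x y.
have bx := bounded_on_lin (fun v => (v == x)%:R).
have bz := bounded_on_lin (fun v => (v == z)%:R).
have := joint_lin_transfer (fun v => (v == x)%:R) xy bz.
rewrite (joint_dot_sym V2 kappa_gt0 kappa_lt xy bx bz).
rewrite (joint_lin_transfer _ xy bx) eq_sym (negbTE zy) eq_sym (negbTE zx) subrr !mul0r.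
rewrite eqxx eq_sym (negbTE xy) sub0r mulN1r lin_delta => /esym/eqP.
by rewrite mulf_eq0 oppr_eq0 (gt_eqF kappa_gt0)/= subr_eq0 => /eqP.
Qed.

(** [m2_step] makes the normalised second moments constant along each row off the diagonal; their
    symmetry in the two indices joins the rows. *)
Let m2_off : exists H, forall z w, z != w -> m2 z w = H * alpha z * alpha w.
Proof.
have [v1 [v2 v12]] : exists v1 v2 : V, v1 != v2.
  have [x _] := card_gt0P (ltnW V2); exists x.
  move: V2; rewrite (cardD1 x) inE add1n ltnS => /card_gt0P[y].
  by rewrite !inE andbT => yx; exists y; rewrite eq_sym.
pose h z w := m2 z w / (alpha z * alpha w).
have hC z w : h z w = h w z by rewrite /h m2C (mulrC (alpha z)).
have hs z w w' : z != w -> z != w' -> h z w = h z w'.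
  by move=> zw zw'; rewrite /h !invfM !(mulrCA (m2 _ _)) (m2_step zw zw').
exists (h v1 v2) => z w zw.
have -> : h v1 v2 = h z w.
  (* Route for z different from v1: (z, w) to (z, v1) along the row, transpose, then (v1, z) to (v1,
     v2). *)
  have [zo|zo] := eqVneq z v1; first by rewrite zo; apply: hs => //; rewrite -zo.
  by rewrite (hs z w v1)// (hC z v1) (hs v1 z v2)// eq_sym.
by rewrite /h -mulrA mulfVK// mulf_neq0.
Qed.

(** This is |alpha| times the variance of l under the probability alpha / |alpha|. By
    [linear_moments] the Dirichlet variance of [lin l] is a fixed multiple of it. *)
Definition alpha_var l : R :=
  \sum_x alpha x * l x ^+ 2 - (\sum_x alpha x * l x) ^+ 2 / \sum_x alpha x.

Lemma mean_lin l : \int[D]_e lin l e = (\sum_x alpha x * l x) / \sum_x alpha x.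
Proof.
rewrite (expectation_sum mS D1); last by move=> x; apply: bounded_onZ; exact: bounded_on_coord.
rewrite mulr_suml; apply: eq_bigr => x _; rewrite (expectationZ mS D1); last exact: bounded_on_coord.
by rewrite -/(m1 x) m1E mulrA (mulrC (l x)).
Qed.

(* The moments are read off the symmetry of [exchange_joint] alone, which only
   determines them up to the constant [k]. *)
Lemma linear_moments : exists2 k : R, 0 < k &
  (forall x y l, x != y -> energy alpha kappa x y (lin l) = 2 * kappa * k * (l x - l y) ^+ 2) /\
  (forall l, \int[D]_e (lin l e ^+ 2) - (\int[D]_e lin l e) ^+ 2 = k * alpha_var l).
Proof.
(* The row sums of the second moments are the first moments; solving for the diagonal leaves this
   coefficient of alpha_z beside the product term. *)
have [H HE] := m2_off; pose k := sa^-1 - H * sa.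
have sa0 : sa != 0 by rewrite gt_eqF.
have m2E z w : m2 z w = H * alpha z * alpha w + (z == w)%:R * k * alpha z.
  have [<-|zw] := eqVneq z w; last by rewrite HE// !mul0r addr0.
  have := sum_m2 z; rewrite (bigD1 z)//= (eq_bigr (fun w => H * alpha z * alpha w)).
    rewrite -mulr_sumr m1E => /eqP; rewrite -subr_eq0 => /eqP e.
    have sE : sa = alpha z + \sum_(i | i != z) alpha i by rewrite /sa (bigD1 z).
    apply/eqP; rewrite -subr_eq0 -e; apply/eqP; rewrite mul1r /k.
    rewrite (_ : \sum_(i | i != z) alpha i = sa - alpha z); last by rewrite sE addrC addKr.
    by rewrite mulrBl; field.
  by move=> w' w'z; rewrite HE// eq_sym.
have dot_lin l z : \int[D]_e (lin l e * coord e z) = \sum_w l w * m2 w z.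
  transitivity (\int[D]_e (\sum_w l w * (coord e w * coord e z))).
    by apply: eq_Rintegral => e _; rewrite mulr_suml; apply: eq_bigr => w _; rewrite mulrA.
  rewrite (expectation_sum mS D1); last first.
    by move=> w; apply: bounded_onZ; apply: bounded_onM; exact: bounded_on_coord.
  apply: eq_bigr => w _; rewrite (expectationZ mS D1)//.
  by apply: bounded_onM; exact: bounded_on_coord.
pose S l := \sum_w alpha w * l w.
have dotE l z : \sum_w l w * m2 w z = H * S l * alpha z + k * alpha z * l z.
  under eq_bigr do rewrite m2E mulrDr.
  rewrite big_split/=; congr (_ + _).
    rewrite /S mulr_sumr mulr_suml; apply: eq_bigr => w _; ring.
  rewrite (bigD1 z)//= eqxx big1 ?addr0; first by rewrite mul1r; ring.
  by move=> w /negbTE ->; rewrite !mul0r mulr0.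
have energyl x y l : x != y ->
    energy alpha kappa x y (lin l) = 2 * kappa * k * (l x - l y) ^+ 2.
  move=> xy; have bl := bounded_on_lin l.
  have := energy_dot V2 kappa_gt0 kappa_lt xy bl.
  rewrite (joint_lin_transfer l xy bl) !dot_lin !dotE => e.
  have ax := alpha_neq0 x; have ay := alpha_neq0 y.
  have -> : energy alpha kappa x y (lin l) = 2 * (energy alpha kappa x y (lin l) / 2) by field.
  by rewrite e; field; rewrite ax ay.
have dot2 l : \int[D]_e (lin l e ^+ 2) = H * S l ^+ 2 + k * \sum_z alpha z * l z ^+ 2.
  transitivity (\int[D]_e (\sum_z l z * (lin l e * coord e z))).
    apply: eq_Rintegral => e _; rewrite expr2 {2}/lin mulr_sumr.
    by apply: eq_bigr => z _; ring.
  have b z := bounded_onM (bounded_on_lin l) (bounded_on_coord z).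
  rewrite (expectation_sum mS D1); last by move=> z; exact: bounded_onZ.
  transitivity (\sum_z (H * S l * (alpha z * l z) + k * (alpha z * l z ^+ 2))).
    apply: eq_bigr => z _; rewrite (expectationZ mS D1)// dot_lin dotE; ring.
  by rewrite big_split/= -!mulr_sumr -/(S l); congr (_ + _); ring.
exists k; last first.
  split=> // l; rewrite dot2 mean_lin /alpha_var -/(S l) -/sa /k; field.
  exact: sa0.
have [x [y xy]] : exists x y : V, x != y.
  have [x _] := card_gt0P (ltnW V2); exists x.
  move: V2; rewrite (cardD1 x) inE add1n ltnS => /card_gt0P[y].
  by rewrite !inE andbT => yx; exists y; rewrite eq_sym.
have := energyl x y (fun z => (z == x)%:R) xy.
rewrite lin_delta eqxx eq_sym (negbTE xy) subr0 expr1n mulr1 => ek.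
(* The sign of k is read off one energy: conditionally on the configuration, the variance of 1 - U
   alone contributes [vx] times the square of the coordinate x. *)
suff e0 : 0 < energy alpha kappa x y ((@coord R V)^~ x).
  by move: e0; rewrite ek pmulr_rgt0// mulr_gt0.
pose vx := kappa * (kappa + 1) / (alpha x * (alpha x + 1)) - (kappa / alpha x) ^+ 2.
have vx_gt0 z : 0 < kappa * (kappa + 1) / (alpha z * (alpha z + 1)) - (kappa / alpha z) ^+ 2.
  have az1 : alpha z + 1 != 0 by rewrite gt_eqF// addr_gt0.
  rewrite (_ : _ - _ = kappa * (alpha z - kappa) / (alpha z ^+ 2 * (alpha z + 1))); last first.
    by field; rewrite az1 alpha_neq0.
  by rewrite divr_gt0 ?mulr_gt0 ?subr_gt0 ?exprn_gt0 ?addr_gt0.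
have bx := bounded_on_coord x; have bxx := bounded_onM bx bx.
have m2xx : 0 < \int[D]_e (coord e x * coord e x).
  apply: (@lt_le_trans _ _ (m1 x ^+ 2)); first by rewrite m1E exprn_gt0// divr_gt0.
  have b := bounded_onB bx (bounded_on_cst simplex (m1 x)).
  have : 0 <= \int[D]_e ((coord e x * coord e x - 2 * m1 x * coord e x) + m1 x ^+ 2).
    apply: Rintegral_ge0 => e _.
    by rewrite (_ : _ + _ = (coord e x - m1 x) ^+ 2) ?sqr_ge0//; ring.
  rewrite (expectationD mS D1); last 2 first.
  - by apply: bounded_onB => //; exact: bounded_onZ.
  - exact: bounded_on_cst.
  rewrite (expectationB mS D1)//; last exact: bounded_onZ.
  rewrite (expectationZ mS D1)// expectation_cst -/(m1 x); nra.
apply: (@lt_le_trans _ _ (vx * \int[D]_e (coord e x * coord e x))).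
  by rewrite mulr_gt0//; exact: vx_gt0.
have b1 := bounded_joint_coord x.
have bd : bounded_on (simplex `*` @unit_square R)
    (fun q => coord q.1 x - coord (exchanged x y q) x).
  by apply: bounded_onB => //; exact: (bounded_joint_exchanged xy bx).
have bd2 : bounded_on (simplex `*` @unit_square R)
    (fun q => (coord q.1 x - coord (exchanged x y q) x) ^+ 2) by exact: bounded_onM.
rewrite /energy (expectation_product mS mQ D1 (Q1 x y) bd2) -(expectationZ mS D1)//.
apply: (expectation_le mS D1); first exact: bounded_onZ.
  exact: (bounded_on_Rintegral mQ (Q1 x y) bd2).
move=> e Se.
have -> : \int[Q x y]_p ((coord e x - coord (exchanged x y (e, p)) x) ^+ 2) =
    \int[Q x y]_p ((0 + (1 - p.1) * coord e x + (1 - p.2) * (- coord e y)) ^+ 2).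
  apply: eq_Rintegral => p _ /=.
  rewrite /exchanged (exchange_move xy) coord_config_move eqxx (negbTE xy) subr0 mulr1.
  by rewrite /=; ring.
rewrite (exchange_quadratic kappa_gt0 kappa_lt) -/vx.
have := vx_gt0 y; set vy := (X in 0 < X) => vy0.
have s1 := sqr_ge0 (0 + kappa / alpha x * coord e x + kappa / alpha y * - coord e y).
have s2 := mulr_ge0 (ltW vy0) (sqr_ge0 (- coord e y)).
by rewrite -expr2 -addrA addrCA lerDl addr_ge0.
Qed.

End linear_functions.

(** * Contraction of second differences *)

Section sums_of_squares.
Context (R : realType) (V : finType).
Hypothesis V2 : (1 < #|V|)%N.
Variables (alpha : V -> R) (kappa : R).
Hypotheses (kappa_gt0 : 0 < kappa) (kappa_lt : forall x, kappa < alpha x).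
Local Notation TR := (measurableTypeR R).
Local Notation Q := (exchange_law alpha kappa).
Implicit Types (x y z : V) (l D : V -> R) (g : (V -> R) -> R).

Let mQ := @measurable_unit_square R.
Let Q1 x y := exchange_law_full kappa_gt0 kappa_lt x y.
Let alpha_gt0 z : 0 < alpha z := lt_trans kappa_gt0 (kappa_lt z).
Let alpha_neq0 z : alpha z != 0. Proof. by rewrite gt_eqF. Qed.
Let sa := \sum_x alpha x.

Let sa_gt0 : 0 < sa.
Proof.
have [x _] := card_gt0P (ltnW V2).
by rewrite /sa (bigD1 x)//= ltr_pwDl// sumr_ge0// => z _; exact: ltW.
Qed.

Definition dot l D : R := \sum_x l x * D x.

(* [sos t g]: [g] is a sum of squares of linear forms, [t] its trace
   against [alpha_var]. *)
Inductive sos : R -> ((V -> R) -> R) -> Prop :=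
| sos_square l : sos (alpha_var alpha l) (fun D => dot l D ^+ 2)
| sosD s t g h : sos s g -> sos t h -> sos (s + t) (fun D => g D + h D)
| sosZ k t g : 0 <= k -> sos t g -> sos (k * t) (fun D => k * g D).

Lemma alpha_varE l : alpha_var alpha l =
  \sum_x alpha x * (l x - (\sum_x alpha x * l x) / sa) ^+ 2.
Proof.
set m := _ / sa.
transitivity (\sum_x (alpha x * l x ^+ 2 - 2 * m * (alpha x * l x) + m ^+ 2 * alpha x)).
  rewrite big_split/= sumrB -!mulr_sumr -/sa /alpha_var -/sa /m; field.
  by rewrite gt_eqF.
by apply: eq_bigr => x _; ring.
Qed.

Lemma alpha_var_ge0 l : 0 <= alpha_var alpha l.
Proof. by rewrite alpha_varE sumr_ge0// => x _; rewrite mulr_ge0 ?sqr_ge0// ltW. Qed.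

Lemma sos_trace_ge0 t g : sos t g -> 0 <= t.
Proof.
elim=> [l|s {}t {}g h _ s0 _ t0|k {}t {}g k0 _ t0].
- exact: alpha_var_ge0.
- exact: addr_ge0.
- exact: mulr_ge0.
Qed.

Lemma sos_ge0 t g D : sos t g -> 0 <= g D.
Proof.
elim=> [l|s {}t {}g h _ s0 _ t0|k {}t {}g k0 _ t0].
- exact: sqr_ge0.
- exact: addr_ge0.
- exact: mulr_ge0.
Qed.

(** On directions of total mass 0 a linear form may be centred, and Cauchy-Schwarz with weights
    alpha bounds its square by [alpha_var] times the sum of the D_x^2 / alpha_x. So the trace alone
    controls the form on differences of configurations. *)
Lemma sos_le t g D : \sum_x D x = 0 -> (forall x, `|D x| <= 1) -> sos t g ->
  g D <= t * \sum_x (alpha x)^-1.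
Proof.
move=> D0 D1; elim=> [l|s {}t {}g h _ s0 _ t0|k {}t {}g k0 _ t0].
- pose m := (\sum_x alpha x * l x) / sa.
  have -> : dot l D = \sum_x (l x - m) * D x.
    under eq_bigr do rewrite mulrBl.
    by rewrite sumrB -mulr_sumr D0 mulr0 subr0.
  apply: (@le_trans _ _ (alpha_var alpha l * \sum_x (D x ^+ 2 / alpha x))).
    apply: discriminant_le.
      by apply: sumr_ge0 => x _; rewrite divr_ge0 ?sqr_ge0// ltW.
    move=> u; rewrite alpha_varE -/m !mulr_sumr -!big_split/=.
    apply: sumr_ge0 => x _.
    rewrite (_ : _ + _ = alpha x * (l x - m + u * (D x / alpha x)) ^+ 2).
      by rewrite mulr_ge0 ?sqr_ge0// ltW.
    by field.
  apply: ler_wpM2l; first exact: alpha_var_ge0.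
  apply: ler_sum => x _; rewrite ler_piMl ?invr_ge0 ?(ltW (alpha_gt0 x))//.
  by rewrite -real_normK ?num_real// expr_le1.
- by rewrite mulrDl lerD.
- by rewrite -mulrA ler_wpM2l.
Qed.

(** The empty sum is 0 times some given sum of squares; this is the purpose of the first hypothesis,
    [sos] having no constructor for 0. *)
Lemma sos_sum I (r : seq I) (p : pred I) (t : I -> R) (g : I -> (V -> R) -> R) :
  (exists t0 g0, sos t0 g0) -> (forall i, p i -> sos (t i) (g i)) ->
  sos (\sum_(i <- r | p i) t i) (fun D => \sum_(i <- r | p i) g i D).
Proof.
move=> [t0 [g0 s0]] sg; elim: r => [|i r IH].
  rewrite big_nil (_ : (fun D => _) = fun D => 0 * g0 D); last first.
    by apply/funext => D; rewrite big_nil mul0r.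
  by rewrite -[X in sos X](mul0r t0); exact: sosZ.
rewrite big_cons (_ : (fun D => _) =
    fun D => if p i then g i D + \sum_(i <- r | p i) g i D else \sum_(i <- r | p i) g i D).
  by case: ifPn => // pi; apply: sosD => //; exact: sg.
by apply/funext => D; rewrite big_cons.
Qed.

(** An exchange with fixed Beta variables is linear in the configuration; this is the same map on
    differences, written as a net flow from x to y. *)
Definition dir_move D x y (p : TR * TR) : V -> R := fun z =>
  D z + ((1 - p.1) * D x - (1 - p.2) * D y) * ((z == y)%:R - (z == x)%:R).

Lemma dot_delta l x : \sum_z l z * (z == x)%:R = l x.
Proof. by rewrite (bigD1 x)//= eqxx mulr1 big1 ?addr0// => z /negbTE ->; rewrite mulr0. Qed.

Lemma delta_dot l x : \sum_z (z == x)%:R * l z = l x.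
Proof. by under eq_bigr do rewrite mulrC; exact: dot_delta. Qed.

Lemma dot_move l D x y p : dot l (dir_move D x y p) =
  dot l D + (1 - p.1) * ((l y - l x) * D x) + (1 - p.2) * (- ((l y - l x) * D y)).
Proof.
rewrite /dot /dir_move.
transitivity (\sum_z (l z * D z + ((1 - p.1) * D x - (1 - p.2) * D y) *
    (l z * (z == y)%:R - l z * (z == x)%:R))).
  by apply: eq_bigr => z _; ring.
by rewrite big_split/= -mulr_sumr sumrB !dot_delta; ring.
Qed.

Lemma bounded_sos_move t g D x y : sos t g ->
  bounded_on (@unit_square R) (fun p => g (dir_move D x y p)).
Proof.
elim=> [l|s {}t {}g h _ bg _ bh|k {}t {}g k0 _ bg].
- under eq_fun do rewrite dot_move expr2.
  by apply: bounded_onM; exact: bounded_exchange_linear.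
- exact: bounded_onD.
- exact: bounded_onZ.
Qed.

Lemma alpha_var_perturb l x y s t : x != y ->
  alpha_var alpha (fun z => l z + s * (z == x)%:R + t * (z == y)%:R) =
  \sum_z alpha z * l z ^+ 2 + alpha x * (2 * s * l x + s ^+ 2) +
  alpha y * (2 * t * l y + t ^+ 2) -
  (\sum_z alpha z * l z + s * alpha x + t * alpha y) ^+ 2 / sa.
Proof.
move=> xy; rewrite /alpha_var -/sa; congr (_ - _ ^+ 2 / sa); last first.
  transitivity (\sum_z (alpha z * l z + s * (alpha z * (z == x)%:R) +
     t * (alpha z * (z == y)%:R))); first by apply: eq_bigr => z _; ring.
  by rewrite !big_split/= -!mulr_sumr !dot_delta.
transitivity (\sum_z (alpha z * l z ^+ 2 +
    (alpha z * (2 * s * l z + s ^+ 2)) * (z == x)%:R +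
    (alpha z * (2 * t * l z + t ^+ 2)) * (z == y)%:R)); last first.
  by rewrite !big_split/= !(dot_delta (fun z => alpha z * (_ * l z + _))).
apply: eq_bigr => z _.
have [->|zx] := eqVneq z x; first by rewrite (negbTE xy) /=; ring.
by case: (z == y) => /=; ring.
Qed.

Definition edge_gamma x y : R :=
  ((alpha x - kappa) / (alpha x + 1) + (alpha y - kappa) / (alpha y + 1)) *
  (1 + (\sum_x alpha x)^-1).

Definition edge_dir x y : V -> R := fun z => (z == x)%:R - (z == y)%:R.

Lemma dot_edge_dir l x y : dot l (edge_dir x y) = l x - l y.
Proof. by rewrite /dot /edge_dir; under eq_bigr do rewrite mulrBr; rewrite sumrB !dot_delta. Qed.

(* The trace drops by exactly the edge term of [gamma_IEM]. *)
Lemma sos_exchange t g x y : x != y -> sos t g ->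
  sos (t - kappa * edge_gamma x y * g (edge_dir x y))
      (fun D => \int[Q x y]_p g (dir_move D x y p)).
Proof.
move=> xy; elim=> [l|s {}t {}g h sg IHg sh IHh|k {}t {}g k0 sg IHg].
- pose d := l y - l x.
  (* [l1] is the form averaged over the exchange, while [l2] and [l3], concentrated at x and y,
     carry the variances of 1 - U and 1 - W. The common shape with zero terms lets
     [alpha_var_perturb] treat all three. *)
  pose l1 z := l z + kappa / alpha x * d * (z == x)%:R + - (kappa / alpha y * d) * (z == y)%:R.
  pose l2 z := 0 + d * (z == x)%:R + 0 * (z == y)%:R.
  pose l3 z := 0 + 0 * (z == x)%:R + d * (z == y)%:R.
  pose v z := kappa * (kappa + 1) / (alpha z * (alpha z + 1)) - (kappa / alpha z) ^+ 2.
  have az1 z : alpha z + 1 != 0 by rewrite gt_eqF// addr_gt0.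
  have v_ge0 z : 0 <= v z.
    rewrite (_ : v z = kappa * (alpha z - kappa) / (alpha z ^+ 2 * (alpha z + 1))); last first.
      by rewrite /v; field; rewrite az1 alpha_neq0.
    by rewrite divr_ge0 ?mulr_ge0 ?subr_ge0 ?exprn_ge0 ?addr_ge0 ?ltW.
  have := sosD (sosD (sos_square l1) (sosZ (v_ge0 x) (sos_square l2)))
    (sosZ (v_ge0 y) (sos_square l3)).
  rewrite (_ : (fun D => _ + _) = (fun D => \int[Q x y]_p dot l (dir_move D x y p) ^+ 2)).
    rewrite (_ : _ + _ = alpha_var alpha l - kappa * edge_gamma x y * dot l (edge_dir x y) ^+ 2)//.
    (* The alpha-mean of [l1] equals that of l. In the factor 1 + 1/|alpha| the 1 stems from the
       sums of alpha_z l_z^2, and the 1/|alpha| from the squared means of [l2] and [l3]. *)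
    rewrite /l1 /l2 /l3 !(alpha_var_perturb _ _ _ xy) dot_edge_dir.
    have z1 : \sum_z alpha z * (0 : R) ^+ 2 = 0 by rewrite big1// => z _; rewrite expr0n mulr0.
    have z2 : \sum_z alpha z * (0 : R) = 0 by rewrite big1// => z _; rewrite mulr0.
    rewrite z1 z2 /v /edge_gamma /alpha_var -/sa /d; field.
    by rewrite !az1 !alpha_neq0 gt_eqF.
  apply/funext => D; have dE l' a b u w : dot (fun z => l' z + a * (z == u)%:R + b * (z == w)%:R) D =
      dot l' D + a * D u + b * D w.
    rewrite /dot; transitivity (\sum_z (l' z * D z + a * ((z == u)%:R * D z) + b * ((z == w)%:R * D z))).
      by apply: eq_bigr => z _; ring.
    by rewrite !big_split/= -!mulr_sumr !delta_dot.
  rewrite /l1 /l2 /l3 !dE.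
  have z0 : dot (fun=> 0) D = 0 by rewrite /dot big1// => z _; rewrite mul0r.
  rewrite z0; under [RHS]eq_Rintegral do rewrite dot_move.
  by rewrite (exchange_quadratic kappa_gt0 kappa_lt) -/d -/(v x) -/(v y); ring.
- have := sosD IHg IHh; congr sos; first by ring.
  apply/funext => D; rewrite (expectationD mQ (Q1 x y))//.
    exact: (bounded_sos_move _ _ _ sg).
  exact: (bounded_sos_move _ _ _ sh).
- have := sosZ k0 IHg; congr sos; first by ring.
  apply/funext => D; rewrite (expectationZ mQ (Q1 x y))//.
  exact: (bounded_sos_move _ _ _ sg).
Qed.

Variable c : V -> V -> R.
Hypothesis c_ge0 : forall x y, 0 <= c x y.
Local Notation lt_rank x y := (enum_rank x < enum_rank y)%N.

(** The action of P = I + eps L on dominating forms: hold, or replace the form by its average over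
    an exchange. *)
Definition sos_step eps g D : R :=
  (1 - eps * total_rate c) * g D +
  eps * \sum_x \sum_(y | lt_rank x y) c x y * \int[Q x y]_p g (dir_move D x y p).

Lemma poincare_sos G t g :
  (forall l, G * alpha_var alpha l <=
     \sum_x \sum_(y | lt_rank x y) c x y * kappa * (l x - l y) ^+ 2) ->
  sos t g ->
  G * t <= \sum_x \sum_(y | lt_rank x y) c x y * kappa * g (edge_dir x y).
Proof.
move=> hG; elim=> [l|s {}t {}g h _ IHg _ IHh|k {}t {}g k0 _ IHg].
- by apply: le_trans (hG l) _; under eq_bigr do under eq_bigr do rewrite -dot_edge_dir.
- rewrite mulrDr (le_trans (lerD IHg IHh))// -big_split/= ler_sum// => x _.
  by rewrite -big_split/= ler_sum// => y _; rewrite -mulrDr.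
- rewrite mulrCA (le_trans (ler_wpM2l k0 IHg))// mulr_sumr ler_sum// => x _.
  by rewrite mulr_sumr ler_sum// => y _; rewrite mulrCA.
Qed.

Lemma sos_stepP eps G m t g : 0 <= eps -> eps * total_rate c <= 1 -> 0 <= m ->
  (forall x y, x != y -> 0 < c x y -> m <= edge_gamma x y) ->
  (forall l, G * alpha_var alpha l <=
     \sum_x \sum_(y | lt_rank x y) c x y * kappa * (l x - l y) ^+ 2) ->
  sos t g ->
  exists2 t', sos t' (sos_step eps g) & t' <= (1 - eps * (m * G)) * t.
Proof.
move=> eps0 eps1 m0 hm hG sg.
have ex : exists t0 g0, sos t0 g0 by exists t, g.
exists ((1 - eps * total_rate c) * t + eps * \sum_x \sum_(y | lt_rank x y)
    c x y * (t - kappa * edge_gamma x y * g (edge_dir x y))).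
  apply: sosD; apply: sosZ => //; first by rewrite subr_ge0.
  apply: sos_sum => // x _; apply: sos_sum => // y /rank_lt_neq xy.
  by apply: sosZ => //; exact: sos_exchange.
have -> : \sum_x \sum_(y | lt_rank x y) c x y * (t - kappa * edge_gamma x y * g (edge_dir x y)) =
    total_rate c * t - \sum_x \sum_(y | lt_rank x y) c x y * kappa * edge_gamma x y * g (edge_dir x y).
  rewrite /total_rate mulr_suml -sumrB; apply: eq_bigr => x _.
  by rewrite mulr_suml -sumrB; apply: eq_bigr => y _; ring.
have : m * (G * t) <= \sum_x \sum_(y | lt_rank x y)
    c x y * kappa * edge_gamma x y * g (edge_dir x y).
  apply: le_trans (ler_wpM2l m0 (poincare_sos hG sg)) _.
  rewrite mulr_sumr ler_sum// => x _; rewrite mulr_sumr ler_sum// => y /rank_lt_neq xy.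
  have := c_ge0 x y; rewrite le_eqVlt => /predU1P[<-|cxy]; first by rewrite !mul0r mulr0.
  rewrite mulrA ler_wpM2r ?(sos_ge0 _ sg)// mulrC ler_wpM2l ?hm//.
  by rewrite mulr_ge0 ?(ltW kappa_gt0) ?(ltW cxy).
move=> /(ler_wpM2l eps0); lra.
Qed.

End sums_of_squares.

Lemma le_halving (R : realType) (x K M : R) :
  (forall n, x <= K + M / 2 ^+ n) -> x <= K.
Proof.
move=> h; apply/ler_addgt0Pr => e e0.
have [n Mn] : exists n, M / 2 ^+ n <= e.
  exists (Num.trunc (M / e)).+1.
  rewrite ler_pdivrMr ?exprn_gt0// mulrC -ler_pdivrMr//.
  apply: (@le_trans _ _ (Num.trunc (M / e)).+1%:R); first exact/ltW/truncnS_gt.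
  by rewrite -natrX ler_nat ltnW// ltn_expl.
by apply: le_trans (h n) _; rewrite lerD2l.
Qed.

(* A bound [M] on the defect from the chord improves to [(K + M) / 2],
   since the defect at [t] is a midpoint of those at [0] and [2 t] (or at
   [2 t - 1] and [1]). *)
Lemma chord_approx (R : realType) (h : R -> R) (K B : R) :
  (forall t, 0 <= t <= 1 -> `|h t| <= B) ->
  (forall u v, 0 <= u <= 1 -> 0 <= v <= 1 -> `|h u + h v - 2 * h ((u + v) / 2)| <= K) ->
  forall t, 0 <= t <= 1 -> `|h t - (h 0 + t * (h 1 - h 0))| <= K.
Proof.
move=> hB hK; pose phi t := h t - (h 0 + t * (h 1 - h 0)).
have p0 : phi 0 = 0 by rewrite /phi; ring.
have p1 : phi 1 = 0 by rewrite /phi; ring.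
have pK u v : 0 <= u <= 1 -> 0 <= v <= 1 -> `|phi u + phi v - 2 * phi ((u + v) / 2)| <= K.
  move=> u01 v01; by rewrite (_ : _ - _ = h u + h v - 2 * h ((u + v) / 2)) ?hK// /phi; field.
have i0 : 0 <= (0 : R) <= 1 by rewrite lexx ler01.
have i1 : 0 <= (1 : R) <= 1 by rewrite lexx ler01.
have B0 : 0 <= B := le_trans (normr_ge0 _) (hB 0 i0).
(* The defect is at most 4 B outright: B from h t, B from h 0 and 2 B from the slope. The halving
   starts there. *)
suff it : forall n t, 0 <= t <= 1 -> `|phi t| <= K + (4 * B) / 2 ^+ n.
  by move=> t t01; apply: (@le_halving _ _ K (4 * B)) => n; exact: it.
have K0 : 0 <= K := le_trans (normr_ge0 _) (hK 0 0 i0 i0).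
elim => [t t01|n IH t t01].
  rewrite expr0 divr1; have h1 : `|h 1| <= B := hB 1 i1.
  have h0 : `|h 0| <= B := hB 0 i0.
  have ht := hB t t01; have /andP[t0 t1] := t01.
  move: h1 h0 ht; rewrite /phi !ler_norml => /andP[? ?] /andP[? ?] /andP[? ?].
  apply/andP; split; nra.
have [t2|t2] := leP t (1 / 2).
  have t01' : 0 <= 2 * t <= 1 by lra.
  have := IH _ t01'; have := pK 0 (2 * t) i0 t01'.
  rewrite p0 (_ : (0 + 2 * t) / 2 = t); last by field.
  rewrite exprS invfM mulrCA; set M := _ / 2 ^+ n.
  rewrite !ler_norml => /andP[? ?] /andP[? ?]; apply/andP; split; lra.
have t01' : 0 <= 2 * t - 1 <= 1 by lra.
have := IH _ t01'; have := pK (2 * t - 1) 1 t01' i1.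
rewrite p1 (_ : (2 * t - 1 + 1) / 2 = t); last by field.
rewrite exprS invfM mulrCA; set M := _ / 2 ^+ n.
rewrite !ler_norml => /andP[? ?] /andP[? ?]; apply/andP; split; lra.
Qed.

(** * Second differences and approximation by affine functions *)

Section second_differences.
Context (R : realType) (V : finType).
Hypothesis V2 : (1 < #|V|)%N.
Local Notation simplex := (@simplex R V).
Implicit Types (f : config V R -> R) (e : config V R) (x y z : V) (g : (V -> R) -> R).

Definition direction e1 e2 : V -> R := fun z => coord e2 z - coord e1 z.

Definition second_diff f e1 e2 e3 e4 : R := f e4 - f e3 - f e2 + f e1.

Definition parallelogram e1 e2 e3 e4 :=
  [/\ simplex e1, simplex e2, simplex e3, simplex e4 &
      direction e3 e4 = direction e1 e2].

(** A sum of the two values and not their geometric mean, so that the bound is linear in g and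
    passes through expectations. *)
Definition second_diff_le g f := forall e1 e2 e3 e4, parallelogram e1 e2 e3 e4 ->
  `|second_diff f e1 e2 e3 e4| <= g (direction e1 e2) + g (direction e1 e3).

Definition vertex x : config V R := config_of (fun z => (z == x)%:R).

Lemma simplex_vertex x : simplex (vertex x).
Proof.
split=> [z|]; first by rewrite coord_config_of; case: (z == x).
under eq_bigr do rewrite coord_config_of.
by rewrite (bigD1 x)//= eqxx big1 ?addr0// => z /negbTE ->.
Qed.

Lemma sum_direction e1 e2 : simplex e1 -> simplex e2 -> \sum_z direction e1 e2 z = 0.
Proof. by move=> [_ s1] [_ s2]; rewrite sumrB s1 s2 subrr. Qed.

Lemma norm_direction_le1 e1 e2 z : simplex e1 -> simplex e2 -> `|direction e1 e2 z| <= 1.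
Proof.
move=> S1 S2; have [p1 _] := S1; have [p2 _] := S2.
have := coord_le1 z S1; have := coord_le1 z S2; have := p1 z; have := p2 z.
rewrite ler_norml /direction; lra.
Qed.

Section affine_approx.
Variables (f : config V R -> R) (K : R).
Hypothesis bf : bounded_on simplex f.
Hypothesis fK : forall e1 e2 e3 e4, parallelogram e1 e2 e3 e4 ->
  `|second_diff f e1 e2 e3 e4| <= K.

Definition edge_point (o x : V) (t : R) : config V R :=
  config_of (fun z => (z == o)%:R + t * ((z == x)%:R - (z == o)%:R)).

Lemma sum_delta (a : V -> R) x : \sum_z a z * (z == x)%:R = a x.
Proof. by rewrite (bigD1 x)//= eqxx mulr1 big1 ?addr0// => z /negbTE ->; rewrite mulr0. Qed.

Lemma sum1_delta x : \sum_z (z == x)%:R = 1 :> R.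
Proof. by rewrite -[RHS](sum_delta (fun=> 1) x); apply: eq_bigr => z _; rewrite mul1r. Qed.

Lemma simplex_edge_point o x t : 0 <= t <= 1 -> simplex (edge_point o x t).
Proof.
move=> /andP[t0 t1]; split=> [z|]; rewrite ?coord_config_of.
  by case: (z == o); case: (z == x) => /=; lra.
under eq_bigr do rewrite coord_config_of.
by rewrite big_split/= -mulr_sumr sumrB !sum1_delta subrr mulr0 addr0.
Qed.

Lemma edge_approx o x t : 0 <= t <= 1 ->
  `|f (edge_point o x t) - (f (vertex o) + t * (f (vertex x) - f (vertex o)))| <= K.
Proof.
move=> t01; have e0 : edge_point o x 0 = vertex o.
  by apply: config_ext => z; rewrite !coord_config_of mul0r addr0.
have e1 : edge_point o x 1 = vertex x.
  by apply: config_ext => z; rewrite !coord_config_of mul1r addrC subrK.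
rewrite -e0 -e1; have [_ [B fB]] := bf.
apply: (@chord_approx _ (fun t => f (edge_point o x t)) K B) => //.
  by move=> s s01; apply: fB; exact: simplex_edge_point.
move=> u v u01 v01; have m01 : 0 <= (u + v) / 2 <= 1.
  by move: u01 v01 => /andP[? ?] /andP[? ?]; apply/andP; split; lra.
(* A parallelogram flattened onto the edge, with both middle corners at the midpoint; its second
   difference is the midpoint defect of [chord_approx]. *)
have := fK (e1 := edge_point o x u) (e2 := edge_point o x ((u + v) / 2))
  (e3 := edge_point o x ((u + v) / 2)) (e4 := edge_point o x v).
rewrite /second_diff (_ : _ - _ - _ + _ = f (edge_point o x u) + f (edge_point o x v) -
  2 * f (edge_point o x ((u + v) / 2))); last by ring.
apply; split; [exact: simplex_edge_point..|].
by apply/funext => z; rewrite /direction !coord_config_of; field.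
Qed.

Definition partial_point (o : V) e (r : seq V) : config V R :=
  config_of (fun z => (z == o)%:R + \sum_(x <- r) coord e x * ((z == x)%:R - (z == o)%:R)).

Lemma simplex_partial_point o e r : simplex e -> uniq r -> simplex (partial_point o e r).
Proof.
move=> [e0 e1] ur; split=> [z|]; rewrite ?coord_config_of.
  have s0 : 0 <= \sum_(x <- r) coord e x * (z == x)%:R.
    by apply: sumr_ge0 => x _; rewrite mulr_ge0//; case: (_ == _).
  have s1 : \sum_(x <- r) coord e x <= 1.
    rewrite -e1 big_uniq// [leRHS](bigID (mem r))/= lerDl; exact: sumr_ge0.
  under eq_bigr do rewrite mulrBr.
  rewrite sumrB -mulr_suml; case: (z == o) => /=; lra.
under eq_bigr do rewrite coord_config_of.
rewrite big_split/= sum1_delta exchange_big/= big1 ?addr0// => x _.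
by rewrite -mulr_sumr sumrB !sum1_delta subrr mulr0.
Qed.

(* [partial_point] moves the mass from [o] to one vertex at a time; second
   differences compare each move with the same move started at the vertex [o]. *)
Lemma affine_approx e : simplex e ->
  `|f e - \sum_x coord e x * f (vertex x)| <= (2 * K) *+ #|V|.
Proof.
move=> Se; have [e0 e1] := Se; have [ o _] := card_gt0P (ltnW V2).
have K0 : 0 <= K.
  have So := simplex_vertex o.
  by apply: le_trans (normr_ge0 _) (fK (e1 := vertex o) (e2 := vertex o) (e3 := vertex o) (e4 := vertex o) (And5 So So So So erefl)).
suff it : forall r, uniq r -> `|f (partial_point o e r) - (f (vertex o) +
    \sum_(x <- r) coord e x * (f (vertex x) - f (vertex o)))| <= (2 * K) *+ size r.
  have := it (enum V) (enum_uniq V); rewrite -cardE.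
  have -> : partial_point o e (enum V) = e.
    apply: config_ext => z; rewrite coord_config_of big_enum/=.
    under eq_bigr do rewrite mulrBr; rewrite sumrB -mulr_suml e1.
    by under eq_bigr do rewrite eq_sym; rewrite sum_delta mul1r addrC subrK.
  rewrite big_enum/=; under [X in f _ - (_ + X)]eq_bigr do rewrite mulrBr.
  by rewrite sumrB -mulr_suml e1 mul1r [f (vertex o) + _]addrC subrK.
elim=> [_|x r IH /=/andP[xr ur]].
  rewrite big_nil addr0 mulr0n (_ : partial_point o e [::] = vertex o) ?subrr ?normr0//.
  by apply: config_ext => z; rewrite !coord_config_of big_nil addr0.
have x01 : 0 <= coord e x <= 1 by rewrite e0 coord_le1.
(* Each vertex costs 2 K: one K for comparing the move with the same move from the vertex o, one for
   the edge itself. *)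
have := edge_approx o x x01.
have := fK (e1 := vertex o) (e2 := edge_point o x (coord e x))
  (e3 := partial_point o e r) (e4 := partial_point o e (x :: r)).
have := IH ur; rewrite big_cons mulrSr /second_diff => h1 h2 h3.
have pl : parallelogram (vertex o) (edge_point o x (coord e x))
    (partial_point o e r) (partial_point o e (x :: r)).
  split; [exact: simplex_vertex|exact: simplex_edge_point|exact: simplex_partial_point| |].
    by apply: simplex_partial_point => //=; rewrite xr.
  by apply/funext => z; rewrite /direction !coord_config_of big_cons; ring.
move: h1 h3 (h2 pl); rewrite !ler_norml => /andP[? ?] /andP[? ?] /andP[? ?]; apply/andP; split; lra.
Qed.

End affine_approx.
End second_differences.

HB.lock Definition nrm d (T : measurableType d) (R : realType) (P : probability T R)
  (f : T -> R) : R := Num.sqrt (\int[P]_x (f x ^+ 2)).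

(** * The L2 norm of bounded functions *)

Section quadratic_norm.
Context d (T : measurableType d) (R : realType) (P : probability T R).
Variable S : set T.
Hypotheses (mS : measurable S) (PS : P S = 1%E).
Implicit Types f g h : T -> R.

Local Notation nrm := (@nrm d T R P).

Lemma expectation_sqr_ge0 f : 0 <= \int[P]_x (f x ^+ 2).
Proof. by apply: Rintegral_ge0 => x _; exact: sqr_ge0. Qed.

Lemma nrm_ge0 f : 0 <= nrm f. Proof. by rewrite unlock sqrtr_ge0. Qed.

Lemma sqr_nrm f : nrm f ^+ 2 = \int[P]_x (f x ^+ 2).
Proof. by rewrite unlock sqr_sqrtr// expectation_sqr_ge0. Qed.

Lemma expectation_sqrD f g : bounded_on S f -> bounded_on S g ->
  \int[P]_x ((f x + g x) ^+ 2) =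
  \int[P]_x (f x ^+ 2) + 2 * \int[P]_x (f x * g x) + \int[P]_x (g x ^+ 2).
Proof.
move=> bf bg; have bff := bounded_onM bf bf; have bgg := bounded_onM bg bg.
have bfg := bounded_onM bf bg.
transitivity (\int[P]_x (f x * f x + 2 * (f x * g x) + g x * g x)).
  by apply: eq_Rintegral => x _; ring.
rewrite (expectationD mS PS)//; last by apply: bounded_onD => //; exact: bounded_onZ.
rewrite (expectationD mS PS)//; last exact: bounded_onZ.
by rewrite (expectationZ mS PS).
Qed.

Lemma expectation_mul_le f g : bounded_on S f -> bounded_on S g ->
  \int[P]_x (f x * g x) <= nrm f * nrm g.
Proof.
move=> bf bg; apply: le_trans (ler_norm _) _.
rewrite -ler_sqr ?nnegrE ?mulr_ge0 ?nrm_ge0// real_normK ?num_real// exprMn !sqr_nrm.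
apply: discriminant_le; first exact: expectation_sqr_ge0.
move=> t; have btg := bounded_onZ t bg.
have := expectation_sqr_ge0 (fun x => f x + t * g x).
rewrite (expectation_sqrD bf btg).
have -> : \int[P]_x (f x * (t * g x)) = t * \int[P]_x (f x * g x).
  rewrite -(expectationZ mS PS); last exact: bounded_onM.
  by apply: eq_Rintegral => x _; ring.
have -> : \int[P]_x ((t * g x) ^+ 2) = t ^+ 2 * \int[P]_x (g x ^+ 2).
  rewrite -(expectationZ mS PS); last exact: bounded_onM.
  by apply: eq_Rintegral => x _; ring.
by rewrite mulrA.
Qed.

Lemma nrmD f g : bounded_on S f -> bounded_on S g ->
  nrm (fun x => f x + g x) <= nrm f + nrm g.
Proof.
move=> bf bg; rewrite -ler_sqr ?nnegrE ?addr_ge0 ?nrm_ge0// sqr_nrm expectation_sqrD//.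
by have := expectation_mul_le bf bg; rewrite -!sqr_nrm; lra.
Qed.

Lemma nrmN f : nrm (fun x => - f x) = nrm f.
Proof. by rewrite unlock; congr Num.sqrt; apply: eq_Rintegral => x _; rewrite sqrrN. Qed.

Lemma nrmZ k f : bounded_on S f -> nrm (fun x => k * f x) = `|k| * nrm f.
Proof.
move=> bf; rewrite unlock -sqrtr_sqr -sqrtrM ?sqr_ge0// -(expectationZ mS PS).
  by congr Num.sqrt; apply: eq_Rintegral => x _; rewrite exprMn.
exact: bounded_onM.
Qed.

Lemma nrm_le f K : bounded_on S f -> 0 <= K -> (forall x, S x -> `|f x| <= K) -> nrm f <= K.
Proof.
move=> bf K0 fK; rewrite -ler_sqr ?nnegrE ?nrm_ge0// sqr_nrm -[leRHS](expectation_cst P).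
apply: (expectation_le mS PS); [exact: bounded_onM|exact: bounded_on_cst|].
by move=> x Sx; rewrite -(real_normK (num_real (f x))) ler_sqr ?nnegrE ?fK.
Qed.

Lemma expectation_sqr_center f : bounded_on S f ->
  \int[P]_x ((f x - \int[P]_y f y) ^+ 2) = \int[P]_x (f x ^+ 2) - (\int[P]_y f y) ^+ 2.
Proof.
move=> bf; set m := \int[P]_y f y.
rewrite (expectation_sqrD bf (bounded_on_cst S (- m))) expectation_cst.
have -> : \int[P]_x (f x * - m) = - m * m.
  rewrite -[X in _ = _ * X]/(\int[P]_y f y) -(expectationZ mS PS)//.
  by apply: eq_Rintegral => x _; rewrite mulrC.
have ar (u v : R) : u + 2 * (- v * v) + (- v) ^+ 2 = u - v ^+ 2 by ring.
exact: ar.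
Qed.

Lemma nrm_center f : bounded_on S f -> nrm (fun x => f x - \int[P]_y f y) <= nrm f.
Proof.
move=> bf; rewrite -ler_sqr ?nnegrE ?nrm_ge0// !sqr_nrm expectation_sqr_center//.
by rewrite lerBlDr lerDl sqr_ge0.
Qed.

Lemma nrm_eq f g : bounded_on S f -> bounded_on S g -> (forall x, S x -> f x = g x) ->
  nrm f = nrm g.
Proof.
move=> bf bg fg; rewrite unlock; congr Num.sqrt; apply: (expectation_eq mS PS).
- exact: bounded_onM.
- exact: bounded_onM.
- by move=> x Sx; rewrite fg.
Qed.

End quadratic_norm.

(* The ratios are nondecreasing, so a first ratio above [r] would make [s]
   outgrow [r ^+ n]. *)
Lemma log_convex_ratio (R : realType) (s : nat -> R) (K r : R) :
  (forall n, 0 <= s n) -> (forall n, s n.+1 ^+ 2 <= s n * s n.+2) ->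
  0 < r -> (forall n, s n <= K * r ^+ n) -> s 1%N <= r * s 0%N.
Proof.
move=> s0 sc r0 sK; rewrite leNgt; apply/negP => s1.
have s0_gt0 : 0 < s 0%N.
  rewrite lt_neqAle s0 andbT; apply/eqP => e.
  have := sc 0%N; rewrite -e mul0r => h.
  by move: s1; rewrite -e mulr0 => s1; have := exprn_gt0 2 s1; rewrite ltNge h.
pose q := s 1%N / s 0%N.
have rq : r < q by rewrite ltr_pdivlMr.
have q0 : 0 < q := lt_trans r0 rq.
have it n : 0 < s n /\ q * s n <= s n.+1.
  elim: n => [|n [sn0 sn1]]; first by split=> //; rewrite divfK ?gt_eqF.
  have sn1_gt0 : 0 < s n.+1 by rewrite (lt_le_trans _ sn1)// mulr_gt0.
  split=> //; rewrite -(ler_pM2l sn0); apply: le_trans (sc n).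
  by rewrite mulrA [s n * q]mulrC expr2 ler_wpM2r// ltW.
have itq n : q ^+ n * s 0%N <= s n.
  elim: n => [|n IH]; first by rewrite mul1r.
  by have [_] := it n; apply: le_trans; rewrite exprS -mulrA ler_wpM2l// ltW.
pose u := q / r - 1.
have u0 : 0 < u by rewrite subr_gt0 ltr_pdivlMr// mul1r.
(* Bernoulli's inequality makes the powers of q / r unbounded, against the bound K / s 0. *)
have bern n : 1 + n%:R * u <= (q / r) ^+ n.
  elim: n => [|n IH]; first by rewrite mul0r addr0.
  rewrite exprS (_ : q / r = 1 + u); last by rewrite /u addrC subrK.
  rewrite (_ : q / r = 1 + u) in IH; last by rewrite /u addrC subrK.
  apply: (@le_trans _ _ ((1 + u) * (1 + n%:R * u))); last by rewrite ler_wpM2l// addr_ge0// ltW.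
  have : 0 <= n%:R * u * u by apply: mulr_ge0 (ltW u0); apply: mulr_ge0 (ltW u0).
  by rewrite -natr1; nra.
have bd n : n%:R * u <= K / s 0%N.
  apply: (@le_trans _ _ ((q / r) ^+ n)); first by have := bern n; lra.
  rewrite ler_pdivlMr// expr_div_n mulrAC ler_pdivrMr ?exprn_gt0//.
  exact: le_trans (itq n) (sK n).
have := bd (Num.trunc (K / s 0%N / u)).+1; apply/negP; rewrite -ltNge -ltr_pdivrMr//.
exact: truncnS_gt.
Qed.

(** * The Markov operator I + eps L *)

Section markov_operator.
Context (R : realType) (V : finType).
Variables (c : V -> V -> R) (alpha : V -> R) (kappa : R).
Hypothesis c_ge0 : forall x y, 0 <= c x y.
Hypotheses (kappa_gt0 : 0 < kappa) (kappa_lt : forall x, kappa < alpha x).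
Local Notation Q := (exchange_law alpha kappa).
Local Notation simplex := (@simplex R V).
Local Notation L := (IEM_generator c alpha kappa).
Local Notation lt_rank x y := (enum_rank x < enum_rank y)%N.
Implicit Types (f : config V R -> R) (e : config V R) (x y z : V) (g : (V -> R) -> R).

Let mQ := @measurable_unit_square R.
Let Q1 x y := exchange_law_full kappa_gt0 kappa_lt x y.

Variable eps : R.
Hypothesis eps_ge0 : 0 <= eps.
Hypothesis eps_le : eps * (2 * total_rate c) <= 1.

Let C_ge0 : 0 <= total_rate c := total_rate_ge0 c_ge0.

Let eps_le1 : eps * total_rate c <= 1.
Proof. have := mulr_ge0 eps_ge0 C_ge0; move: eps_le; lra. Qed.

(** Under the bound on eps this is a lazy chain: an exchange along {x, y} has weight eps c_xy, and
    holding has weight at least 1/2. *)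
Definition markov f e : R := f e + eps * L f e.

Lemma bounded_exchange_section f e x y : x != y -> bounded_on simplex f -> simplex e ->
  bounded_on (@unit_square R) (fun p => f (exchanged x y (e, p))).
Proof. by move=> xy bf Se; exact: (bounded_on_section Se (bounded_joint_exchanged xy bf)). Qed.

Lemma markovE f e : bounded_on simplex f -> simplex e ->
  markov f e = (1 - eps * total_rate c) * f e +
    eps * \sum_x \sum_(y | lt_rank x y) c x y * \int[Q x y]_p f (exchanged x y (e, p)).
Proof.
move=> bf Se; rewrite /markov.
suff -> : L f e = \sum_x \sum_(y | lt_rank x y)
    c x y * \int[Q x y]_p f (exchanged x y (e, p)) - total_rate c * f e by ring.
rewrite /total_rate mulr_suml -sumrB; apply: eq_bigr => x _.
rewrite mulr_suml -sumrB; apply: eq_bigr => y /rank_lt_neq xy.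
rewrite -mulrBr; congr (_ * _).
have bfe := bounded_exchange_section xy bf Se.
have := expectationB mQ (Q1 x y) bfe (bounded_on_cst _ (f e)).
by rewrite expectation_cst.
Qed.

Lemma bounded_on_markov f : bounded_on simplex f -> bounded_on simplex (markov f).
Proof.
move=> bf; apply: bounded_onD => //; apply: bounded_onZ.
exact: bounded_on_generator.
Qed.

Lemma bounded_on_markov_iter n f : bounded_on simplex f -> bounded_on simplex (iter n markov f).
Proof. by move=> bf; elim: n => //= n; exact: bounded_on_markov. Qed.

Lemma markovB f h e : bounded_on simplex f -> bounded_on simplex h -> simplex e ->
  markov (fun e => f e - h e) e = markov f e - markov h e.
Proof.
move=> bf bh Se; rewrite !markovE//; last exact: bounded_onB.
suff -> : \sum_x \sum_(y | lt_rank x y) c x y *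
    \int[Q x y]_p (f (exchanged x y (e, p)) - h (exchanged x y (e, p))) =
    \sum_x \sum_(y | lt_rank x y) c x y * \int[Q x y]_p f (exchanged x y (e, p)) -
    \sum_x \sum_(y | lt_rank x y) c x y * \int[Q x y]_p h (exchanged x y (e, p)) by ring.
rewrite -sumrB; apply: eq_bigr => x _; rewrite -sumrB; apply: eq_bigr => y /rank_lt_neq xy.
by rewrite -mulrBr (expectationB mQ (Q1 x y)) //; exact: bounded_exchange_section.
Qed.

Lemma direction_exchanged e1 e2 x y p : x != y ->
  direction (exchanged x y (e1, p)) (exchanged x y (e2, p)) =
  dir_move (direction e1 e2) x y p.
Proof.
move=> xy; apply/funext => z.
rewrite /direction /exchanged !(exchange_move xy) !coord_config_move /dir_move/=; ring.
Qed.

(** The same Beta variables are used at all four corners; the image is again a parallelogram, with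
    sides moved by [dir_move]. The second difference can then be bounded under the expectation. *)
Lemma second_diff_markov t g f : bounded_on simplex f -> sos alpha t g ->
  second_diff_le g f -> second_diff_le (sos_step alpha kappa c eps g) (markov f).
Proof.
move=> bf sg gf e1 e2 e3 e4 pl; have [S1 S2 S3 S4 e12] := pl.
rewrite /second_diff !markovE//.
pose I e x y := \int[Q x y]_p f (exchanged x y (e, p)).
rewrite -/(I e4 _ _).
have -> : forall a4 a3 a2 a1 b4 b3 b2 b1 : R,
  ((1 - eps * total_rate c) * a4 + eps * b4) - ((1 - eps * total_rate c) * a3 + eps * b3)
  - ((1 - eps * total_rate c) * a2 + eps * b2) + ((1 - eps * total_rate c) * a1 + eps * b1) =
  (1 - eps * total_rate c) * (a4 - a3 - a2 + a1) + eps * (b4 - b3 - b2 + b1) by move=> *; ring.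
rewrite -!sumrB -big_split/=.
under eq_bigr do rewrite -!sumrB -big_split/=.
rewrite /sos_step.
have -> : forall a2 a1 b2 b1 : R,
  ((1 - eps * total_rate c) * a2 + eps * b2) + ((1 - eps * total_rate c) * a1 + eps * b1) =
  (1 - eps * total_rate c) * (a2 + a1) + eps * (b2 + b1) by move=> *; ring.
rewrite (le_trans (ler_normD _ _))// lerD// normrM.
  by rewrite ger0_norm ?subr_ge0// ler_wpM2l ?subr_ge0//; exact: gf.
rewrite ger0_norm// ler_wpM2l// (le_trans (ler_norm_sum _ _ _))//.
rewrite -big_split/= ler_sum// => x _.
rewrite (le_trans (ler_norm_sum _ _ _))// -big_split/= ler_sum// => y /rank_lt_neq xy.
have b e : simplex e -> bounded_on (@unit_square R) (fun p => f (exchanged x y (e, p))).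
  exact: bounded_exchange_section.
have b4 := b _ S4; have b3 := b _ S3; have b2 := b _ S2; have b1 := b _ S1.
rewrite -!mulrBr -!mulrDr normrM ger0_norm// ler_wpM2l//.
have b43 := bounded_onB b4 b3; have b432 := bounded_onB b43 b2.
have bb := bounded_onD b432 b1.
rewrite -(expectationB mQ (Q1 x y) b4 b3) -(expectationB mQ (Q1 x y) b43 b2).
rewrite -(expectationD mQ (Q1 x y) b432 b1).
have bs D' := bounded_sos_move D' x y sg.
rewrite -(expectationD mQ (Q1 x y) (bs _) (bs _)).
apply: le_trans (expectation_norm mQ (Q1 x y) bb) _.
apply: (expectation_le mQ (Q1 x y)); first exact: bounded_on_norm.
  exact: bounded_onD.
move=> p Sp; rewrite -!(direction_exchanged _ _ _ xy).
apply: gf; split; [exact: exchanged_simplex..|].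
by rewrite !(direction_exchanged _ _ _ xy) e12.
Qed.

End markov_operator.

(** * The spectral inequality for regular functions *)

Section spectral_class.
Context (R : realType) (V : finType).
Hypothesis V2 : (1 < #|V|)%N.
Variables (c : V -> V -> R) (alpha : V -> R) (kappa : R).
Hypothesis c_ge0 : forall x y, 0 <= c x y.
Hypotheses (kappa_gt0 : 0 < kappa) (kappa_lt : forall x, kappa < alpha x).
Local Notation D := (dirichlet alpha).
Local Notation Q := (exchange_law alpha kappa).
Local Notation simplex := (@simplex R V).
Local Notation L := (IEM_generator c alpha kappa).
Local Notation lt_rank x y := (enum_rank x < enum_rank y)%N.
Local Notation N := (nrm D).
Implicit Types (f h : config V R -> R) (e : config V R) (x y z : V) (g : (V -> R) -> R).

Let mS : measurable simplex := @measurable_simplex R V.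
Let D1 : D simplex = 1%E := dirichlet_full V2 alpha.
Let alpha_gt0 z : 0 < alpha z := lt_trans kappa_gt0 (kappa_lt z).

Section fixed_step.
Variable eps : R.
Hypothesis eps_gt0 : 0 < eps.
Hypothesis eps_le : eps * (2 * total_rate c) <= 1.
Local Notation P := (markov c alpha kappa eps).

Let eps_ge0 : 0 <= eps := ltW eps_gt0.
Let C_ge0 : 0 <= total_rate c := total_rate_ge0 c_ge0.

Let bP f : bounded_on simplex f -> bounded_on simplex (P f).
Proof. exact: bounded_on_markov. Qed.

Lemma markov_sym f h : bounded_on simplex f -> bounded_on simplex h ->
  \int[D]_e (h e * P f e) = \int[D]_e (f e * P h e).
Proof.
move=> bf bh; rewrite /markov.
have key f' h' : bounded_on simplex f' -> bounded_on simplex h' ->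
    \int[D]_e (h' e * (f' e + eps * L f' e)) =
    \int[D]_e (h' e * f' e) + eps * \int[D]_e (h' e * L f' e).
  move=> bf' bh'; have bL := bounded_on_generator c kappa_gt0 kappa_lt bf'.
  rewrite -(expectationZ mS D1); last exact: bounded_onM.
  rewrite -(expectationD mS D1); [|exact: bounded_onM|by apply: bounded_onZ; exact: bounded_onM].
  by apply: eq_Rintegral => e _; ring.
have e1 : \int[D]_e (h e * f e) = \int[D]_e (f e * h e).
  by apply: eq_Rintegral => e _; rewrite mulrC.
have e2 := generator_sym V2 c kappa_gt0 kappa_lt bf bh.
rewrite (key f h bf bh) (key h f bh bf) e1.
exact: (f_equal (fun X => _ + eps * X) e2).
Qed.

Lemma markov_form f : bounded_on simplex f ->
  \int[D]_e (f e * P f e) = N f ^+ 2 - eps * form alpha kappa c f.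
Proof.
move=> bf; have bL := bounded_on_generator c kappa_gt0 kappa_lt bf.
rewrite sqr_nrm (form_generator V2 c kappa_gt0 kappa_lt bf) mulrN opprK.
rewrite -(expectationZ mS D1); last exact: bounded_onM.
rewrite -(expectationD mS D1); [|exact: bounded_onM|by apply: bounded_onZ; exact: bounded_onM].
by apply: eq_Rintegral => e _; rewrite /markov; ring.
Qed.

(** The factor 2 in the bound on eps serves here, through [form_le]. Non-negativity of the form is
    what makes Cauchy-Schwarz available for P. *)
Lemma markov_dot_ge0 f : bounded_on simplex f -> 0 <= \int[D]_e (f e * P f e).
Proof.
move=> bf; rewrite markov_form// sqr_nrm subr_ge0.
have := form_le V2 c_ge0 kappa_gt0 kappa_lt (bounded_square_integrable mS D1 bf).
move=> /(ler_wpM2l eps_ge0) /le_trans; apply; rewrite mulrA ler_piMl//.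
exact: expectation_sqr_ge0.
Qed.

Lemma markov_cauchy_schwarz f h : bounded_on simplex f -> bounded_on simplex h ->
  (\int[D]_e (h e * P f e)) ^+ 2 <= \int[D]_e (h e * P h e) * \int[D]_e (f e * P f e).
Proof.
move=> bf bh; apply: discriminant_le; first exact: markov_dot_ge0.
move=> t; have btf := bounded_onZ (- t) bf.
have := markov_dot_ge0 (bounded_onB bh btf).
rewrite (_ : \int[D]_e _ = \int[D]_e (h e * P h e) + 2 * t * \int[D]_e (h e * P f e) +
  t ^+ 2 * \int[D]_e (f e * P f e))//.
have Pt e : simplex e -> P (fun e => - t * f e) e = - t * P f e.
  move=> Se; rewrite !(markovE c kappa_gt0 kappa_lt)//.
  suff -> : \sum_x \sum_(y | lt_rank x y) c x y *
      \int[Q x y]_p (- t * f (exchanged x y (e, p))) =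
      - t * \sum_x \sum_(y | lt_rank x y) c x y * \int[Q x y]_p f (exchanged x y (e, p)).
    by ring.
  rewrite mulr_sumr; apply: eq_bigr => x _; rewrite mulr_sumr; apply: eq_bigr => y /rank_lt_neq xy.
  rewrite [RHS]mulrCA; congr (_ * _).
  rewrite (expectationZ (@measurable_unit_square R) (exchange_law_full kappa_gt0 kappa_lt x y))//.
  exact: bounded_exchange_section.
have bhh := bounded_onM bh (bP bh); have bhf := bounded_onM bh (bP bf).
have bfh := bounded_onM bf (bP bh); have bff := bounded_onM bf (bP bf).
transitivity (\int[D]_e (h e * P h e + t * (h e * P f e) + t * (f e * P h e) +
    t ^+ 2 * (f e * P f e))).
  apply: (expectation_eq mS D1).
  - by apply: bounded_onM; [exact: bounded_onB|apply: bP; exact: bounded_onB].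
  - by apply: bounded_onD; [apply: bounded_onD; [apply: bounded_onD|]|] => //; exact: bounded_onZ.
  - move=> e Se; rewrite (markovB c kappa_gt0 kappa_lt)// Pt//; ring.
have b1 := bounded_onD bhh (bounded_onZ t bhf).
rewrite (expectationD mS D1); [|by apply: bounded_onD => //; exact: bounded_onZ|exact: bounded_onZ].
rewrite (expectationD mS D1 b1); last exact: bounded_onZ.
rewrite (expectationD mS D1 bhh); last exact: bounded_onZ.
rewrite (expectationZ mS D1 t bhf) (expectationZ mS D1 t bfh) (expectationZ mS D1 _ bff).
have ar (a b b' d : R) : b' = b -> a + t * b + t * b' + t ^+ 2 * d = a + 2 * t * b + t ^+ 2 * d.
  by move=> ->; ring.
exact: ar (markov_sym bh bf).
Qed.

(* Self-adjointness turns a bound on the quadratic form along the orbit of [f]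
   into a bound on the norm. *)
Lemma markov_contract r f : 0 <= r -> bounded_on simplex f ->
  \int[D]_e (f e * P f e) <= r * N f ^+ 2 ->
  \int[D]_e (P f e * P (P f) e) <= r * N (P f) ^+ 2 ->
  N (P f) <= r * N f.
Proof.
move=> r0 bf h1 h2; have bPf := bP bf.
have [N0|N0] := eqVneq (N (P f)) 0; first by rewrite N0 mulr_ge0 ?nrm_ge0.
have Np : 0 < N (P f) by rewrite lt_neqAle eq_sym N0 nrm_ge0.
have cs := markov_cauchy_schwarz bf bPf.
have e : \int[D]_e (P f e * P f e) = N (P f) ^+ 2 by rewrite sqr_nrm.
rewrite -ler_sqr ?nnegrE ?mulr_ge0 ?nrm_ge0// exprMn.
rewrite e in cs.
have h3 : (N (P f) ^+ 2) ^+ 2 <= (r * N (P f) ^+ 2) * (r * N f ^+ 2).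
  apply: le_trans cs _; apply: ler_pM => //; exact: markov_dot_ge0.
rewrite -(ler_pM2l (exprn_gt0 2 Np)).
have ar (u v : R) : u ^+ 2 <= (r * u) * (r * v) -> u * u <= u * (r ^+ 2 * v).
  by rewrite (_ : u * (r ^+ 2 * v) = (r * u) * (r * v)) ?expr2//; ring.
exact: ar h3.
Qed.

Lemma nrm_markov_le f : bounded_on simplex f -> N (P f) <= N f.
Proof.
move=> bf; rewrite -[leRHS]mul1r; apply: markov_contract => //.
  rewrite mul1r markov_form// lerBlDr lerDl mulr_ge0 ?form_ge0//.
rewrite mul1r markov_form ?lerBlDr ?lerDl ?mulr_ge0 ?form_ge0//; exact: bP.
Qed.

Lemma mean_markov f : bounded_on simplex f -> \int[D]_e P f e = \int[D]_e f e.
Proof.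
move=> bf; have b1 := bounded_on_cst simplex (1 : R).
have bL := bounded_on_generator c kappa_gt0 kappa_lt bf.
have L1 e : L (fun=> 1) e = 0.
  rewrite /IEM_generator big1// => x _; rewrite big1// => y _.
  rewrite (_ : \int[_]_p _ = 0) ?mulr0//.
  rewrite -[RHS](expectation_cst (Q x y)).
  by apply: eq_Rintegral => p _; rewrite subrr.
have := markov_sym bf b1.
have -> : \int[D]_e (1 * P f e) = \int[D]_e P f e.
  by apply: eq_Rintegral => e _; rewrite mul1r.
by move=> ->; apply: eq_Rintegral => e _; rewrite /markov L1 mulr0 addr0 mulr1.
Qed.

(** [markov_contract] asks for a bound on the form at P f as well; stability of linear functions
    lets the Poincare inequality supply it. *)
Lemma markov_lin l : exists l', P (lin l) = lin l'.
Proof.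
have [l' Ll] : exists l', L (lin l) = lin l'.
  (* On average an exchange sends the fraction kappa / alpha_x of the mass at x to y, and kappa /
     alpha_y of that at y to x. *)
  exists (\sum_x \sum_(y | lt_rank x y) (fun z => c x y * ((l y - l x) *
     (kappa / alpha x * (z == x)%:R - kappa / alpha y * (z == y)%:R)))).
  apply/funext => e; rewrite /lin.
  under [RHS]eq_bigr do rewrite fct_sumE mulr_suml.
  rewrite exchange_big/=; apply: eq_bigr => x _.
  under [RHS]eq_bigr do rewrite fct_sumE mulr_suml.
  rewrite exchange_big/=; apply: eq_bigr => y /rank_lt_neq xy.
  under [RHS]eq_bigr do rewrite -mulrA.
  rewrite -mulr_sumr; congr (_ * _).
  transitivity (\int[Q x y]_p (0 + (1 - p.1) * ((l y - l x) * coord e x) +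
      (1 - p.2) * (- ((l y - l x) * coord e y)))).
    apply: eq_Rintegral => p _.
    by have := lin_exchanged l (e, p) xy; rewrite /exchanged/= /lin => ->; ring.
  rewrite (exchange_linear kappa_gt0 kappa_lt).
  under [RHS]eq_bigr do rewrite -mulrA.
  rewrite -mulr_sumr.
  under [in RHS]eq_bigr do rewrite mulrBl -!mulrA.
  by rewrite sumrB -!mulr_sumr !delta_dot; ring.
exists (fun z => l z + eps * l' z); apply/funext => e.
rewrite /markov Ll /lin mulr_sumr -big_split/=; apply: eq_bigr => z _; ring.
Qed.

Variables (m G : R).
Hypotheses (m01 : 0 <= m <= 1) (G_ge0 : 0 <= G).
Hypothesis hm : forall x y, x != y -> 0 < c x y -> m <= edge_gamma alpha kappa x y.
Hypothesis hG : forall l, G * alpha_var alpha l <=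
  \sum_x \sum_(y | lt_rank x y) c x y * kappa * (l x - l y) ^+ 2.

(** The unknown constant of [linear_moments] multiplies the variance and the energies alike, and
    cancels. *)
Lemma lin_poincare l : \int[D]_e lin l e = 0 -> G * N (lin l) ^+ 2 <= form alpha kappa c (lin l).
Proof.
move=> l0; have [k k0 [ke kv]] := linear_moments V2 kappa_gt0 kappa_lt.
have := kv l; rewrite l0 expr0n subr0 -sqr_nrm => ->.
rewrite mulrCA (le_trans (ler_wpM2l (ltW k0) (hG l)))// mulr_sumr ler_sum// => x _.
rewrite mulr_sumr ler_sum// => y /rank_lt_neq xy.
by rewrite (ke x y l xy); lra.
Qed.

Local Notation rho := (1 - eps * (m * G)).
Hypothesis rho_ge0 : 0 <= rho.

Lemma nrm_markov_lin l : \int[D]_e lin l e = 0 -> N (P (lin l)) <= rho * N (lin l).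
Proof.
have form1 l' : \int[D]_e lin l' e = 0 -> \int[D]_e (lin l' e * P (lin l') e) <= rho * N (lin l') ^+ 2.
  move=> l0; rewrite markov_form ?mulrBl ?mul1r ?lerB//; last exact: bounded_on_lin.
  rewrite -mulrA ler_wpM2l//; apply: le_trans (lin_poincare l0).
  (* The minimum with 1 enters here: linear functions contract by 1 - eps G only, and m <= 1 puts
     this below rho. *)
  have /andP[_ m1] := m01; have p0 : 0 <= G * N (lin l') ^+ 2 by rewrite mulr_ge0 ?sqr_ge0.
  by rewrite -mulrA ler_piMl.
move=> l0; have bl := @bounded_on_lin R V l; have [l' Pl] := markov_lin l.
apply: markov_contract => //; first exact: form1.
by rewrite Pl; apply: form1; rewrite -Pl mean_markov.
Qed.

(** * The orbit of a centred function *)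

Section orbit.
Variables (f : config V R -> R) (t : R) (g : (V -> R) -> R).
Hypotheses (bf : bounded_on simplex f) (f0 : \int[D]_e f e = 0).
Hypotheses (sg : sos alpha t g) (fg : second_diff_le g f).

Local Notation F n := (iter n P f).

Let bF n : bounded_on simplex (F n).
Proof. exact: bounded_on_markov_iter. Qed.

Let F0 n : \int[D]_e F n e = 0.
Proof. by elim: n => [//|n IH]; rewrite -IH; exact: mean_markov (bF n). Qed.

Lemma orbit_second_diff n : exists2 t', t' <= rho ^+ n * t &
  exists2 g', sos alpha t' g' & second_diff_le g' (F n).
Proof.
elim: n => [|n [t' tt' [g' sg' fg']]].
  by exists t; rewrite ?mul1r//; exists g.
case/andP: m01 => m0 m1.
have el : eps * total_rate c <= 1.
  by have := mulr_ge0 eps_ge0 C_ge0; move: eps_le; lra.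
have [t2 st2 t2t] := sos_stepP V2 kappa_gt0 kappa_lt c_ge0 eps_ge0 el m0 hm hG sg'.
exists t2; first by rewrite exprS -mulrA (le_trans t2t)// ler_wpM2l.
eexists; first exact: st2.
exact: (second_diff_markov c_ge0 kappa_gt0 kappa_lt eps_ge0 eps_le (bF n) sg' fg').
Qed.

Lemma orbit_affine : exists2 K, 0 <= K & forall n, exists2 l,
  \int[D]_e lin l e = 0 & N (fun e => lin l e - F n e) <= K * rho ^+ n.
Proof.
pose s := \sum_x (alpha x)^-1.
have s0 : 0 <= s by apply: sumr_ge0 => x _; rewrite invr_ge0 ltW.
have t0 := sos_trace_ge0 V2 kappa_gt0 kappa_lt sg.
(* Each of the two sides of a parallelogram contributes the trace times s by [sos_le];
   [affine_approx] then costs a factor 2 per vertex. *)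
exists ((2 * (2 * (t * s))) *+ #|V|).
  by rewrite mulrn_wge0// !mulr_ge0.
move=> n; have [t' tt' [g' sg' fg']] := orbit_second_diff n.
have sd e1 e2 e3 e4 : parallelogram e1 e2 e3 e4 ->
    `|second_diff (F n) e1 e2 e3 e4| <= 2 * (t' * s).
  move=> pl; have [S1 S2 S3 S4 _] := pl.
  apply: le_trans (fg' _ _ _ _ pl) _; rewrite mulr_natl mulr2n.
  apply: lerD; apply: (sos_le V2 kappa_gt0 kappa_lt) sg'.
  - exact: sum_direction.
  - by move=> x; exact: norm_direction_le1.
  - exact: sum_direction.
  - by move=> x; exact: norm_direction_le1.
pose l0 x := F n (vertex R x).
have ap e : simplex e -> `|lin l0 e - F n e| <= (2 * (2 * (t * s))) *+ #|V| * rho ^+ n.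
  move=> Se; rewrite distrC; have := affine_approx V2 (bF n) sd Se.
  rewrite /lin; under [in X in _ -> X]eq_bigr do rewrite mulrC.
  move=> /le_trans; apply; rewrite [leRHS]mulrnAl lerMn2r; apply/orP; right.
  rewrite (_ : 2 * (2 * (t * s)) * rho ^+ n = 2 * (2 * (rho ^+ n * t * s))); last by ring.
  by rewrite ler_wpM2l// ler_wpM2l// ler_wpM2r.
have bl0 := @bounded_on_lin R V l0; have bd := bounded_onB bl0 (bF n).
pose mn := \int[D]_e lin l0 e.
(* On Omega the total mass is 1, so constants are linear functions and centring stays within
   [lin]. *)
have lE e : simplex e -> lin (fun x => l0 x - mn) e = lin l0 e - mn.
  move=> [_ e1]; rewrite /lin; under eq_bigr do rewrite mulrBl.
  by rewrite sumrB -mulr_sumr e1 mulr1.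
exists (fun x => l0 x - mn).
  rewrite (expectation_eq mS D1 (bounded_on_lin _) (bounded_onB bl0 (bounded_on_cst _ mn)) lE).
  by rewrite (expectationB mS D1 bl0 (bounded_on_cst _ mn)) expectation_cst subrr.
have K0 : 0 <= (2 * (2 * (t * s))) *+ #|V| * rho ^+ n.
  by rewrite mulr_ge0 ?exprn_ge0// mulrn_wge0// !mulr_ge0.
apply: le_trans (nrm_le mS D1 bd K0 ap).
apply: le_trans (nrm_center mS D1 bd).
rewrite le_eqVlt; apply/orP; left; apply/eqP; apply: (nrm_eq mS D1).
- by apply: bounded_onB => //; exact: bounded_on_lin.
- by apply: bounded_onB => //; exact: bounded_on_cst.
- move=> e Se; rewrite lE// (expectationB mS D1 bl0 (bF n)) F0 subr0 -/mn; ring.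
Qed.

(** Comparison with the affine approximant gives N (F n.+1) <= rho N (F n) + 2 K rho^n, whose
    solutions grow like n rho^n; the room between rho and r absorbs the factor n. *)
Lemma orbit_decay r : rho < r -> exists K, forall n, N (F n) <= K * r ^+ n.
Proof.
have ar (a b y y1 K K' p q s : R) : y1 <= a + b -> a <= p * (y + K * q) -> b <= K * q ->
    K * q <= K * s -> p * (K * q) <= K * s -> p * y <= p * (K' * s) ->
    (p * K' + 2 * K) * s <= r * K' * s -> y1 <= K' * (r * s).
  by lra.
move=> rhor; have [K K0 hK] := orbit_affine.
have r0 : 0 < r := le_lt_trans rho_ge0 rhor.
have rr : 0 < r - rho by rewrite subr_gt0.
(* The first term covers n = 0; the second gives rho K' + 2 K <= r K', which closes the
   induction. *)
pose K' := N f + 2 * K / (r - rho).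
have hK' : rho * K' + 2 * K <= r * K'.
  have : 2 * K <= (r - rho) * K'.
    rewrite mulrDr [X in _ + X]mulrC divfK ?gt_eqF// lerDr mulr_ge0 ?nrm_ge0 ?(ltW rr)//.
  lra.
exists K'; elim=> [|n IH].
  by rewrite mulr1 lerDl divr_ge0 ?(ltW rr)// mulr_ge0.
have [l l0 ld] := hK n.
have bl := @bounded_on_lin R V l; have bd := bounded_onB bl (bF n).
have step : N (F n.+1) <= N (P (lin l)) + N (fun e => - P (fun e => lin l e - F n e) e).
  apply: le_trans (nrmD mS D1 (bP bl) (bounded_onN (bP bd))).
  rewrite le_eqVlt; apply/orP; left; apply/eqP; apply: (nrm_eq mS D1) => //.
    by apply: bounded_onD; [exact: bP|apply: bounded_onN; exact: bP].
  by move=> e Se; rewrite (markovB c kappa_gt0 kappa_lt)//= opprB addrC subrK.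
have h1 : N (P (lin l)) <= rho * (N (F n) + K * rho ^+ n).
  apply: le_trans (nrm_markov_lin l0) _; rewrite ler_wpM2l//.
  rewrite addrC; apply: le_trans (lerD ld (lexx _)).
  apply: le_trans (nrmD mS D1 bd (bF n)).
  rewrite le_eqVlt; apply/orP; left; apply/eqP; apply: (nrm_eq mS D1) => //.
    exact: bounded_onD.
  by move=> e Se; rewrite subrK.
have h2 : N (fun e => - P (fun e => lin l e - F n e) e) <= K * rho ^+ n.
  by rewrite nrmN; apply: le_trans (nrm_markov_le bd) ld.
have rho1 : rho <= 1 by rewrite lerBlDr lerDl !mulr_ge0//; case/andP: m01.
have rn : K * rho ^+ n <= K * r ^+ n.
  by rewrite ler_wpM2l// lerXn2r ?nnegrE// ltW.
have h3 : rho * (K * rho ^+ n) <= K * r ^+ n.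
  by apply: le_trans rn; rewrite ler_piMl// mulr_ge0 ?exprn_ge0.
have h4 := ler_wpM2l rho_ge0 IH.
have h5 := ler_wpM2r (exprn_ge0 n (ltW r0)) hK'.
rewrite exprS; exact: ar step h1 h2 rn h3 h4 h5.
Qed.

Lemma orbit_spectral : m * G * N f ^+ 2 <= form alpha kappa c f.
Proof.
suff key r : rho < r -> N f ^+ 2 - eps * form alpha kappa c f <= r * N f ^+ 2.
  rewrite -(ler_pM2l eps_gt0); apply/ler_addgt0Pr => d d0.
  (* After multiplication by N f ^ 2 the excess over rho costs at most d. *)
  pose r := rho + d / (N f ^+ 2 + 1).
  have n1 : 0 < N f ^+ 2 + 1 by rewrite ltr_wpDl ?sqr_ge0.
  have := key r; rewrite ltrDl divr_gt0// => /(_ isT).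
  have : d / (N f ^+ 2 + 1) * N f ^+ 2 <= d.
    by rewrite mulrAC ler_pdivrMr// ler_wpM2l ?(ltW d0)// lerDl.
  rewrite /r mulrDl; lra.
move=> rr; have r0 : 0 < r := le_lt_trans rho_ge0 rr.
have [K hK] := orbit_decay rr.
(* Self-adjointness gives that the squared norm of F (n + 1) is the scalar product of F n and F (n +
   2); Cauchy-Schwarz does the rest. *)
have lc n : (N (F n.+1) ^+ 2) ^+ 2 <= N (F n) ^+ 2 * N (F n.+2) ^+ 2.
  have ar (a b d : R) : 0 <= a -> 0 <= b -> 0 <= d -> a ^+ 2 <= b * d ->
      (a ^+ 2) ^+ 2 <= b ^+ 2 * d ^+ 2.
    by move=> a0 b0 d0 ab; rewrite -exprMn ler_sqr// nnegrE ?sqr_ge0// mulr_ge0.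
  apply: ar; [exact: nrm_ge0..|].
  apply: le_trans (expectation_mul_le mS D1 (bF n) (bF n.+2)).
  rewrite sqr_nrm le_eqVlt; apply/orP; left; apply/eqP.
  transitivity (\int[D]_e (F n.+1 e * P (F n) e)).
    by apply: eq_Rintegral => e _; rewrite expr2.
  exact: (markov_sym (bF n) (bF n.+1)).
have s1 : N (F 1) ^+ 2 <= r ^+ 2 * N (F 0) ^+ 2.
  apply: (@log_convex_ratio _ (fun n => N (F n) ^+ 2) (K ^+ 2)) => //.
  - by move=> n; exact: sqr_ge0.
  - exact: exprn_gt0.
  - move=> n; rewrite -exprM mulnC exprM -exprMn ler_sqr ?nnegrE ?nrm_ge0//.
    exact: le_trans (nrm_ge0 _ _) (hK n).
rewrite -markov_form//; apply: le_trans (expectation_mul_le mS D1 bf (bF 1)) _.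
rewrite mulrC expr2 mulrA ler_wpM2r ?nrm_ge0//.
by rewrite -ler_sqr ?nnegrE ?mulr_ge0 ?nrm_ge0 ?(ltW r0)// exprMn.
Qed.

End orbit.
End fixed_step.
End spectral_class.

(** * An algebra of smooth functions *)

Section smooth_functions.
Context (R : realType) (V : finType).
Local Notation simplex := (@simplex R V).
Implicit Types (f h : config V R -> R) (e : config V R) (x y z : V).

Definition l1_norm (D : V -> R) : R := \sum_z `|D z|.

Lemma l1_norm_ge0 D : 0 <= l1_norm D.
Proof. by apply: sumr_ge0. Qed.

(* A discrete form of C^{1,1} regularity on Omega. *)
Definition smooth f := measurable_fun [set: config V R] f /\ exists2 K, 0 <= K & [/\
  forall e, simplex e -> `|f e| <= K,
  forall e1 e2, simplex e1 -> simplex e2 -> `|f e2 - f e1| <= K * l1_norm (direction e1 e2) &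
  forall e1 e2 e3 e4, parallelogram e1 e2 e3 e4 ->
    `|second_diff f e1 e2 e3 e4| <=
      K * (l1_norm (direction e1 e2) * l1_norm (direction e1 e3))].

Lemma smooth_bounded f : smooth f -> bounded_on simplex f.
Proof. by move=> [mf [K _ [fK _ _]]]; split => //; exists K. Qed.

Lemma smooth_cst k : smooth (fun=> k).
Proof.
split; first exact: measurable_cst.
exists `|k| => //; split=> // [e1 e2 _ _|e1 e2 e3 e4 _].
  by rewrite subrr normr0 mulr_ge0// l1_norm_ge0.
rewrite /second_diff subrr add0r addNr normr0.
by rewrite !mulr_ge0// l1_norm_ge0.
Qed.

Lemma smoothD f h : smooth f -> smooth h -> smooth (fun e => f e + h e).
Proof.
move=> [mf [K K0 [f0 f1 f2]]] [mh [M M0 [h0 h1 h2]]].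
split; first exact: measurable_funD.
exists (K + M); first exact: addr_ge0.
split=> [e Se|e1 e2 S1 S2|e1 e2 e3 e4 pl].
- by rewrite (le_trans (ler_normD _ _))// lerD ?f0 ?h0.
- rewrite (_ : _ - _ = f e2 - f e1 + (h e2 - h e1)); last by ring.
  by rewrite mulrDl (le_trans (ler_normD _ _))// lerD ?f1 ?h1.
- rewrite /second_diff (_ : _ + _ = second_diff f e1 e2 e3 e4 + second_diff h e1 e2 e3 e4).
    by rewrite mulrDl (le_trans (ler_normD _ _))// lerD ?f2 ?h2.
  by rewrite /second_diff; ring.
Qed.

Lemma parallelogram_sym e1 e2 e3 e4 :
  parallelogram e1 e2 e3 e4 -> direction e2 e4 = direction e1 e3.
Proof.
move=> [_ _ _ _ e12]; apply/funext => z; have := congr1 (@^~ z) e12; rewrite /direction.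
lra.
Qed.

(** A discrete Leibniz rule; the constant 4 counts its terms for the second difference. *)
Lemma smoothM f h : smooth f -> smooth h -> smooth (fun e => f e * h e).
Proof.
move=> [mf [K K0 [f0 f1 f2]]] [mh [M M0 [h0 h1 h2]]].
split; first exact: measurable_funM.
have KM := mulr_ge0 K0 M0.
exists (4 * (K * M)); first exact: mulr_ge0.
split=> [e Se|e1 e2 S1 S2|e1 e2 e3 e4 pl].
- apply: (@le_trans _ _ (K * M)); last lra.
  by rewrite normrM ler_pM ?f0 ?h0.
- rewrite (_ : _ - _ = (f e2 - f e1) * h e2 + f e1 * (h e2 - h e1)); last by ring.
  have n0 := l1_norm_ge0 (direction e1 e2).
  have a1 := ler_pM (normr_ge0 _) (normr_ge0 _) (f1 _ _ S1 S2) (h0 _ S2).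
  have a2 := ler_pM (normr_ge0 _) (normr_ge0 _) (f0 _ S1) (h1 _ _ S1 S2).
  rewrite (le_trans (ler_normD _ _))// !normrM (le_trans (lerD a1 a2))//.
  by have := mulr_ge0 KM n0; lra.
- have [S1 S2 S3 S4 e34] := pl; have e24 := parallelogram_sym pl.
  rewrite /second_diff (_ : _ + _ = second_diff f e1 e2 e3 e4 * h e4 +
    (f e3 - f e1) * (h e4 - h e3) + (f e2 - f e1) * (h e4 - h e2) +
    f e1 * second_diff h e1 e2 e3 e4); last by rewrite /second_diff; ring.
  set p := l1_norm (direction e1 e2); set q := l1_norm (direction e1 e3).
  have p0 : 0 <= p := l1_norm_ge0 _; have q0 : 0 <= q := l1_norm_ge0 _.
  have a1 := ler_pM (normr_ge0 _) (normr_ge0 _) (f2 _ _ _ _ pl) (h0 _ S4).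
  have a2 := ler_pM (normr_ge0 _) (normr_ge0 _) (f1 _ _ S1 S3) (h1 _ _ S3 S4).
  have a3 := ler_pM (normr_ge0 _) (normr_ge0 _) (f1 _ _ S1 S2) (h1 _ _ S2 S4).
  have a4 := ler_pM (normr_ge0 _) (normr_ge0 _) (f0 _ S1) (h2 _ _ _ _ pl).
  rewrite e34 -/p -/q in a2; rewrite e24 -/p -/q in a3; rewrite -/p -/q in a1 a4.
  rewrite -!normrM in a1 a2 a3 a4.
  do 3 rewrite (le_trans (ler_normD _ _))// -lerBrDr.
  by have := mulr_ge0 KM (mulr_ge0 p0 q0); lra.
Qed.

Lemma smoothZ k f : smooth f -> smooth (fun e => k * f e).
Proof. exact/smoothM/smooth_cst. Qed.

Lemma smoothX n f : smooth f -> smooth (fun e => f e ^+ n).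
Proof.
move=> sf; elim: n => [|n IH]; first by under eq_fun do rewrite expr0; exact: smooth_cst.
by under eq_fun do rewrite exprS; exact: smoothM.
Qed.

(** The square is needed: the positive part alone has a kink, where its second differences are of
    first order only. The zero set is still a half-line, so it detects a ray. *)
Definition sqr_pos (u : R) : R := Num.max u 0 ^+ 2.

Lemma sqr_pos_second_diff (a p q : R) :
  `|sqr_pos (a + p + q) - sqr_pos (a + p) - sqr_pos (a + q) + sqr_pos a| <= 2 * (`|p| * `|q|).
Proof.
(* Changing the sign of a step amounts to starting from another corner and changing the sign of the
   second difference, so non-negative steps suffice. *)
suff key (u v w : R) : 0 <= v -> 0 <= w ->
    0 <= sqr_pos (u + v + w) - sqr_pos (u + v) - sqr_pos (u + w) + sqr_pos u <= 2 * (v * w).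
  have [p0|p0] := leP 0 p; have [q0|q0] := leP 0 q.
  - by have /andP[h1 h2] := key a p q p0 q0; rewrite ger0_norm// !ger0_norm.
  - have q0' : 0 <= - q by rewrite oppr_ge0 ltW.
    have := key (a + q) p (- q) p0 q0'; rewrite (ger0_norm p0) (ltr0_norm q0).
    have -> : a + q + p + - q = a + p by ring.
    have -> : a + q + - q = a by ring.
    have -> : a + q + p = a + p + q by ring.
    by move=> /andP[h1 h2]; rewrite ler_norml; apply/andP; split; lra.
  - have p0' : 0 <= - p by rewrite oppr_ge0 ltW.
    have := key (a + p) (- p) q p0' q0; rewrite (ger0_norm q0) (ltr0_norm p0).
    have -> : a + p + - p + q = a + q by ring.
    have -> : a + p + - p = a by ring.
    by move=> /andP[h1 h2]; rewrite ler_norml; apply/andP; split; lra.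
  - have p0' : 0 <= - p by rewrite oppr_ge0 ltW.
    have q0' : 0 <= - q by rewrite oppr_ge0 ltW.
    have := key (a + p + q) (- p) (- q) p0' q0'; rewrite (ltr0_norm q0) (ltr0_norm p0).
    have -> : a + p + q + - p + - q = a by ring.
    have -> : a + p + q + - p = a + q by ring.
    have -> : a + p + q + - q = a + p by ring.
    by move=> /andP[h1 h2]; rewrite ler_norml; apply/andP; split; lra.
move=> v0 w0; rewrite /sqr_pos !maxEle.
case: (lerP (u + v + w) 0) => h1; case: (lerP (u + v) 0) => h2;
case: (lerP (u + w) 0) => h3; case: (lerP u 0) => h4; apply/andP; split; nra.
Qed.

Lemma norm_direction_le e1 e2 x : `|direction e1 e2 x| <= l1_norm (direction e1 e2).
Proof. by rewrite /l1_norm (bigD1 x)//= lerDl sumr_ge0. Qed.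

Lemma smooth_sqr_pos x a : smooth (fun e => sqr_pos (coord e x - a)).
Proof.
split.
  apply: measurable_funX; apply: measurable_maxr; last exact: measurable_cst.
  by apply: measurable_funB; [exact: measurable_coord|exact: measurable_cst].
(* M bounds the positive part of the shifted coordinate on Omega. As M >= 1, the constant 2 M^2
   below dominates the bounds M^2, 2 M and 2 of the three conditions. *)
pose M := 1 + `|a|; have M1 : 1 <= M by rewrite lerDl.
have b e : simplex e -> 0 <= Num.max (coord e x - a) 0 <= M.
  move=> Se; rewrite le_max lexx orbT ge_max /M; have := coord_le1 x Se.
  have := ler_norm (- a); rewrite normrN; have := normr_ge0 a => *.
  by apply/andP; split; lra.
have MM : 1 <= M ^+ 2 by rewrite exprn_ege1.
have M2 : M <= M ^+ 2 by rewrite expr2 ler_peMl// (le_trans ler01).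
exists (2 * M ^+ 2); first by rewrite mulr_ge0// sqr_ge0.
split=> [e Se|e1 e2 S1 S2|e1 e2 e3 e4 pl].
- have /andP[m0 m1] := b e Se; rewrite ger0_norm ?sqr_ge0//.
  have : sqr_pos (coord e x - a) <= M ^+ 2 by rewrite ler_sqr ?nnegrE// (le_trans m0).
  by lra.
- have /andP[p0 p1] := b e1 S1; have /andP[q0 q1] := b e2 S2.
  apply: (@le_trans _ _ (2 * M * `|direction e1 e2 x|)); last first.
    apply: ler_pM => //; last exact: norm_direction_le.
      by rewrite mulr_ge0// (le_trans ler01).
    by rewrite ler_pM2l.
  rewrite /sqr_pos subr_sqr normrM mulrC ler_pM//.
    by rewrite ger0_norm ?addr_ge0//; lra.
  rewrite (_ : direction e1 e2 x = coord e2 x - a - (coord e1 x - a)); last first.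
    by rewrite /direction; ring.
  move: (coord e2 x - a) (coord e1 x - a) => u v; rewrite !maxEle.
  by case: (lerP u 0) => h1; case: (lerP v 0) => h2; rewrite ler_norml;
    have := ler_norm (u - v); have := ler_norm (v - u); rewrite (distrC v u) => *;
    apply/andP; split; lra.
- have [S1 S2 S3 S4 e12] := pl; have e24 := parallelogram_sym pl.
  have := sqr_pos_second_diff (coord e1 x - a) (direction e1 e2 x) (direction e1 e3 x).
  have d4 : direction e1 e3 x = coord e4 x - coord e2 x by rewrite -e24.
  have -> : coord e1 x - a + direction e1 e2 x + direction e1 e3 x = coord e4 x - a.
    by rewrite d4 /direction; ring.
  have -> : coord e1 x - a + direction e1 e2 x = coord e2 x - a by rewrite /direction; ring.
  have -> : coord e1 x - a + direction e1 e3 x = coord e3 x - a by rewrite /direction; ring.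
  rewrite /second_diff => h.
  rewrite (_ : _ + _ = sqr_pos (coord e4 x - a) - sqr_pos (coord e2 x - a) -
    sqr_pos (coord e3 x - a) + sqr_pos (coord e1 x - a)); last by ring.
  apply: le_trans h _; apply: ler_pM => //.
    by rewrite ler_peMr.
  by apply: ler_pM => //; exact: norm_direction_le.
Qed.

End smooth_functions.

Section smooth_spectral.
Context (R : realType) (V : finType).
Hypothesis V2 : (1 < #|V|)%N.
Variables (c : V -> V -> R) (alpha : V -> R) (kappa : R).
Hypothesis c_ge0 : forall x y, 0 <= c x y.
Hypotheses (kappa_gt0 : 0 < kappa) (kappa_lt : forall x, kappa < alpha x).
Local Notation D := (dirichlet alpha).
Local Notation simplex := (@simplex R V).
Local Notation lt_rank x y := (enum_rank x < enum_rank y)%N.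
Implicit Types (f h : config V R -> R) (e : config V R) (x y z : V).

Let mS : measurable simplex := @measurable_simplex R V.
Let D1 : D simplex = 1%E := dirichlet_full V2 alpha.

(** K p q <= K / 2 (p^2 + q^2), and the square of the l1 norm is at most the number of vertices
    times the sum of squares, which is a sum of squares of coordinate forms. *)
Lemma smooth_second_diff f : smooth f ->
  exists t g, sos alpha t g /\ second_diff_le g f.
Proof.
move=> [_ [K K0 [_ _ fK]]].
pose l z : V -> R := fun w => (w == z)%:R.
have [z0 _] := card_gt0P (ltnW V2).
have K1 : 0 <= K / 2 * #|V|%:R by rewrite mulr_ge0// divr_ge0.
exists (K / 2 * #|V|%:R * \sum_z alpha_var alpha (l z)).
exists (fun d => K / 2 * #|V|%:R * \sum_z dot (l z) d ^+ 2); split.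
  apply: sosZ => //; apply: (@sos_sum _ _ _ _ _ _ _ (fun z d => dot (l z) d ^+ 2)).
    by exists (alpha_var alpha (l z0)), (fun d => dot (l z0) d ^+ 2); exact: sos_square.
  by move=> z _; exact: sos_square.
move=> e1 e2 e3 e4 pl; apply: le_trans (fK _ _ _ _ pl) _.
have dE d : \sum_z dot (l z) d ^+ 2 = \sum_z d z ^+ 2.
  by apply: eq_bigr => z _; rewrite /dot delta_dot.
have cs (d : V -> R) : l1_norm d ^+ 2 <= #|V|%:R * \sum_z d z ^+ 2.
  apply: discriminant_le; first by apply: sumr_ge0 => z _; exact: sqr_ge0.
  move=> t; rewrite /l1_norm (_ : _ + _ = \sum_z (1 + t * `|d z|) ^+ 2).
    by apply: sumr_ge0 => z _; exact: sqr_ge0.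
  transitivity (\sum_(z : V) (1 : R) + 2 * t * \sum_z `|d z| + t ^+ 2 * \sum_z d z ^+ 2).
    by rewrite sumr_const.
  rewrite !mulr_sumr -!big_split/=.
  apply: eq_bigr => z _; rewrite -(real_normK (num_real (d z))); ring.
rewrite !dE; have := cs (direction e1 e2); have := cs (direction e1 e3).
have := sqr_ge0 (l1_norm (direction e1 e2) - l1_norm (direction e1 e3)).
move: (l1_norm _) (l1_norm _) => p q h /(ler_wpM2l K0) h1 /(ler_wpM2l K0) h2.
have := mulr_ge0 K0 h; lra.
Qed.

Lemma form_shift f k : form alpha kappa c (fun e => f e - k) = form alpha kappa c f.
Proof.
apply: eq_bigr => x _; apply: eq_bigr => y _.
suff -> : energy alpha kappa x y (fun e => f e - k) = energy alpha kappa x y f by [].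
by apply: eq_Rintegral => q _; rewrite opprB addrA subrK.
Qed.

Lemma smooth_spectral (m G : R) f : 0 <= m <= 1 -> 0 <= G ->
  (forall x y, x != y -> 0 < c x y -> m <= edge_gamma alpha kappa x y) ->
  (forall l, G * alpha_var alpha l <=
    \sum_x \sum_(y | lt_rank x y) c x y * kappa * (l x - l y) ^+ 2) ->
  smooth f ->
  m * G * (\int[D]_e (f e ^+ 2) - (\int[D]_e f e) ^+ 2) <= form alpha kappa c f.
Proof.
move=> m01 G0 hm hG sf; have bf := smooth_bounded sf.
set k := \int[D]_e f e.
have mG0 : 0 <= m * G by apply: mulr_ge0 => //; case/andP: m01.
have C0 := total_rate_ge0 c_ge0.
(* Small enough for both step conditions, with a 1 added to keep the denominator positive. The
   conclusion does not depend on eps. *)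
pose eps := (2 * total_rate c + m * G + 1)^-1.
have d0 : 0 < 2 * total_rate c + m * G + 1.
  by rewrite ltr_wpDl// addr_ge0// mulr_ge0.
have eps0 : 0 < eps by rewrite invr_gt0.
have eps1 : eps * (2 * total_rate c) <= 1.
  by rewrite mulrC ler_pdivrMr// mul1r -addrA lerDl addr_ge0.
have rho0 : 0 <= 1 - eps * (m * G).
  rewrite subr_ge0 mulrC ler_pdivrMr// mul1r addrAC lerDr addr_ge0// mulr_ge0//.
have sh : smooth (fun e => f e - k) := smoothD sf (smooth_cst _ (- k)).
have [t [g [sg gh]]] := smooth_second_diff sh.
have bk := bounded_on_cst simplex k.
have k0 : \int[D]_e (f e - k) = 0.
  by rewrite (expectationB mS D1 bf bk) expectation_cst subrr.
have := orbit_spectral V2 c_ge0 kappa_gt0 kappa_lt eps0 eps1 m01 G0 hm hG rho0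
  (smooth_bounded sh) k0 sg gh.
by rewrite form_shift sqr_nrm (expectation_sqr_center mS D1 bf).
Qed.

End smooth_spectral.

(** * Density in L2 and the spectral gap *)

Section dominated_small.
Context d (T : measurableType d) (R : realType) (P : probability T R).
Variable S : set T.
Hypotheses (mS : measurable S) (PS : P S = 1%E).

Lemma dominated_small (h : nat -> T -> R) (G : T -> R) :
  (forall n, measurable_fun [set: T] (h n)) -> P.-integrable [set: T] (EFin \o G) ->
  (forall n x, S x -> 0 <= h n x <= G x) ->
  (forall x, S x -> h ^~ x @ \oo --> (0 : R)) ->
  forall e, 0 < e -> exists n, \int[P]_x h n x <= e.
Proof.
move=> mh iG hG h0 e e0.
have [||||_ _] := @dominated_convergence _ _ _ P setT measurableT (fun n => EFin \o h n)
  (EFin \o cst 0) (EFin \o G) _ _ _ iG.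
- by move=> n; exact/measurable_EFinP.
- exact/measurable_EFinP.
- apply: (full_ae mS PS) => x Sx _; apply/cvg_EFin; first by near=> n.
  exact: h0.
- apply: (full_ae mS PS) => x Sx n _; have /andP[p0 p1] := hG n x Sx.
  by rewrite /= lee_fin ger0_norm.
rewrite integral0 => /fine_cvg /cvgrPdist_lt /(_ e e0)[N _ /(_ N (leqnn N))] /= hN.
exists N; rewrite sub0r normrN in hN; apply: le_trans (ltW hN).
exact: ler_norm.
Unshelve. all: by end_near. Qed.

End dominated_small.

(** The sum is the integer part of v, written as a sum of indicators of level sets. *)
Lemma count_levels (R : realType) (K : nat) (v : R) : 0 <= v <= K%:R ->
  `|v - \sum_(k < K) (k.+1%:R <= v)%R%:R| <= 1.
Proof.
elim: K v => [|K IH] v /andP[v0 v1].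
  by rewrite big_ord0 subr0 (_ : v = 0) ?normr0//; apply/eqP; rewrite eq_le v0 v1.
rewrite big_ord_recl; under eq_bigr do rewrite lift0.
have [h|h] := leP 1 v.
  have := IH (v - 1); rewrite subr_ge0 h lerBlDr natr1 v1 => /(_ isT).
  rewrite (_ : \sum_(k < K) _ = \sum_(k < K) (k.+2%:R <= v)%R%:R); last first.
    by apply: eq_bigr => k _; rewrite lerBrDr natr1.
  by rewrite opprD addrA.
rewrite big1 => [|k _]; last by rewrite leNgt (lt_trans h)//= ltr1n.
by rewrite addr0 subr0 ger0_norm// ltW.
Qed.

(** * Density of smooth functions in L2 *)

Section density.
Context (R : realType) (V : finType).
Variable (D : probability (config V R) R).
Local Notation simplex := (@simplex R V).
Hypothesis D1 : D simplex = 1%E.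
Implicit Types (f g h : config V R -> R) (e : config V R) (x y z : V) (A B : set (config V R)).

Let mS : measurable simplex := @measurable_simplex R V.

(** Approximants with values in [0, 1] remain so under complements and unions, and for them
    closeness in L1 gives closeness in L2. *)
Definition smooth_approx A := forall d, 0 < d -> exists g,
  [/\ smooth g, forall e, simplex e -> 0 <= g e <= 1 &
      \int[D]_e `|\1_A e - g e| <= d].

Let bI A : measurable A -> bounded_on simplex (\1_A : _ -> R).
Proof.
move=> mA; split; first exact: measurable_indic.
by exists 1 => e _; rewrite indicE; case: (_ \in _); rewrite ?normr1 ?normr0.
Qed.

Let bIg A g : measurable A -> smooth g -> bounded_on simplex (fun e => `|\1_A e - g e|).
Proof.
by move=> mA sg; apply/bounded_on_norm/bounded_onB; [exact: bI|exact: smooth_bounded].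
Qed.

Lemma smooth_approx_ray x a : smooth_approx [set e | a < coord e x].
Proof.
(* [v] is 1 exactly where the coordinate is at most [a], so its powers decrease
   to the indicator of the complement. *)
pose v e := 1 - ((1 + `|a|) ^+ 2)^-1 * sqr_pos (coord e x - a).
have sv : smooth v.
  apply: (smoothD (smooth_cst _ 1)); under eq_fun do rewrite -mulNr.
  exact/smoothZ/smooth_sqr_pos.
have M0 : 0 < (1 + `|a|) ^+ 2 by rewrite exprn_gt0// ltr_pwDl.
have v01 e : simplex e -> 0 <= v e <= 1.
  move=> Se; rewrite /v subr_ge0 lerBlDr lerDl mulr_ge0 ?invr_ge0 ?(ltW M0) ?sqr_ge0// andbT.
  rewrite mulrC ler_pdivrMr// mul1r ler_sqr ?nnegrE ?addr_ge0//.
    rewrite ge_max addr_ge0// andbT lerD ?coord_le1//.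
    by rewrite -normrN ler_norm.
  by rewrite le_max lexx orbT.
have v1 e : coord e x <= a -> v e = 1.
  by move=> h; rewrite /v /sqr_pos max_r ?subr_le0// expr0n mulr0 subr0.
have vlt e : a < coord e x -> v e < 1.
  move=> h; rewrite /v ltrBlDr ltrDl mulr_gt0 ?invr_gt0//.
  by rewrite exprn_gt0// lt_max subr_gt0 h.
set A := [set e | _].
have mA : measurable A.
  rewrite (_ : A = ((@coord R V)^~ x) @^-1` `]a, +oo[).
    by rewrite -[X in measurable X]setTI; apply: measurable_coord.
  by apply/seteqP; split => e /=; rewrite in_itv/= andbT.
move=> d d0.
have sn n : smooth (fun e => 1 - v e ^+ n).
  apply: (smoothD (smooth_cst _ 1)); under eq_fun do rewrite -mulN1r.
  exact/smoothZ/smoothX.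
have hE n e : simplex e -> `|\1_A e - (1 - v e ^+ n)| = \1_A e * v e ^+ n.
  move=> Se; have /andP[p0 p1] := v01 e Se; rewrite indicE.
  have [h|h] := boolP (e \in A).
    by rewrite mul1r opprB addrC subrK ger0_norm// exprn_ge0.
  rewrite mul0r v1 ?expr1n ?subrr ?normr0//.
  by rewrite leNgt; apply: contra h => h; rewrite inE.
have [||||n hn] := @dominated_small _ _ _ D simplex mS D1
    (fun n e => `|\1_A e - (1 - v e ^+ n)|) (cst 1) _ _ _ _ d d0.
- by move=> n; have [] := bIg mA (sn n).
- exact: (bounded_on_integrable mS D1 (bounded_on_cst simplex 1)).
- move=> n e Se; rewrite hE//; have /andP[p0 p1] := v01 e Se.
  rewrite indicE; case: (_ \in _); rewrite ?mul1r ?mul0r ?lexx ?ler01//.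
  by rewrite exprn_ge0// exprn_ile1.
- move=> e Se; have /andP[p0 p1] := v01 e Se.
  have [h|h] := boolP (e \in A); last first.
    by apply: cvg_near_cst; near=> m; rewrite hE// indicE (negbTE h) mul0r.
  rewrite (_ : (fun m => _) = fun m => v e ^+ m); last first.
    by apply/funext => m; rewrite hE// indicE h mul1r.
  by apply: cvg_expr; rewrite ger0_norm// vlt//; rewrite inE in h.
exists (fun e => 1 - v e ^+ n); split => // e Se.
have /andP[p0 p1] := v01 e Se.
by rewrite subr_ge0 exprn_ile1// lerBlDr lerDl exprn_ge0.
Unshelve. all: by end_near. Qed.

Lemma smooth_approx0 : smooth_approx set0.
Proof.
move=> d d0; exists (fun=> 0); split; first exact: smooth_cst.
  by move=> e _; rewrite lexx ler01.
rewrite (_ : \int[D]_e _ = 0) ?ltW// -[RHS](expectation_cst D).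
by apply: eq_Rintegral => e _; rewrite indic0 subrr normr0.
Qed.

Lemma smooth_approxC A : smooth_approx A -> smooth_approx (~` A).
Proof.
move=> aA d d0; have [g [sg g01 gA]] := aA d d0.
exists (fun e => 1 - g e); split.
- apply: (smoothD (smooth_cst _ 1)); under eq_fun do rewrite -mulN1r.
  exact: smoothZ.
- by move=> e /g01 /andP[p0 p1]; rewrite subr_ge0 p1 lerBlDr lerDl.
rewrite (_ : \int[D]_e _ = \int[D]_e `|\1_A e - g e|)//.
apply: eq_Rintegral => e _; rewrite !indicE in_setC -normrN.
by congr `|_|; case: (_ \in _) => /=; ring.
Qed.

Lemma smooth_approxU A B : measurable A -> measurable B ->
  smooth_approx A -> smooth_approx B -> smooth_approx (A `|` B).
Proof.
move=> mA mB aA aB d d0; have d2 : 0 < d / 2 by rewrite divr_gt0.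
have [f [sf f01 fA]] := aA _ d2; have [g [sg g01 gB]] := aB _ d2.
(* This is 1 - (1 - f)(1 - g), so it stays in [0, 1], and its error is at most the sum of the two
   errors. *)
exists (fun e => f e + g e + -1 * (f e * g e)).
have s : smooth (fun e => f e + g e + -1 * (f e * g e)).
  by apply: smoothD; [exact: smoothD|apply: smoothZ; exact: smoothM].
split => // [e Se|].
  by have /andP[? ?] := f01 e Se; have /andP[? ?] := g01 e Se; apply/andP; split; nra.
apply: (@le_trans _ _ (\int[D]_e (`|\1_A e - f e| + `|\1_B e - g e|))).
  apply: (expectation_le mS D1).
  - by apply: bIg => //; exact: measurableU.
  - by apply: bounded_onD; exact: bIg.
  move=> e Se; have /andP[f0 f1] := f01 e Se; have /andP[g0 g1] := g01 e Se.
  rewrite !indicE in_setU; case: (e \in A); case: (e \in B) => /=.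
  - by rewrite !ger0_norm ?subr_ge0//; nra.
  - by rewrite ger0_norm ?(ger0_norm (x := 1 - f e)) ?sub0r ?normrN ?ger0_norm ?subr_ge0//; nra.
  - by rewrite ger0_norm ?(ger0_norm (x := 1 - g e)) ?sub0r ?normrN ?ger0_norm ?subr_ge0//; nra.
  - by rewrite !sub0r !normrN !ger0_norm//; nra.
rewrite (expectationD mS D1); [|exact: bIg..].
by rewrite (splitr d) lerD.
Qed.

Lemma smooth_approx_bigcup (F : nat -> set (config V R)) :
  (forall n, measurable (F n)) -> (forall n, smooth_approx (F n)) ->
  smooth_approx (\bigcup_n F n).
Proof.
move=> mF aF d d0; set A := \bigcup_n F n.
have d2 : 0 < d / 2 by rewrite divr_gt0.
have mA : measurable A by exact: bigcupT_measurable.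
pose U n := \big[setU/set0]_(i < n) F i.
have mU n : measurable (U n) by exact: bigsetU_measurable.
have aU n : smooth_approx (U n).
  elim: n => [|n IH]; first by rewrite /U big_ord0; exact: smooth_approx0.
  by rewrite /U big_ord_recr; apply: smooth_approxU => //; exact: mU.
have UA n : U n `<=` A.
  by rewrite /U => e; rewrite -bigcup_mkord => -[i _ Fi]; exists i.
have hE n e : `|\1_A e - \1_(U n) e| = \1_(A `\` U n) e :> R.
  rewrite !indicE in_setD; have [h|h] := boolP (e \in U n).
    by rewrite (mem_set (UA n e _)) ?subrr ?normr0 ?andbF//; move: h; rewrite inE.
  by rewrite subr0 andbT ger0_norm.
have [||||n hn] := @dominated_small _ _ _ D simplex mS D1
    (fun n e => `|\1_A e - \1_(U n) e|) (cst 1) _ _ _ _ _ d2.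
- by move=> n; have [] := bounded_on_norm (bounded_onB (bI mA) (bI (mU n))).
- exact: (bounded_on_integrable mS D1 (bounded_on_cst simplex 1)).
- by move=> n e Se; rewrite hE indicE; case: (_ \in _); rewrite ?lexx ?ler01.
- move=> e Se; apply: cvg_near_cst; have [h|h] := boolP (e \in A).
    move: h; rewrite inE => -[k _ Fk]; exists k.+1 => // n /= kn.
    rewrite hE indicE in_setD (_ : e \in U n) ?andbF//.
    by rewrite inE /U -bigcup_mkord; exists k.
  by near=> n; rewrite hE indicE in_setD (negbTE h).
have [g [sg g01 gU]] := aU n _ d2; exists g; split => //.
apply: (@le_trans _ _ (\int[D]_e (`|\1_A e - \1_(U n) e| + `|\1_(U n) e - g e|))).
  apply: (expectation_le mS D1).
  - exact: bIg.
  - by apply: bounded_onD; [apply: bounded_on_norm; apply: bounded_onB; exact: bI|exact: bIg].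
  - by move=> e _; rewrite (le_trans _ (ler_normD _ _))// addrA subrK.
rewrite (expectationD mS D1); [|by apply: bounded_on_norm; apply: bounded_onB; exact: bI|exact: bIg].
by rewrite (splitr d) lerD.
Unshelve. all: by end_near. Qed.

(** The approximable measurable sets form a sigma-algebra. Coordinates generate the sigma-algebra of
    configurations and open rays that of the line, so [smooth_approx_ray] is enough. *)
Lemma smooth_approx_measurable A : measurable A -> smooth_approx A.
Proof.
suff sub : @measurable _ (config V R) `<=` [set A | measurable A /\ smooth_approx A].
  by move=> /sub[].
apply: smallest_sub.
  split=> [|B [mB aB]|F mF].
  - by split; [exact: measurable0|exact: smooth_approx0].
  - rewrite setTD; split; first exact: measurableC.
    exact: smooth_approxC.
  - split; first by apply: bigcupT_measurable => n; have [] := mF n.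
    by apply: smooth_approx_bigcup => n; have [] := mF n.
apply: (big_ind (fun X => X `<=` _)) => [|X Y sX sY|i _ _ [B mB <-]].
- exact: sub0set.
- by rewrite subUset.
rewrite setTI; pose p : config V R -> R := fun e => tnth e i.
pose good := [set B : set R | measurable (p @^-1` B) /\ smooth_approx (p @^-1` B)].
suff sB : (@ocitv R).-sigma.-measurable `<=` good by exact: sB.
rewrite RGenOInfty.measurableE; apply: smallest_sub.
  split=> [|C [mC aC]|F mF].
  - by rewrite /good/= preimage_set0; split; [exact: measurable0|exact: smooth_approx0].
  - rewrite /good/= setTD preimage_setC; split; first exact: measurableC.
    exact: smooth_approxC.
  - rewrite /good/= preimage_bigcup; split; first by apply: bigcupT_measurable => n; have [] := mF n.
    by apply: smooth_approx_bigcup => n; have [] := mF n.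
move=> _ [a ->]; split.
  by rewrite -[X in measurable X]setTI; apply: measurable_tnth.
rewrite (_ : _ @^-1` _ = [set e | a < coord e (enum_val i)]).
  exact: smooth_approx_ray.
by apply/seteqP; split => e /=; rewrite in_itv/= andbT /p /coord enum_valK.
Qed.

Local Notation N := (nrm D).

Definition l2_approx f := forall d, 0 < d ->
  exists2 g, smooth g & N (fun e => f e - g e) <= d.

(** The difference is bounded by 1 on Omega, so its square is below its modulus; hence L1 precision
    d^2 for L2 precision d. *)
Lemma l2_approx_indic A : measurable A -> l2_approx (\1_A : _ -> R).
Proof.
move=> mA d d0; have [g [sg g01 gA]] := smooth_approx_measurable mA (exprn_gt0 2 d0).
exists g => //; rewrite -ler_sqr ?nnegrE ?nrm_ge0 ?(ltW d0)// sqr_nrm.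
have b := bounded_onB (bI mA) (smooth_bounded sg).
apply: le_trans gA; apply: (expectation_le mS D1).
- exact: bounded_onM.
- exact: bounded_on_norm.
move=> e Se; rewrite -(real_normK (num_real (_ - _))) expr2 ler_piMr//.
by have /andP[g0 g1] := g01 e Se; rewrite indicE ler_norml; case: (_ \in _);
  apply/andP; split => /=; lra.
Qed.

Lemma l2_approx_smooth f : smooth f -> l2_approx f.
Proof.
move=> sf d d0; exists f => //; apply: (nrm_le mS D1) (ltW d0) _.
  by apply: bounded_onB; exact: smooth_bounded.
by move=> e _; rewrite subrr normr0 ltW.
Qed.

Lemma l2_approxD f h : bounded_on simplex f -> bounded_on simplex h ->
  l2_approx f -> l2_approx h -> l2_approx (fun e => f e + h e).
Proof.
move=> bf bh af ah d d0; have d2 : 0 < d / 2 by rewrite divr_gt0.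
have [g sg fg] := af _ d2; have [k sk hk] := ah _ d2.
exists (fun e => g e + k e); first exact: smoothD.
have bg := smooth_bounded sg; have bk := smooth_bounded sk.
have bfg := bounded_onB bf bg; have bhk := bounded_onB bh bk.
rewrite (nrm_eq mS D1 (g := fun e => (f e - g e) + (h e - k e))).
- by rewrite (le_trans (nrmD mS D1 bfg bhk))// (splitr d) lerD.
- by apply: bounded_onB; exact: bounded_onD.
- exact: bounded_onD.
- by move=> e _; ring.
Qed.

Lemma l2_approxZ k f : bounded_on simplex f -> l2_approx f -> l2_approx (fun e => k * f e).
Proof.
move=> bf af d d0; have k0 : 0 < `|k| + 1 by rewrite ltr_wpDl.
have [g sg fg] := af _ (divr_gt0 d0 k0).
exists (fun e => k * g e); first exact: smoothZ.
have bfg := bounded_onB bf (smooth_bounded sg).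
rewrite (nrm_eq mS D1 (g := fun e => k * (f e - g e))).
- rewrite (nrmZ mS D1 k bfg); apply: le_trans (ler_wpM2l (normr_ge0 k) fg) _.
  by rewrite mulrA ler_pdivrMr// mulrC ler_wpM2l ?(ltW d0)// lerDl.
- by apply: bounded_onB; apply: bounded_onZ => //; exact: smooth_bounded.
- exact: bounded_onZ.
- by move=> e _; ring.
Qed.

(** A staircase with steps of height 1/n, written as a combination of indicators of superlevel sets,
    is uniformly within 1/n of f on Omega. *)
Lemma l2_approx_bounded f : bounded_on simplex f -> l2_approx f.
Proof.
move=> bf d d0; have [mf [K fK]] := bf; have d2 : 0 < d / 2 by rewrite divr_gt0.
pose n := (Num.trunc (d / 2)^-1).+1.
have n0 : (0 : R) < n%:R by rewrite ltr0n.
have nd : (n%:R)^-1 <= d / 2.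
  by rewrite -[leRHS]invrK lef_pV2 ?posrE ?invr_gt0// ltW// truncnS_gt.
(* On Omega f + K lies in [0, 2 K], so this many levels exhaust n (f + K). *)
pose B := (Num.trunc (2 * K * n%:R)).+1.
pose A (k : 'I_B) := [set e | k.+1%:R <= n%:R * (f e + K)].
have mA k : measurable (A k).
  rewrite (_ : A k = (fun e => n%:R * (f e + K)) @^-1` `[k.+1%:R, +oo[).
    rewrite -[X in measurable X]setTI; apply: measurable_funM => //.
    exact: measurable_funD.
  by apply/seteqP; split => e /=; rewrite in_itv/= andbT.
pose s e : R := \sum_(k < B) \1_(A k) e.
have bs : bounded_on simplex s by apply: bounded_on_sum => k; exact: bI.
have as_ : l2_approx s.
  rewrite /s; elim: (index_enum _) => [|k r IH].
    by under eq_fun do rewrite big_nil; apply: l2_approx_smooth; exact: smooth_cst.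
  under eq_fun do rewrite big_cons; apply: l2_approxD => //; first exact: bI.
    by apply: bounded_on_sum => i; exact: bI.
  exact: l2_approx_indic.
have bk := bounded_on_cst simplex (- K).
have ns := l2_approxD (bounded_onZ n%:R^-1 bs) bk (l2_approxZ n%:R^-1 bs as_)
  (l2_approx_smooth (smooth_cst _ (- K))).
have [g sg hg] := ns _ d2; exists g => //.
have bg := smooth_bounded sg.
have bns := bounded_onD (bounded_onZ n%:R^-1 bs) bk.
have b1 := bounded_onB bf bns; have b2 := bounded_onB bns bg.
rewrite (nrm_eq mS D1 (g := fun e => (f e - (n%:R^-1 * s e + - K)) +
   (n%:R^-1 * s e + - K - g e))).
- rewrite (le_trans (nrmD mS D1 b1 b2))// (splitr d) lerD//.
  apply: le_trans nd; apply: (nrm_le mS D1 b1); first by rewrite invr_ge0 ltW.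
  move=> e Se; have := fK e Se; rewrite ler_norml => /andP[f0 f1].
  have v0 : 0 <= n%:R * (f e + K) <= B%:R.
    rewrite mulr_ge0 ?ler0n//=; last by rewrite -(opprK K) subr_ge0.
    apply: le_trans (ltW (truncnS_gt _)); rewrite mulrC ler_wpM2r ?ler0n//; lra.
  have := count_levels v0.
  have -> : \sum_(k < B) (k.+1%:R <= n%:R * (f e + K))%R%:R = s e.
    apply: eq_bigr => k _; rewrite indicE; congr (nat_of_bool _)%:R.
    by apply/idP/idP; rewrite inE.
  move=> h; rewrite (_ : _ - _ = n%:R^-1 * (n%:R * (f e + K) - s e)); last first.
    by field; rewrite gt_eqF.
  by rewrite normrM ger0_norm ?invr_ge0 ?(ltW n0)// ler_piMr// invr_ge0 ltW.
- exact: bounded_onB.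
- exact: bounded_onD.
- by move=> e _; ring.
Qed.

(** Truncation reduces to bounded functions. Each of the two errors is d / 4 because the square of a
    sum is at most twice the sum of the squares. *)
Lemma smooth_dense f : square_integrable D f -> forall d, 0 < d ->
  exists2 g, smooth g & \int[D]_e ((f e - g e) ^+ 2) <= d.
Proof.
move=> lf d d0; have [mf _] := lf; have d4 : 0 < d / 4 by rewrite divr_gt0.
pose t n e : R := Num.max (Num.min (f e) n%:R) (- n%:R).
have bt n : bounded_on simplex (t n).
  split; first by apply: measurable_maxr => //; exact: measurable_minr.
  exists n%:R => e _; rewrite ler_norml /t le_max lexx orbT/= ge_max ge_min lexx orbT/=.
  by rewrite (le_trans (y := 0)) ?oppr_le0.
have lt n := bounded_square_integrable mS D1 (bt n).
have [||||n hn] := @dominated_small _ _ _ D simplex mS D1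
    (fun n e => (f e - t n e) ^+ 2) (fun e => f e ^+ 2) _ _ _ _ _ d4.
- by move=> n; apply: measurable_funX; apply: measurable_funB => //; have [] := bt n.
- exact: square_integrable_sqr lf.
- move=> n e _; rewrite sqr_ge0/=; have n0 := ler0n R n.
  rewrite /t; move: (n%:R) n0 (f e) => m m0 u.
  have [h1|h1] := leP u m.
    have [h2|h2] := leP u (- m); last by rewrite subrr expr0n sqr_ge0.
    by have := mulr_ge0 m0 m0; nra.
  rewrite max_l; last by rewrite (le_trans (y := 0)) ?oppr_le0.
  have um : 0 <= u - m by rewrite subr_ge0 ltW.
  by have := mulr_ge0 m0 um; nra.
- move=> e _; apply: cvg_near_cst; exists (Num.trunc `|f e|).+1 => // n /= hn.
  have fn : `|f e| <= n%:R by rewrite (le_trans (ltW (truncnS_gt _)))// ler_nat.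
  move: fn; rewrite ler_norml => /andP[f1 f2].
  by rewrite /t min_l// max_l// subrr expr0n.
have d2 : 0 < Num.sqrt (d / 4) by rewrite sqrtr_gt0.
have [g sg tg] := l2_approx_bounded (bt n) d2; exists g => //.
have lg := bounded_square_integrable mS D1 (smooth_bounded sg).
have l1 := square_integrableB lf (lt n); have l2 := square_integrableB (lt n) lg.
have s1 := square_integrable_sqr l1; have s2 := square_integrable_sqr l2.
have i1 : D.-integrable setT (fun q => (2 * (f q - t n q) ^+ 2)%:E).
  by under eq_fun do rewrite EFinM; exact: integrableZl.
have i2 : D.-integrable setT (fun q => (2 * (t n q - g q) ^+ 2)%:E).
  by under eq_fun do rewrite EFinM; exact: integrableZl.
apply: (@le_trans _ _ (\int[D]_q (2 * (f q - t n q) ^+ 2 + 2 * (t n q - g q) ^+ 2))).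
  apply: le_Rintegral => //.
  - exact: square_integrable_sqr (square_integrableB lf lg).
  - by apply: eq_integrable (integrableD measurableT i1 i2).
  - move=> q _; have := sqr_ge0 ((f q - t n q) - (t n q - g q)); nra.
have tg2 : \int[D]_q ((t n q - g q) ^+ 2) <= d / 4.
  rewrite -sqr_nrm -[leRHS]sqr_sqrtr ?(ltW d4)//.
  by rewrite ler_sqr ?nnegrE ?nrm_ge0// ltW.
rewrite RintegralD// !RintegralZl//.
have ar (u v : R) : u <= d / 4 -> v <= d / 4 -> 2 * u + 2 * v <= d by lra.
exact: ar hn tg2.
Qed.

End density.

(** * Membership in L2 and normalisation in terms of squares *)

Section l2_norm.
Context d (T : measurableType d) (R : realType) (P : probability T R).
Implicit Types f : T -> R.

Lemma Lnorm2_sqr f :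
  (Lnorm P 2%:E (fun x => (f x)%:E) `^ 2 = \int[P]_x (f x ^+ 2)%:E)%E.
Proof.
rewrite poweR_Lnorm ?pnatr_eq0//; apply: eq_integral => x _.
rewrite /= -[RHS]/((f x ^+ 2)%:E) powR_mulrn// real_normK ?num_real//.
Qed.

Lemma Lfun2_square_integrable f : f \in Lfun P 2%:E -> square_integrable P f.
Proof.
move=> lf; split; first by have := sub_Lfun_mfun lf; rewrite inE.
have := sub_Lfun_finLfun lf; rewrite inE /= /finite_norm => h.
by rewrite -Lnorm2_sqr poweR_lty.
Qed.

Lemma square_integrable_Lfun2 f : square_integrable P f -> f \in Lfun P 2%:E.
Proof.
move=> [mf f2]; apply/andP; split; first by rewrite inE.
rewrite inE /= /finite_norm ltey; apply/eqP => h.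
by move: f2; rewrite -Lnorm2_sqr h poweRyr ?pnatr_eq0// ltxx.
Qed.

Lemma Lnorm2_eq1 f : Lnorm P 2%:E (fun x => (f x)%:E) = 1%E <->
  (\int[P]_x (f x ^+ 2)%:E = 1)%E.
Proof.
split=> [h|]; first by rewrite -Lnorm2_sqr h poweR1r.
rewrite -Lnorm2_sqr => h.
have : ((Lnorm P 2%:E (fun x => (f x)%:E) `^ 2) `^ 2^-1 = 1)%E by rewrite h poweR1r.
by rewrite -poweRrM divff ?pnatr_eq0// poweRe1// Lnorm_ge0.
Qed.

End l2_norm.

(** Two limits in order: e tends to 0 at fixed d, since the inverse of d multiplies the error, and
    then d tends to 0. *)
Lemma le_perturb (R : realType) (x F K C : R) : 0 <= F -> 0 <= K -> 0 <= C ->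
  (forall d e, 0 < d -> 0 < e ->
    x <= (1 + d) ^+ 2 * F + e * ((1 + d) * (1 + d^-1) * C + (1 + d) * K + (1 + d^-1) * K)) ->
  x <= F.
Proof.
move=> F0 K0 C0 h; apply/ler_addgt0Pr => t t0.
(* Chosen so that d <= 1, whence (1 + d)^2 <= 1 + 3 d, and so that 3 d F <= t. *)
pose d := t / (3 * F + t + 1).
have q0 : 0 < 3 * F + t + 1 by rewrite ltr_wpDl// addr_ge0// ?mulr_ge0// ltW.
have d0 : 0 < d by rewrite divr_gt0.
have d1 : d <= 1 by rewrite ler_pdivrMr// mul1r; lra.
have dF : 3 * d * F <= t.
  rewrite (_ : 3 * d * F = t * (3 * F) / (3 * F + t + 1)); last by rewrite /d; ring.
  rewrite ler_pdivrMr//.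
  by rewrite ler_wpM2l ?ltW//; lra.
have h1 : x <= (1 + d) ^+ 2 * F.
  apply/ler_addgt0Pr => s s0.
  set M := (1 + d) * (1 + d^-1) * C + (1 + d) * K + (1 + d^-1) * K.
  have di : 0 <= d^-1 by rewrite invr_ge0 ltW.
  have M0 : 0 <= M by rewrite !addr_ge0// !mulr_ge0// addr_ge0// ltW.
  have M1 : 0 < M + 1 by rewrite ltr_wpDl.
  have := h d (s / (M + 1)) d0 (divr_gt0 s0 M1); rewrite -/M => /le_trans; apply.
  by rewrite lerD2l mulrAC ler_pdivrMr// ler_wpM2l ?(ltW s0)// lerDl.
apply: le_trans h1 _.
have d1' : 0 <= 1 - d by rewrite subr_ge0.
by have := mulr_ge0 (mulr_ge0 (ltW d0) F0) d1'; nra.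
Qed.

(** * The spectral inequality in L2 *)

Section spectral_gap.
Context (R : realType) (V : finType).
Hypothesis V2 : (1 < #|V|)%N.
Variables (c : V -> V -> R) (alpha : V -> R) (kappa : R).
Hypothesis c_ge0 : forall x y, 0 <= c x y.
Hypotheses (kappa_gt0 : 0 < kappa) (kappa_lt : forall x, kappa < alpha x).
Local Notation D := (dirichlet alpha).
Local Notation simplex := (@simplex R V).
Local Notation lt_rank x y := (enum_rank x < enum_rank y)%N.
Implicit Types (f h : config V R -> R) (e : config V R) (x y z : V) (l : V -> R).

Let mS : measurable simplex := @measurable_simplex R V.
Let D1 : D simplex = 1%E := dirichlet_full V2 alpha.

(** Young's inequality; the weight d keeps the main term with a factor close to 1, at the price of a
    large factor on the small term. *)
Lemma integral_sqrD_le d' (T : measurableType d') (P : probability T R) (u v : T -> R) d :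
  0 < d -> square_integrable P u -> square_integrable P v ->
  \int[P]_q ((u q + v q) ^+ 2) <=
  (1 + d) * \int[P]_q (u q ^+ 2) + (1 + d^-1) * \int[P]_q (v q ^+ 2).
Proof.
move=> d0 lu lv; have s1 := square_integrable_sqr lu; have s2 := square_integrable_sqr lv.
have i1 : P.-integrable setT (fun q => ((1 + d) * u q ^+ 2)%:E).
  by under eq_fun do rewrite EFinM; exact: integrableZl.
have i2 : P.-integrable setT (fun q => ((1 + d^-1) * v q ^+ 2)%:E).
  by under eq_fun do rewrite EFinM; exact: integrableZl.
apply: (@le_trans _ _ (\int[P]_q ((1 + d) * u q ^+ 2 + (1 + d^-1) * v q ^+ 2))).
  apply: le_Rintegral => //.
  - exact: square_integrable_sqr (square_integrableD lu lv).
  - by apply: eq_integrable (integrableD measurableT i1 i2).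
  - move=> q _; rewrite -subr_ge0.
    rewrite (_ : _ - _ = d * (u q - d^-1 * v q) ^+ 2).
      by rewrite mulr_ge0 ?sqr_ge0 ?ltW.
    by field; rewrite gt_eqF.
by rewrite RintegralD// !RintegralZl.
Qed.

Lemma form_add_le f h d : 0 < d -> square_integrable D f -> square_integrable D h ->
  form alpha kappa c (fun e => f e + h e) <=
  (1 + d) * form alpha kappa c f + (1 + d^-1) * form alpha kappa c h.
Proof.
move=> d0 lf lh; rewrite /form !mulr_sumr -big_split/= ler_sum// => x _.
rewrite !mulr_sumr -big_split/= ler_sum// => y /rank_lt_neq xy.
rewrite !(mulrCA _ (c x y)) -mulrDr ler_wpM2l// !mulrA -mulrDl ler_wpM2r//.
have lf1 := square_integrableB (square_integrable_fst kappa x y lf)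
  (square_integrable_exchanged V2 kappa_gt0 kappa_lt xy lf).
have lh1 := square_integrableB (square_integrable_fst kappa x y lh)
  (square_integrable_exchanged V2 kappa_gt0 kappa_lt xy lh).
apply: le_trans (integral_sqrD_le d0 lf1 lh1).
rewrite le_eqVlt; apply/orP; left; apply/eqP; apply: eq_Rintegral => q _.
by rewrite opprD addrACA.
Qed.

Lemma sqr_mean_le f : square_integrable D f ->
  (\int[D]_e f e) ^+ 2 <= \int[D]_e (f e ^+ 2).
Proof.
move=> lf; set k := \int[D]_e f e.
have i1 := square_integrable_integrable lf.
have i2 := square_integrable_sqr lf.
have i3 : D.-integrable setT (fun e => (2 * k * f e)%:E).
  by under eq_fun do rewrite EFinM; exact: integrableZl.
have i4 : D.-integrable setT (fun e => (k ^+ 2)%:E).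
  exact: (bounded_on_integrable mS D1 (bounded_on_cst simplex (k ^+ 2))).
have : 0 <= \int[D]_e (f e ^+ 2 - 2 * k * f e + k ^+ 2).
  apply: Rintegral_ge0 => e _; rewrite (_ : _ + _ = (f e - k) ^+ 2) ?sqr_ge0//; ring.
rewrite RintegralD//; last by apply: eq_integrable (integrableB measurableT i2 i3).
rewrite RintegralB// RintegralZl// expectation_cst -/k.
have ar (u : R) : 0 <= u - 2 * k * k + k ^+ 2 -> k ^+ 2 <= u by nra.
exact: ar.
Qed.

(** Both sides are continuous in L2, the form because L is bounded. The smooth approximants need not
    be centred, but their squared mean is at most the squared distance to f. *)
Lemma l2_spectral (m G : R) f : 0 <= m <= 1 -> 0 <= G ->
  (forall x y, x != y -> 0 < c x y -> m <= edge_gamma alpha kappa x y) ->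
  (forall l, G * alpha_var alpha l <=
    \sum_x \sum_(y | lt_rank x y) c x y * kappa * (l x - l y) ^+ 2) ->
  square_integrable D f -> \int[D]_e f e = 0 ->
  m * G * \int[D]_e (f e ^+ 2) <= form alpha kappa c f.
Proof.
move=> m01 G0 hm hG lf f0.
have mG0 : 0 <= m * G by apply: mulr_ge0 => //; case/andP: m01.
have C0 : 0 <= 2 * total_rate c by rewrite mulr_ge0// total_rate_ge0.
apply: (le_perturb (form_ge0 _ _ c_ge0 _) mG0 C0) => d t d0 t0.
have [g sg hg] := smooth_dense D1 lf t0.
have lg := bounded_square_integrable mS D1 (smooth_bounded sg).
have lfg := square_integrableB lf lg; have lgf := square_integrableB lg lf.
have di : 0 <= d^-1 by rewrite invr_ge0 ltW.
have e1 : \int[D]_e ((g e - f e) ^+ 2) = \int[D]_e ((f e - g e) ^+ 2).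
  by apply: eq_Rintegral => e _; rewrite -sqrrN opprB.
have h1 := integral_sqrD_le d0 lg lfg.
have e2 : \int[D]_e ((g e + (f e - g e)) ^+ 2) = \int[D]_e (f e ^+ 2).
  by apply: eq_Rintegral => e _; rewrite addrC subrK.
rewrite e2 in h1.
have h2 := form_add_le d0 lf lgf.
have e3 : (fun e => f e + (g e - f e)) = g by apply/funext => e; rewrite addrC subrK.
rewrite e3 in h2.
have h3 := form_le V2 c_ge0 kappa_gt0 kappa_lt lgf; rewrite e1 in h3.
have h4 := sqr_mean_le lgf; rewrite e1 in h4.
have e4 : \int[D]_e (g e - f e) = \int[D]_e g e.
  by rewrite RintegralB ?f0 ?subr0//; exact: square_integrable_integrable.
rewrite e4 in h4.
have h5 := smooth_spectral V2 c_ge0 kappa_gt0 kappa_lt m01 G0 hm hG sg.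
have ar (mG A B I k2 Ff Fg Fd C : R) : 0 <= mG -> 0 <= C -> I <= t ->
    A <= (1 + d) * B + (1 + d^-1) * I -> Fg <= (1 + d) * Ff + (1 + d^-1) * Fd ->
    Fd <= C * I -> k2 <= I -> mG * (B - k2) <= Fg ->
    mG * A <= (1 + d) ^+ 2 * Ff + t * ((1 + d) * (1 + d^-1) * C + (1 + d) * mG + (1 + d^-1) * mG).
  move=> K0 {}C0 It a1 a2 a3 a4 a5.
  have p1 : 0 <= 1 + d by rewrite addr_ge0// ltW.
  have p2 : 0 <= 1 + d^-1 by rewrite addr_ge0.
  have b1 := ler_wpM2l K0 a1.
  have b2 := ler_wpM2l p1 (le_trans a5 a2).
  have b3 := ler_wpM2l (mulr_ge0 p1 p2) (le_trans a3 (ler_wpM2l C0 It)).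
  have b4 := ler_wpM2l (mulr_ge0 p1 K0) (le_trans a4 It).
  have b5 := ler_wpM2l (mulr_ge0 p2 K0) It.
  move: (d^-1) b1 b2 b3 b4 b5 => dd b1 b2 b3 b4 b5; lra.
exact: ar mG0 C0 hg h1 h2 h3 h4 h5.
Qed.

End spectral_gap.

(** * The affine gap and the two bounds *)

Section affine_gap.
Context (R : realType) (V : finType).
Hypothesis V2 : (1 < #|V|)%N.
Variables (c : V -> V -> R) (alpha : V -> R) (kappa : R).
Hypothesis c_ge0 : forall x y, 0 <= c x y.
Hypotheses (kappa_gt0 : 0 < kappa) (kappa_lt : forall x, kappa < alpha x).
Local Notation D := (dirichlet alpha).
Local Notation simplex := (@simplex R V).
Local Notation lt_rank x y := (enum_rank x < enum_rank y)%N.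
Local Notation gap1 := (gap1 c alpha kappa).
Local Notation edges l := (\sum_x \sum_(y | lt_rank x y) c x y * kappa * (l x - l y) ^+ 2).
Implicit Types (f : config V R -> R) (e : config V R) (x y z : V) (l : V -> R).

Let mS : measurable simplex := @measurable_simplex R V.
Let D1 : D simplex = 1%E := dirichlet_full V2 alpha.
Let alpha_gt0 z : 0 < alpha z := lt_trans kappa_gt0 (kappa_lt z).

Lemma deg_le1_square_integrable f : deg_le1_poly f -> square_integrable D f.
Proof.
move=> [a [l fE]]; apply: (bounded_square_integrable mS D1).
rewrite (_ : f = fun e => a + lin l e); last exact/funext.
by apply: bounded_onD; [exact: bounded_on_cst|exact: bounded_on_lin].
Qed.

Lemma centered_norm_eq1 f : square_integrable D f ->
  centered_norm alpha f = 1%E <-> \int[D]_e ((f e - mean alpha f) ^+ 2) = 1.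
Proof.
move=> lf; have l1 := square_integrableB lf (square_integrable_cst D (mean alpha f)).
have fi : (\int[D]_e ((f e - mean alpha f) ^+ 2)%:E \is a fin_num)%E.
  exact: integrable_fin_num (square_integrable_sqr l1).
rewrite /centered_norm Lnorm2_eq1; split=> h; first by rewrite /Rintegral h.
by rewrite -(fineK fi); congr EFin.
Qed.

(** The definition of [gap1] tested on [lin l] normalised to unit variance, the constant k
    cancelling. It is stated in the extended reals because finiteness of [gap1] is only then drawn
    from the second conjunct. *)
Lemma gap1_le_edges l : (gap1 * (alpha_var alpha l)%:E <= (edges l)%:E)%E /\
  (0 < alpha_var alpha l -> exists r : R, (gap1 <= r%:E)%E).
Proof.
have [k k0 [ke kv]] := linear_moments V2 kappa_gt0 kappa_lt.
have E0 : 0 <= edges l.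
  by apply: sumr_ge0 => x _; apply: sumr_ge0 => y _; rewrite mulr_ge0 ?sqr_ge0// mulr_ge0 ?(ltW kappa_gt0).
suff key : 0 < alpha_var alpha l -> (gap1 <= (edges l / alpha_var alpha l)%:E)%E.
  split; last by move=> /key; exists (edges l / alpha_var alpha l).
  have := alpha_var_ge0 V2 kappa_gt0 kappa_lt l.
  rewrite le_eqVlt => /predU1P[<-|v0]; first by rewrite mule0 lee_fin.
  have v0' : (0 <= (alpha_var alpha l)%:E)%E by rewrite lee_fin ltW.
  apply: le_trans (lee_wpmul2r v0' (key v0)) _.
  by rewrite -EFinM divfK// gt_eqF.
move=> v0; have kv0 : 0 < k * alpha_var alpha l by rewrite mulr_gt0.
(* k times [alpha_var] is the Dirichlet variance of [lin l], so s normalises it to 1. *)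
pose s := (Num.sqrt (k * alpha_var alpha l))^-1.
have s2 : s ^+ 2 * (k * alpha_var alpha l) = 1.
  by rewrite exprVn sqr_sqrtr ?(ltW kv0)// mulVf// gt_eqF.
pose l' x := s * l x.
have lE : lin l' = fun e => s * lin l e.
  by apply/funext => e; rewrite /lin mulr_sumr; apply: eq_bigr => x _; rewrite mulrA.
have bl := @bounded_on_lin R V l.
have b' := @bounded_on_lin R V l'.
apply: ereal_inf_lbound; exists (lin l').
  split; first by exists 0, l' => e; rewrite add0r.
  apply/centered_norm_eq1; first exact: (bounded_square_integrable mS D1).
  apply: etrans (expectation_sqr_center mS D1 b') _.
  rewrite kv -s2 mulrCA; congr (_ * _).
  rewrite /alpha_var mulrBr; congr (_ - _).
    by rewrite mulr_sumr; apply: eq_bigr => x _; rewrite /l' exprMn mulrCA.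
  rewrite (_ : \sum_x alpha x * l' x = s * \sum_x alpha x * l x) ?exprMn ?mulrA//.
  by rewrite mulr_sumr; apply: eq_bigr => x _; rewrite /l' mulrCA.
rewrite (dirichlet_formE V2 kappa_gt0 kappa_lt); last exact: (bounded_square_integrable mS D1).
congr EFin; apply: (canRL (mulfK (lt0r_neq0 v0))).
transitivity ((s ^+ 2 * (k * alpha_var alpha l)) * edges l); last by rewrite s2 mul1r.
rewrite (_ : form _ _ _ _ = s ^+ 2 * k * edges l); first by ring.
rewrite mulr_sumr; apply: eq_bigr => x _; rewrite mulr_sumr; apply: eq_bigr => y /rank_lt_neq xy.
by rewrite (ke x y l' xy) /l' -mulrBr exprMn; field.
Qed.

Lemma gap1_fin : exists2 G : R, 0 <= G & gap1 = G%:E.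
Proof.
have g0 : (0 <= gap1)%E.
  apply: le_ereal_inf_tmp => _ [f [fl _] <-].
  rewrite (dirichlet_formE V2 kappa_gt0 kappa_lt) ?lee_fin ?form_ge0//.
  exact: deg_le1_square_integrable.
have [x _] := card_gt0P (ltnW V2).
have [y yx] : exists y : V, y != x.
  move: V2; rewrite (cardD1 x) inE add1n ltnS => /card_gt0P[y].
  by rewrite !inE andbT => yx; exists y.
have v0 : 0 < alpha_var alpha (fun z => (z == x)%:R).
  rewrite (alpha_varE V2 kappa_gt0 kappa_lt).
  set m := _ / _.
  rewrite (bigD1 x)//= (bigD1 y yx)/= eqxx (negbTE yx).
  have h0 : 0 <= \sum_(i | (i != x) && (i != y)) alpha i * ((i == x)%:R - m) ^+ 2.
    by apply: sumr_ge0 => z _; rewrite mulr_ge0 ?sqr_ge0// ltW.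
  (* The terms at x and at y are positive multiples of (1 - m)^2 and m^2, which do not vanish
     together. *)
  rewrite addrA ltr_pwDl//; have [m0|m0] := eqVneq m 0.
    by rewrite m0 subrr subr0 expr0n mulr0 addr0 expr1n mulr1.
  apply: ltr_wpDl; first by rewrite mulr_ge0 ?sqr_ge0// ltW.
  by rewrite mulr_gt0// lt_neqAle sqr_ge0 andbT eq_sym sqrf_eq0 sub0r oppr_eq0.
have [_ /(_ v0)[r gr]] := gap1_le_edges (fun z => (z == x)%:R).
have fg : gap1 \is a fin_num by rewrite ge0_fin_numE// (le_lt_trans gr)// ltry.
by exists (fine gap1); rewrite ?fine_ge0// fineK.
Qed.

Lemma gap_le_gap1 : (gap c alpha kappa <= gap1)%E.
Proof.
apply: le_ereal_inf => _ [f [fl fn] <-]; exists f => //; split=> //.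
exact/square_integrable_Lfun2/deg_le1_square_integrable.
Qed.

Lemma gap_ge (m G : R) : 0 <= m <= 1 -> 0 <= G -> gap1 = G%:E ->
  (forall x y, x != y -> 0 < c x y -> m <= edge_gamma alpha kappa x y) ->
  (m%:E * gap1 <= gap c alpha kappa)%E.
Proof.
move=> m01 G0 gG hm; apply: le_ereal_inf_tmp => _ [f [/Lfun2_square_integrable lf fn] <-].
rewrite (dirichlet_formE V2 kappa_gt0 kappa_lt)// gG -EFinM lee_fin.
have hG l : G * alpha_var alpha l <= edges l.
  by have [+ _] := gap1_le_edges l; rewrite gG -EFinM lee_fin.
have lh := square_integrableB lf (square_integrable_cst D (mean alpha f)).
have h0 : \int[D]_e (f e - mean alpha f) = 0.
  rewrite RintegralB//; last 2 first.
  - exact: square_integrable_integrable.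
  - exact: square_integrable_integrable (square_integrable_cst D _).
  by rewrite expectation_cst subrr.
have := l2_spectral V2 c_ge0 kappa_gt0 kappa_lt m01 G0 hm hG lh h0.
by rewrite form_shift (proj1 (centered_norm_eq1 lf) fn) mulr1.
Qed.

End affine_gap.

Theorem theorem1p3 (R : realType) (V : finType)
    (c : V -> V -> R) (alpha : V -> R) (kappa : R)
    (V_ge2 : (2 <= #|V|)%N)
    (c_sym : forall x y, c x y = c y x)
    (c_ge0 : forall x y, 0 <= c x y)
    (c_diag : forall x, c x x = 0)
    (c_conn : forall x y, connect (fun u v => 0 < c u v) x y)
    (alpha_gt0 : forall x, 0 < alpha x)
    (kappa_bounds : 0 < kappa < alpha_min alpha) :
  ((Order.min 1 (gamma_IEM c alpha kappa))%:E * gap1 c alpha kappa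
     <= gap c alpha kappa <= gap1 c alpha kappa)%E.
Proof.
have /andP[kappa_gt0 kappa_lt_min] := kappa_bounds.
have kappa_lt x : kappa < alpha x.
  apply: lt_le_trans kappa_lt_min _; apply: ge_inf; last by exists x.
  by exists 0 => _ [y _ <-]; exact: ltW.
rewrite gap_le_gap1// andbT.
have term_ge0 z : 0 <= (alpha z - kappa) / (alpha z + 1).
  by apply: divr_ge0; [rewrite subr_ge0 ltW|rewrite addr_ge0// ltW].
have factor_ge0 : 0 <= 1 + (\sum_x alpha x)^-1.
  by rewrite addr_ge0// invr_ge0 sumr_ge0// => x _; exact: ltW.
pose E := [set (alpha p.1 - kappa) / (alpha p.1 + 1) +
               (alpha p.2 - kappa) / (alpha p.2 + 1)
          | p in [set p : V * V | p.1 != p.2 /\ 0 < c p.1 p.2]].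
have gammaE : gamma_IEM c alpha kappa = inf E * (1 + (\sum_x alpha x)^-1) by [].
have E_ge0 : lbound E 0 by move=> _ [p _ <-]; rewrite addr_ge0.
(* [inf] of the empty set is 0, so the sign holds in either case. *)
have inf_ge0 : 0 <= inf E.
  have [->|/set0P nE] := eqVneq E set0; first by rewrite inf0.
  exact: lb_le_inf.
have [G G0 gG] := gap1_fin V_ge2 c_ge0 kappa_gt0 kappa_lt.
apply: (gap_ge V_ge2 c_ge0 kappa_gt0 kappa_lt _ G0 gG) => [|x y xy cxy].
  by rewrite le_min ler01 ge_min lexx gammaE mulr_ge0.
apply: (@le_trans _ _ (gamma_IEM c alpha kappa)); first by rewrite ge_min lexx orbT.
rewrite gammaE /edge_gamma ler_wpM2r//; apply: ge_inf; first by exists 0.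
by exists (x, y).
Qed.
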